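(* Let $X=\{X_t\}_{t\in\mathbb{R}^N_+}$ be an $N$-parameter additive Lévy process in $\mathbb{R}^d$ with Lévy exponent $(\Psi_1,\dots,\Psi_N)$. Then $$E\{\lambda_d(X(\mathbb{R}^N_+))\}>0\quad\Longleftrightarrow\quad \int_{\mathbb{R}^d}\prod_{j=1}^N\mathrm{Re}\left(\frac{1}{1+\Psi_j(\xi)}\right)d\xi<\infty .$$
   Context: $\mathbb{R}_+=[0,\infty)$ and $\lambda_d$ denotes Lebesgue measure on $\mathbb{R}^d$. A Lévy process $Y$ in $\mathbb{R}^d$ (started at $0$) has Lévy exponent $\Psi$ if $E e^{i\xi\cdot Y_t}=e^{-t\Psi(\xi)}$ for all $t\ge 0$, $\xi\in\mathbb{R}^d$. An $N$-parameter additive Lévy process in $\mathbb{R}^d$ with Lévy exponent $(\Psi_1,\dots,\Psi_N)$ is the random field $X_t=X^1_{t_1}+X^2_{t_2}+\cdots+X^N_{t_N}$, $t=(t_1,\dots,t_N)\in\mathbb{R}^N_+$, where $X^1,\dots,X^N$ are independent Lévy processes in $\mathbb{R}^d$ with respective Lévy exponents $\Psi_1,\dots,\Psi_N$. $X(\mathbb{R}^N_+)=\{X_t:t\in\mathbb{R}^N_+\}$ is the range of $X$. *)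

(* Defs.v *)
From HB Require Import structures.
From mathcomp Require Import all_boot all_order all_algebra.
From mathcomp Require Import all_classical all_reals all_analysis.
From mathcomp Require Import complex.

Set Implicit Arguments.
Unset Strict Implicit.
Unset Printing Implicit Defensive.

Import Order.TTheory GRing.Theory Num.Theory.
Import numFieldNormedType.Exports.

Local Open Scope classical_set_scope.
Local Open Scope ring_scope.

Section lebesgue_rV.
Context (R : realType) (d : nat).

(* The dimension is d.+1, as a box in 'rV[R]_0 would never be empty. *)
Local Notation V := 'rV[R]_d.+1.

Definition box (I : V * V) : set V :=
  [set x | forall i, I.1 ord0 i <= x ord0 i <= I.2 ord0 i].

Definition box_volume (I : V * V) : R :=
  \prod_i Num.max 0 (I.2 ord0 i - I.1 ord0 i).

Definition box_cover (A : set V) : set (nat -> V * V) :=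
  [set I | A `<=` \bigcup_k box (I k)].

Definition lebesgue_outer_rV (A : set V) : \bar R :=
  ereal_inf [set (\sum_(k <oo) (box_volume (I k))%:E)%E | I in box_cover A].

Lemma box_volume_ge0 I : 0 <= box_volume I.
Proof. by apply: prodr_ge0 => i _; rewrite le_max lexx. Qed.

Local Open Scope ereal_scope.

Lemma lebesgue_outer_rV_ge0 A : 0 <= lebesgue_outer_rV A.
Proof.
apply: le_ereal_inf_tmp => _ [I _ <-]; apply: nneseries_ge0 => k _ _.
by rewrite lee_fin box_volume_ge0.
Qed.

Lemma lebesgue_outer_rV0 : lebesgue_outer_rV set0 = 0.
Proof.
apply/eqP; rewrite eq_le lebesgue_outer_rV_ge0 andbT.
apply: ereal_inf_lbound; exists (fun=> (0%R, 0%R)); first by move=> x [].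
apply: eseries0 => k _ _.
by rewrite /box_volume big_ord_recl/= mxE subrr maxxx mul0r.
Qed.

Lemma le_lebesgue_outer_rV :
  {homo lebesgue_outer_rV : A B / A `<=` B >-> A <= B}.
Proof.
move=> A B AB; apply/ereal_inf_le_tmp => _ [I BI <-].
by exists I => //; apply: subset_trans AB BI.
Qed.

Lemma lebesgue_outer_rV_sigma_subadditive :
  sigma_subadditive lebesgue_outer_rV.
Proof.
move=> A; have [[i ioo]|] := pselect (exists i, lebesgue_outer_rV (A i) = +oo).
  rewrite (eseries_pinfty _ _ ioo) ?leey// => n _.
  by rewrite -ltNye (lt_le_trans _ (lebesgue_outer_rV_ge0 _)).
rewrite -forallNE => Aoo.
suff add2e (e : {posnum R}) : lebesgue_outer_rV (\bigcup_n A n) <=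
    \sum_(i <oo) lebesgue_outer_rV (A i) + e%:num%:E.
  by apply/lee_addgt0Pr => _/posnumP[].
rewrite (le_trans _ (epsilon_trick _ _ _))//; last first.
  by move=> n; exact: lebesgue_outer_rV_ge0.
pose vol I := (box_volume I)%:E.
have vol_ge0 I : 0 <= vol I by rewrite lee_fin box_volume_ge0.
pose Q n (B : nat -> V * V) := box_cover (A n) B /\
  \sum_(k <oo) vol (B k) <=
    lebesgue_outer_rV (A n) + (e%:num / (2 ^ n.+1)%:R)%:E.
have [G QG] : {G : nat -> nat -> V * V & forall n, Q n (G n)}.
  apply: (@choice _ _ Q) => n; rewrite /Q /lebesgue_outer_rV.
  set S := (X in ereal_inf X); move infS : (ereal_inf S) => iS.
  case: iS infS => [r Sr|Soo|Soo].
  - have en1 : (0 < e%:num / (2 ^ n.+1)%:R)%R by [].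
    have /(lb_ereal_inf_adherent en1) : ereal_inf S \is a fin_num by rewrite Sr.
    move=> [_ [B AnB <-] xS].
    by exists B; split => //; rewrite -Sr; exact/ltW.
  - by have := Aoo n; rewrite /lebesgue_outer_rV Soo.
  - suff : lbound S 0 by move/le_ereal_inf_tmp; rewrite Soo.
    by move=> /= _ [B AnB <-]; apply: nneseries_ge0 => *; exact: vol_ge0.
have volG_ge0 x : 0 <= (vol \o uncurry G) x by exact: vol_ge0.
apply: (@le_trans _ _ (\esum_(i in setT) (vol \o uncurry G) i)).
  apply: ereal_inf_lbound => /=.
  have /card_esym/ppcard_eqP[f] := card_nat2.
  exists (uncurry G \o f).
    move=> t [i _] /(QG i).1[j _ Bijt]; exists (f^-1%FUN (i, j)) => //=.
    by rewrite invK ?inE.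
  rewrite -(esum_pred_image (vol \o uncurry G) _ xpredT) ?[fun=> _]set_true//.
  by rewrite image_eq.
rewrite (_ : esum _ _ = \sum_(i <oo) \sum_(j <oo ) vol (G i j)); last first.
  pose J : nat -> set (nat * nat) := fun i => [set (i, j) | j in setT].
  rewrite (_ : setT = \bigcup_k J k); last first.
    by rewrite predeqE => -[a b]; split => // _; exists a => //; exists b.
  rewrite esum_bigcupT /=; last 2 first.
    - apply/trivIsetP => i j _ _ ij.
      rewrite predeqE => -[n m] /=; split => //= -[] [_] _ [<-{n} _].
      by move=> [m' _] [] /esym/eqP; rewrite (negbTE ij).
    - by move=> /= [n m]; exact: vol_ge0.
  rewrite -(image_id [set: nat]) -fun_true esum_pred_image//; last first.
    by move=> n _; exact: esum_ge0.
  apply: eq_eseriesr => /= j _.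
  rewrite -(esum_pred_image (vol \o uncurry G) (pair j) predT)//=; last first.
    by move=> ? ? _ _; exact: (@can_inj _ _ _ snd).
  by congr esum; rewrite predeqE => -[a b]; split; move=> [i _ <-]; exists i.
apply: lee_lim.
- apply: is_cvg_nneseries => n *.
  by apply: nneseries_ge0 => m *; exact: vol_ge0.
- apply: is_cvg_nneseries => n *; apply: adde_ge0 => //.
  exact: lebesgue_outer_rV_ge0.
- by near=> n; apply: lee_sum => i _; exact: (QG i).2.
Unshelve. all: by end_near. Qed.

HB.instance Definition _ := isOuterMeasure.Build R V lebesgue_outer_rV
  lebesgue_outer_rV0 lebesgue_outer_rV_ge0 le_lebesgue_outer_rV
  lebesgue_outer_rV_sigma_subadditive.

(* By Caratheodory's theorem, the measurable sets are the Lebesgue measurable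
   sets, and the measure is complete. *)
Definition lebesgue_measure_rV
    (A : set (caratheodory_type lebesgue_outer_rV)) : \bar R :=
  lebesgue_outer_rV A.

HB.instance Definition _ := isMeasure.Build _ _ _ lebesgue_measure_rV
  (@caratheodory_measure0 _ _ lebesgue_outer_rV)
  (@caratheodory_measure_ge0 _ _ lebesgue_outer_rV)
  (@caratheodory_measure_sigma_additive _ _ lebesgue_outer_rV).

End lebesgue_rV.

Arguments lebesgue_measure_rV : clear implicits.

Section complex_exponential.
Context {R : realType}.
Local Open Scope complex_scope.

Definition cexp (z : R[i]) : R[i] :=
  (expR (complex.Re z))%:C * (cos (complex.Im z) +i* sin (complex.Im z)).

Definition cexpectation {dO} {Omega : measurableType dO}
    (P : probability Omega R) (Z : Omega -> R[i]) : R[i] :=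
  (\int[P]_w complex.Re (Z w)) +i* (\int[P]_w complex.Im (Z w)).

End complex_exponential.

Definition dot {R : pzRingType} {d} (x y : 'rV[R]_d) : R :=
  \sum_i x ord0 i * y ord0 i.

Section levy.
Context {dO : measure_display} {Omega : measurableType dO} {R : realType}.
Context (P : probability Omega R).

Definition borel_rV d : set (set 'rV[R]_d) := <<s [set U | open U] >>.

Definition sigma_vector d (Z : Omega -> 'rV[R]_d) : set (set Omega) :=
  [set Z @^-1` B | B in @borel_rV d].

Definition sigma_process d (Y : R -> Omega -> 'rV[R]_d) : set (set Omega) :=
  <<s [set A | exists2 t : R, 0 <= t & sigma_vector (Y t) A] >>.

Definition mutually_independent (J : finType) (F : J -> set (set Omega)) :=
  forall (K : {set J}) (A : J -> set Omega),
    (forall j, j \in K -> F j (A j)) ->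
    P (\bigcap_(j in [set` K]) A j) = (\prod_(j in K) P (A j))%E.

Record levy_process d (Y : R -> Omega -> 'rV[R]_d) : Prop := {
  levy_measurable : forall t : R, 0 <= t -> sigma_vector (Y t) `<=` measurable ;
  levy_start0 : {ae P, forall w, Y 0 w = 0} ;
  levy_independent_increments : forall (t : nat -> R) n,
    0 <= t 0%N -> {homo t : k l / (k <= l)%N >-> k <= l} ->
    mutually_independent
      (fun k : 'I_n => sigma_vector (Y (t k.+1) \- Y (t k))) ;
  levy_stationary_increments : forall (s t : R) B,
    0 <= s -> 0 <= t -> borel_rV B ->
    P ((Y (s + t) \- Y s) @^-1` B) = P (Y t @^-1` B) ;
  levy_cadlag : {ae P, forall w,
    (forall t : R, 0 <= t -> Y s w @[s --> t^'+] --> Y t w) /\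
    (forall t : R, 0 < t -> cvg (Y s w @[s --> t^'-]))} }.

Definition has_levy_exponent d (Y : R -> Omega -> 'rV[R]_d)
    (Psi : 'rV[R]_d -> R[i]) :=
  forall (t : R) xi, 0 <= t ->
    cexpectation P (fun w => cexp ('i%C * (dot xi (Y t w))%:C%C)) =
    cexp (- (t%:C%C * Psi xi)).

Definition orthant N : set 'rV[R]_N := [set t | forall j, 0 <= t ord0 j].

(* Only the values of X on the orthant are meaningful. *)
Definition additive_levy_process N d (X : 'rV[R]_N -> Omega -> 'rV[R]_d)
    (Psi : 'I_N -> 'rV[R]_d -> R[i]) : Prop :=
  exists Y : 'I_N -> R -> Omega -> 'rV[R]_d,
    [/\ forall j, levy_process (Y j),
        forall j, has_levy_exponent (Y j) (Psi j),
        mutually_independent (fun j => sigma_process (Y j)) &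
        forall t w, orthant t -> X t w = \sum_j Y j (t ord0 j) w].

(* The range of a path need not be Borel, but for almost every w it is
   analytic, hence measurable for the complete measure lebesgue_measure_rV.
   Likewise w |-> lebesgue_measure_rV R d (path_range X w) is measurable only
   for the completion of P in general; as \int[P] of a nonnegative function is
   a supremum over simple functions below it, it is the integral with respect
   to that completion. *)
Definition path_range N d (X : 'rV[R]_N -> Omega -> 'rV[R]_d) (w : Omega) :
    set 'rV[R]_d :=
  [set X t w | t in @orthant N].

End levy.

(* Main.v *)
(* Let rho = prod_j Re (1 / (1 + Psi_j)), and smooth with the Cauchy kernel
   pk e, whose Fourier transform qk e (xi) = exp (- e * sum_i |xi_i|) increases
   to 1 as e decreases to 0.  Sampling the processes at the times a * 2^-k with
   geometric weights of total mass about 1, the expected pk e-energy of the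
   occupation measure converges to the integral of qk e * rho.

   If that integral stays bounded, Fatou gives paths whose discrete energies
   stay bounded along a subsequence, and a capacity estimate then bounds below
   the volume of every cover of the range.

   Conversely, suppose that the walk at a multi-index k is close to x.  Given
   the position at k, the expected occupation near x of each of the 2^n quadrants
   with corner k is a potential which need not be positive term by term in
   Fourier space, but whose sum over the quadrants has the positive symbol
   prod_j 2 Re (1 / (1 + Psi_j)); so no symmetry of the processes is needed.
   Lebesgue measure times the law of the increments is stationary, and Cairoli's
   inequality (iterated Doob maximal inequalities) in L^2 for each quadrant yields
     (measure of the neighbourhood of the range) * (int qk e * rho)^2
       <= C * int qk e * rho,
   which bounds the last integral uniformly in e. *)

Require Import Defs.
From HB Require Import structures.
From mathcomp Require Import all_boot all_order all_algebra.
From mathcomp Require Import all_classical all_reals all_analysis.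
From mathcomp Require Import complex.
From mathcomp Require Import measurable_realfun.
From mathcomp Require Import ring lra zify.

Set Implicit Arguments.
Unset Strict Implicit.
Unset Printing Implicit Defensive.

Import Order.TTheory GRing.Theory Num.Theory.
Import numFieldNormedType.Exports.

Local Open Scope classical_set_scope.
Local Open Scope ring_scope.

(** * Borel vectors and finite families *)

(** The Cauchy kernel is chosen for its heavy tails: a shift by at most [e] changes [pk e] by a
    bounded factor only, and its self-convolution is at most a constant times [pk e] at the same
    scale. A Gaussian has neither property. So one kernel at one scale serves the hitting bound, the
    L^2 bound and the energy. Finite arrays of increments replace continuous time, so that a
    conditional expectation is an integral over resampled coordinates and every maximum is finite.
    The price is that the weights live on finite windows: the array must extend beyond the times of
    interest on both sides, and the lower bound holds over [0, T]^N only, with a constant that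
    degenerates as T grows. The range is therefore covered by its parts over [0, T]^N, T = 0, 1, 2,
    ... The final inequality sets a square against a first power. It can be divided through because
    the integral of [qk e] times rho is finite for each e > 0: [qk e] is integrable and 0 <= rho <=
    1. The range may fail to be Borel and its volume may fail to be a measurable function, so it is
    compared from above with Borel neighbourhoods of discretised paths and from below through
    arbitrary covers. *)

Definition brv (R : realType) d := g_sigma_algebraType [set U : set 'rV[R]_d | open U].

(** Rectangles form a pi-system, so a probability on [fprod] is determined by its values on them. *)
Definition rect d (T : measurableType d) (J : finType) : set (set (J -> T)) :=
  [set A | exists2 B : J -> set T, (forall i, measurable (B i)) &
     A = [set v | forall i, B i (v i)]].

Definition fprod d (T : measurableType d) (J : finType) :=
  g_sigma_algebraType (@rect d T J).

Section brv.
Context {R : realType} {d : nat}.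

Lemma measurable_coord (i : 'I_d) :
  measurable_fun setT (fun x : brv R d => x ord0 i).
Proof.
apply: (measurability _ (RGenOpens.measurableE R)).
move=> _ [_ [a [b ->] <-]]; rewrite setTI; apply: sub_sigma_algebra => /=.
apply: open_comp; last exact: interval_open.
by move=> x _; exact: coord_continuous.
Qed.

(** An open set is the countable union of the rational cubes [B c] that it contains, and the
    preimage of a cube is a finite intersection of preimages of intervals under the coordinates. *)
Lemma measurable_fun_brvP dT (T : measurableType dT) (f : T -> brv R d) :
  (forall i, measurable_fun setT (fun t => f t ord0 i)) ->
  measurable_fun setT f.
Proof.
move=> mf; apply: (@measurability _ _ _ (brv R d) setT f [set U : set 'rV[R]_d | open U] erefl).
move=> _ [U oU <-]; rewrite setTI.
pose B (c : 'rV[rat]_d * nat) := [set x : 'rV[R]_d |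
  forall i, `|x ord0 i - ratr (c.1 ord0 i)| < c.2.+1%:R^-1].
have -> : U = \bigcup_c (if pselect (B c `<=` U) then B c else set0).
  rewrite eqEsubset; split=> [x Ux|x [c _]]; last first.
    by case: pselect => // BU /BU.
  have /nbhs_ballP[e e0 eU] : nbhs x U by exact: open_nbhs_nbhs.
  have [k ke] : exists k : nat, (k.+1%:R^-1 : R) < e / 2.
    exists (Num.truncn (e / 2)^-1).
    by rewrite invf_plt ?posrE ?divr_gt0// truncnS_gt.
  have /choice[q qx] : forall i, exists q : rat,
      `|x ord0 i - ratr q| < k.+1%:R^-1.
    move=> i; have : x ord0 i - k.+1%:R^-1 < x ord0 i + k.+1%:R^-1.
      by rewrite ltrD2l gtrN// invr_gt0.
    move=> /rat_in_itvoo[q]; rewrite in_itv/= => /andP[q1 q2].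
    by exists q; rewrite distrC ltr_distl q1 q2.
  exists (\row_i q i, k) => //; case: pselect => [BU|]; last first.
    case=> y By; apply: eU; split=> [|a i]; [by []|rewrite [a]ord1].
    rewrite -ball_normE/=; have := By i; rewrite /= mxE => yq.
    rewrite (splitr e) -(subrK (ratr (q i)) (x ord0 i)) -addrA.
    rewrite (le_lt_trans (ler_normD _ _))// ltrD ?(lt_trans (qx i))//.
    by rewrite distrC (lt_trans yq).
  by move=> i; rewrite /= mxE.
rewrite preimage_bigcup; apply: countable_bigcupT_measurable.
  exact: countableP.
move=> c; case: pselect => [BU|?]; last by rewrite preimage_set0.
have -> : f @^-1` B c = \bigcap_(i in [set: 'I_d])
    ((fun t => f t ord0 i) @^-1` ball (ratr (c.1 ord0 i) : R) c.2.+1%:R^-1).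
  rewrite eqEsubset; split=> [t Bt i _|t Bt i] /=.
    by rewrite -ball_normE/= distrC; exact: Bt.
  by have := Bt i Logic.I; rewrite /= -ball_normE/= distrC.
apply: fin_bigcap_measurable => // i _; rewrite -[X in measurable X]setTI.
by apply: mf => //; by apply: open_measurable; exact: ball_open.
Qed.

End brv.

Section fprod.
Context d (T : measurableType d) (J : finType).

Lemma rect_setI : setI_closed (@rect d T J).
Proof.
move=> _ _ [A mA ->] [B mB ->]; exists (fun i => A i `&` B i).
  by move=> i; exact: measurableI.
by rewrite eqEsubset; split=> v /= => [[Av Bv] i|ABv]; [|split=> i; have [] := ABv i].
Qed.

Lemma measurable_fproj (i : J) : measurable_fun setT (fun v : fprod T J => v i).
Proof.
move=> _ B mB; rewrite setTI; apply: sub_sigma_algebra.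
exists (fun l => if l == i then B else setT).
  by move=> l; case: eqP.
rewrite eqEsubset; split=> v /= => [Bv l|/(_ i)]; last by rewrite eqxx.
by case: eqP => // ->.
Qed.

Lemma measurable_fun_fprodP d' (S : measurableType d') (f : S -> fprod T J) :
  (forall i, measurable_fun setT (fun s => f s i)) -> measurable_fun setT f.
Proof.
move=> mf; apply: (@measurability _ _ _ (fprod T J) setT f (@rect d T J) erefl).
move=> _ [_ [B mB ->] <-]; rewrite setTI.
have -> : f @^-1` [set v | forall i, B i (v i)] =
    \bigcap_(i in [set: J]) ((fun s => f s i) @^-1` B i).
  by rewrite eqEsubset; split=> [t Bt i _|t Bt i] /=; [exact: Bt|exact: Bt].
apply: fin_bigcap_measurable => // i _; rewrite -[X in measurable X]setTI.
exact: mf.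
Qed.

End fprod.

(** * Product Lebesgue measure on row vectors *)

Section product_lebesgue.
Context {R : realType}.
Local Open Scope ereal_scope.

Definition rv_cons d (p : R * 'rV[R]_d) : 'rV[R]_d.+1 :=
  \row_i (if unlift ord0 i is Some j then p.2 ord0 j else p.1).

Lemma rv_cons0 d a (v : 'rV[R]_d) : rv_cons (a, v) ord0 ord0 = a.
Proof. by rewrite mxE unlift_none. Qed.

Lemma rv_consS d a (v : 'rV[R]_d) j : rv_cons (a, v) ord0 (lift ord0 j) = v ord0 j.
Proof. by rewrite mxE liftK. Qed.

Lemma measurable_rv_cons d :
  measurable_fun [set: measurableTypeR R * brv R d] (@rv_cons d : _ -> brv R d.+1).
Proof.
apply: measurable_fun_brvP => i; have [j ->|->] := unliftP ord0 i.
  rewrite (_ : (fun t => _) = (fun x : brv R d => x ord0 j) \o snd).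
    by apply: measurableT_comp => //; exact: measurable_coord.
  by apply/funext => -[a v]; rewrite rv_consS.
rewrite (_ : (fun t => _) = fst); first exact: measurable_fst.
by apply/funext => -[a v]; rewrite rv_cons0.
Qed.

Section product_sigma_finite.
Context d1 d2 (T1 : measurableType d1) (T2 : measurableType d2).
Context (m1 : {sigma_finite_measure set T1 -> \bar R}).
Context (m2 : {sigma_finite_measure set T2 -> \bar R}).

Lemma sigma_finite_prod : sigma_finite setT (m1 \x m2).
Proof.
have /sigma_finiteP[F [FT ndF Foo]] := sigma_finiteT m1.
have /sigma_finiteP[G [GT ndG Goo]] := sigma_finiteT m2.
exists (fun n => F n `*` G n).
  rewrite eqEsubset; split=> // -[x y] _.
  have [[n _ Fx] [k _ Gy]] : (\bigcup_n F n) x /\ (\bigcup_n G n) y.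
    by rewrite -FT -GT.
  exists (maxn n k) => //; split; last by move: y Gy; exact/subsetPset/ndG/leq_maxr.
  by move: x Fx; exact/subsetPset/ndF/leq_maxl.
move=> k; have [mF ?] := Foo k; have [mG ?] := Goo k.
split; first exact: measurableX.
by rewrite product_measure1E// lte_mul_pinfty// ge0_fin_numE.
Qed.

HB.instance Definition _ := Measure_isSigmaFinite.Build _ _ _
  (m1 \x m2) sigma_finite_prod.

End product_sigma_finite.

Section next.
Context d (m : {sigma_finite_measure set (brv R d) -> \bar R}).

Definition nu_cons : set (brv R d.+1) -> \bar R :=
  pushforward (@lebesgue_measure R \x m) (@rv_cons d : _ -> brv R d.+1).

HB.instance Definition _ := Measure.copy nu_cons
  (measure_function_pushforward__canonical__measure_function_Measure
     (@lebesgue_measure R \x m) (@measurable_rv_cons d)).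

Lemma nu_cons_sigma_finite : sigma_finite setT nu_cons.
Proof.
have [F FT mF] := sigma_finite_prod (@lebesgue_measure R) m.
pose g (x : brv R d.+1) : measurableTypeR R * brv R d :=
  (x ord0 ord0, \row_j x ord0 (lift ord0 j)).
have mg : measurable_fun setT g.
  apply: measurable_fun_pair; first exact: measurable_coord.
  apply: measurable_fun_brvP => i.
  rewrite (_ : (fun t => _) = fun x : brv R d.+1 => x ord0 (lift ord0 i)).
    exact: measurable_coord.
  by apply/funext => x; rewrite mxE.
exists (fun k => g @^-1` F k).
  by rewrite -preimage_bigcup -FT preimage_setT.
move=> k; split; first by rewrite -[X in measurable X]setTI; apply: mg => //; exact: (mF k).1.
have -> : nu_cons (g @^-1` F k) = (@lebesgue_measure R \x m) (F k).
  rewrite /nu_cons /pushforward; congr (_ _).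
  suff E x : g (rv_cons x) = x by rewrite eqEsubset; split=> x /=; rewrite E.
  case: x => a v; rewrite /g rv_cons0; congr pair.
  by apply/rowP => j; rewrite mxE rv_consS.
exact: (mF k).2.
Qed.

HB.instance Definition _ := Measure_isSigmaFinite.Build _ _ _
  nu_cons nu_cons_sigma_finite.

End next.

(** Lebesgue measure as an iterated product, so that Tonelli's theorem allows induction on the
    dimension; the unit mass in dimension 0 starts the recursion. [lamE] identifies it with the
    outer measure on Borel sets. *)
Fixpoint nu d : {sigma_finite_measure set (brv R d) -> \bar R} :=
  match d with
  | 0%N => @dirac _ (brv R 0) (0%R : 'rV[R]_0) R
  | d'.+1 => nu_cons (nu d')
  end.

Lemma integral_nuS d (f : brv R d.+1 -> \bar R) :
  measurable_fun setT f -> (forall x, 0 <= f x) ->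
  \int[nu d.+1]_x f x = \int[@lebesgue_measure R]_a \int[nu d]_v f (rv_cons (a, v)).
Proof.
move=> mf f0; rewrite ge0_integral_pushforward//; last exact: measurable_rv_cons.
rewrite preimage_setT fubini_tonelli1//.
  by apply: measurableT_comp => //; exact: measurable_rv_cons.
by move=> x /=; exact: f0.
Qed.

Lemma measurable_prod_coord d (f : 'I_d -> R -> R) :
  (forall i, measurable_fun setT (f i)) ->
  measurable_fun setT (fun x : brv R d => \prod_i f i (x ord0 i))%R.
Proof.
move=> mf; apply: measurable_prod => i _.
by apply: measurableT_comp; [exact: mf|exact: measurable_coord].
Qed.

Lemma integral_nu_prod d (f : 'I_d -> R -> R) :
  (forall i, measurable_fun setT (f i)) -> (forall i x, 0 <= f i x)%R ->
  \int[nu d]_x (\prod_i f i (x ord0 i))%:E =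
  \prod_i \int[@lebesgue_measure R]_a (f i a)%:E.
Proof.
elim: d f => [|d IH] f mf f0.
  rewrite big_ord0 (eq_integral (cst 1)) ?integral_cst//= ?diracT ?mul1e//.
  by move=> x _; rewrite big_ord0.
rewrite integral_nuS; last 2 first.
- by apply/measurable_EFinP; exact: measurable_prod_coord.
- by move=> x; rewrite lee_fin; exact: prodr_ge0.
rewrite big_ord_recl -IH//.
transitivity (\int[@lebesgue_measure R]_a ((f ord0 a)%:E *
    \int[nu d]_v (\prod_i f (lift ord0 i) (v ord0 i))%:E)).
  apply: eq_integral => a _; rewrite -ge0_integralZl//; last 3 first.
  - apply/measurable_EFinP.
    by apply: (@measurable_prod_coord d (fun i => f (lift ord0 i))).
  - by move=> x _; rewrite lee_fin; exact: prodr_ge0.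
  - by rewrite lee_fin.
  apply: eq_integral => v _; rewrite big_ord_recl rv_cons0 -EFinM.
  by congr (_ * _)%:E; apply: eq_bigr => j _; rewrite rv_consS.
rewrite ge0_integralZr//.
- by apply/measurable_EFinP; exact: mf.
- by move=> x _; rewrite lee_fin.
- by apply: integral_ge0 => x _; rewrite lee_fin; exact: prodr_ge0.
Qed.

End product_lebesgue.

(** Cutting the interval [u, v] at [a] splits its length, also when the interval is empty or lies on
    one side of [a]. *)
Lemma max0_clip (R : realDomainType) (u v a : R) :
  Num.max 0 (v - u) = Num.max 0 (v - Num.max a u) + Num.max 0 (Num.min a v - u).
Proof.
by case: (ltP a u) => ?; case: (ltP a v) => ?;
  do 3?case: (ltP 0 _) => ?; lra.
Qed.

Section lebesgue_rV.
Context {R : realType} {d : nat}.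
Local Notation V := 'rV[R]_d.+1.
Local Open Scope ereal_scope.
Local Notation lam := (@lebesgue_outer_rV R d).

Lemma measurable_box (I : V * V) : measurable (box I : set (brv R d.+1)).
Proof.
have -> : box I = \bigcap_(i in [set: 'I_d.+1])
    ((fun x : brv R d.+1 => x ord0 i) @^-1` `[I.1 ord0 i, I.2 ord0 i]).
  rewrite eqEsubset; split=> x /= Ix i; first by move=> _ /=; rewrite in_itv/=.
  by have := Ix i Logic.I; rewrite /= in_itv.
apply: fin_bigcap_measurable => // i _; rewrite -[X in measurable X]setTI.
by apply: measurable_coord => //; exact: measurable_itv.
Qed.

Lemma nu_box (I : V * V) : nu d.+1 (box I) = (box_volume I)%:E.
Proof.
pose f i (a : R) : R := \1_(`[I.1 ord0 i, I.2 ord0 i]%classic) a.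
have -> : nu d.+1 (box I) = \int[nu d.+1]_x (\prod_i f i (x ord0 i))%:E.
  rewrite -[box I]setIT -integral_indic//; last exact: measurable_box.
  apply: eq_integral => x _; congr EFin; rewrite indicE.
  case: (boolP (x \in box I)) => xI.
    rewrite big1//= => i _; rewrite /f indicE mem_set//=.
    by have := set_mem xI; move=> /(_ i); rewrite in_itv.
  have /existsNP[i Hi] : ~ (forall i, (I.1 ord0 i <= x ord0 i <= I.2 ord0 i)%R).
    by move=> H; move/negP : xI; apply; rewrite inE.
  by rewrite (bigD1 i)//= /f indicE memNset ?mul0r//= in_itv.
rewrite integral_nu_prod; last 2 first.
- by move=> i; exact: measurable_indic.
- by move=> i x; rewrite /f indicE.
rewrite /box_volume (eq_bigr (fun i => (Num.max 0%R (I.2 ord0 i - I.1 ord0 i))%:E)).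
  by elim/big_rec2 : _ => // i x y _ ->; rewrite EFinM.
move=> i _; rewrite integral_indic// setIT.
  apply: (etrans (lebesgue_measure_itv _)) => /=; rewrite lte_fin.
case: ltP => h; first by rewrite -EFinB max_r// subr_ge0 ltW.
by rewrite max_l// subr_le0.
Qed.

Definition half (i : 'I_d.+1) (a : R) : set V := [set x | (a <= x ord0 i)%R].

(** The hyperplane x_i = a cuts each box of a cover into the boxes [up] and [dn], whose volumes add
    up to that of the box. The two parts of [X] thus receive covers whose total volumes add up to
    that of the given one. *)
Lemma caratheodory_half i a : lam.-caratheodory (half i a).
Proof.
apply: le_caratheodory_measurable => X.
apply: le_ereal_inf_tmp => _ [I XI <-].
pose up (J : V * V) : V * V :=
  (\row_l (if l == i then Num.max a (J.1 ord0 l) else J.1 ord0 l), J.2).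
pose dn (J : V * V) : V * V :=
  (J.1, \row_l (if l == i then Num.min a (J.2 ord0 l) else J.2 ord0 l)).
have vol J : box_volume J = (box_volume (up J) + box_volume (dn J))%R.
  rewrite /box_volume (bigD1 i)//= [X in _ = (X + _)%R](bigD1 i)//=.
  rewrite [X in _ = (_ + X)%R](bigD1 i)//= !mxE !eqxx.
  rewrite [X in (_ = _ * X + _)%R](eq_bigr (fun l => Num.max 0 (J.2 ord0 l - J.1 ord0 l))%R); last first.
    by move=> l li; rewrite mxE (negbTE li).
  rewrite [X in (_ = _ + _ * X)%R](eq_bigr (fun l => Num.max 0 (J.2 ord0 l - J.1 ord0 l))%R); last first.
    by move=> l li; rewrite mxE (negbTE li).
  rewrite -mulrDl; congr (_ * _)%R.
  exact: max0_clip.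
have -> : \sum_(k <oo) (box_volume (I k))%:E =
    \sum_(k <oo) (box_volume (up (I k)))%:E + \sum_(k <oo) (box_volume (dn (I k)))%:E.
  rewrite -nneseriesD; last 2 first.
  - by move=> k _; rewrite lee_fin box_volume_ge0.
  - by move=> k _; rewrite lee_fin box_volume_ge0.
  by apply: eq_eseriesr => k _; rewrite -EFinD vol.
apply: leeD; apply: ereal_inf_lbound.
- exists (fun k => up (I k)) => // x [/XI[k _ xk] xa]; exists k => // l /=.
  rewrite mxE; case: eqP => [->|_]; last exact: xk.
  by have /andP[u v] := xk i; rewrite ge_max v u !andbT; exact: xa.
- exists (fun k => dn (I k)) => // x [/XI[k _ xk] xa]; exists k => // l /=.
  rewrite mxE; case: eqP => [->|_]; last exact: xk.
  have /andP[u v] := xk i; rewrite u le_min v andbT.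
  by apply: ltW; rewrite ltNge; exact/negP.
Qed.

Lemma measurable_id_brv :
  measurable_fun setT (id : caratheodory_type lam -> brv R d.+1).
Proof.
apply: measurable_fun_brvP => i.
apply: (measurability _ (RGenCInfty.measurableE R)).
move=> _ [_ [a ->] <-]; rewrite setTI.
have -> : (fun x : caratheodory_type lam => x ord0 i) @^-1` `[a, +oo[ = half i a.
  by rewrite eqEsubset; split=> x /=; rewrite in_itv/= andbT.
exact: caratheodory_half.
Qed.

Definition leb : set (brv R d.+1) -> \bar R :=
  pushforward (lebesgue_measure_rV R d) (id : caratheodory_type lam -> brv R d.+1).

HB.instance Definition _ := Measure.copy leb
  (measure_function_pushforward__canonical__measure_function_Measure
     (lebesgue_measure_rV R d) measurable_id_brv).

Lemma lam_box_le (I : V * V) : lam (box I) <= (box_volume I)%:E.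
Proof.
pose J k : V * V := if k is 0%N then I else (0%R, 0%R).
apply: (@le_trans _ _ (\sum_(k <oo) (box_volume (J k))%:E)).
  by apply: ereal_inf_lbound; exists J => // x xI; exists 0%N.
rewrite (nneseries_split 0 1)//; last by move=> k _; rewrite lee_fin box_volume_ge0.
rewrite big_nat1 eseries0 ?adde0// => -[//|k] _ _ /=.
by rewrite /box_volume big_ord_recl/= mxE subrr maxxx mul0r.
Qed.

(** Countable subadditivity of [nu] bounds the measure of [A] by the total volume of any cover by
    boxes. *)
Lemma nu_le_lam (A : set (brv R d.+1)) : measurable A -> nu d.+1 A <= lam A.
Proof.
move=> mA; apply: le_ereal_inf_tmp => _ [I AI <-].
apply: (@le_trans _ _ (nu d.+1 (\bigcup_k (box (I k) : set (brv R d.+1))))).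
  apply: le_measure; rewrite ?inE//.
  by apply: bigcup_measurable => k _; exact: measurable_box.
apply: le_trans.
  apply: (@measure_sigma_subadditive _ _ _ (nu d.+1) _ (fun k => box (I k))) => //.
  - by move=> k; exact: measurable_box.
  - by apply: bigcup_measurable => k _; exact: measurable_box.
by apply: lee_nneseries => // k _; rewrite -nu_box; exact: lexx.
Qed.

Lemma measurable_boxE :
  @measurable _ (brv R d.+1) = <<s [set box I | I in [set: V * V]] >>.
Proof.
rewrite eqEsubset; split; last first.
  apply: smallest_sub; first exact: sigma_algebra_measurable.
  by move=> _ [I _ <-]; exact: measurable_box.
pose W := g_sigma_algebraType [set box I | I in [set: V * V]].
suff mid : measurable_fun setT (id : W -> brv R d.+1).
  by move=> A mA; have := mid measurableT A mA; rewrite setTI.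
apply: measurable_fun_brvP => i.
apply: (measurability _ (RGenCInfty.measurableE R)).
move=> _ [_ [a ->] <-]; rewrite setTI.
(* These boxes exhaust the half-space: the face in direction [i] stays at [a] and all the others
   recede to infinity. *)
pose J (n : nat) : V * V :=
  (\row_l (if l == i then a else - n%:R)%R, \row_l n%:R%R).
have -> : (fun x : W => x ord0 i) @^-1` `[a, +oo[ = \bigcup_n box (J n).
  rewrite eqEsubset; split=> [x|x [n _ xn]] /=; rewrite in_itv/= andbT; last first.
    by have := xn i; rewrite !mxE eqxx => /andP[].
  move=> ax; exists (\max_l Num.truncn `|x ord0 l|%R).+1%N => // l.
  have h : (`|x ord0 l| <= (\max_l Num.truncn `|x ord0 l|%R).+1%:R)%R.
    rewrite (le_trans (ltW (truncnS_gt _)))// ler_nat ltnS.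
    exact: (leq_bigmax (F := fun l => Num.truncn `|x ord0 l|%R)).
  move: h; rewrite ler_norml => /andP[h1 h2]; rewrite !mxE h2 andbT.
  by case: eqP => [->|].
by apply: bigcup_measurable => n _; apply: sub_sigma_algebra; exists (J n).
Qed.

Lemma boxI_closed : setI_closed [set box I | I in [set: V * V]].
Proof.
move=> _ _ [I _ <-] [J _ <-]; exists
  (\row_l Num.max (I.1 ord0 l) (J.1 ord0 l), \row_l Num.min (I.2 ord0 l) (J.2 ord0 l))%R => //.
rewrite eqEsubset; split=> x.
  by move=> xIJ; split=> l; have := xIJ l; rewrite !mxE ge_max le_min => /andP[/andP[u v] /andP[w z]]; apply/andP.
move=> [xI xJ] l; rewrite !mxE ge_max le_min.
by have /andP[-> ->] := xI l; have /andP[-> ->] := xJ l.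
Qed.

(** Boxes form a pi-system that generates the Borel sets, and the cubes [g n] of finite measure
    exhaust the space. *)
Lemma nu_unique (m : {measure set (brv R d.+1) -> \bar R}) :
  (forall I, m (box I) = (box_volume I)%:E) ->
  forall A, measurable A -> m A = nu d.+1 A.
Proof.
move=> mE A mA.
pose g (n : nat) : set (brv R d.+1) := box (const_mx (- n%:R)%R, const_mx n%:R%R).
apply: (@measure_unique _ R (brv R d.+1) [set box I | I in [set: V * V]] g _ _ _ _ m (nu d.+1)) => //.
- exact: measurable_boxE.
- exact: boxI_closed.
- rewrite eqEsubset; split=> // x _; exists (\max_l Num.truncn `|x ord0 l|%R).+1%N => // l.
  have h : (`|x ord0 l| <= (\max_l Num.truncn `|x ord0 l|%R).+1%:R)%R.
    rewrite (le_trans (ltW (truncnS_gt _)))// ler_nat ltnS.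
    exact: (leq_bigmax (F := fun l => Num.truncn `|x ord0 l|%R)).
  by rewrite !mxE -ler_norml.
- by move=> _ [I _ <-]; exact: (etrans (mE I) (esym (nu_box I))).
- by move=> n; rewrite /g mE ltry.
Qed.

(** Half-spaces are Caratheodory measurable, hence so are Borel sets; the outer measure thus
    restricts to a Borel measure [leb], and it has the right value on boxes. *)
Lemma lamE (A : set (brv R d.+1)) : measurable A -> lam A = nu d.+1 A.
Proof.
move=> mA; apply: (nu_unique (m := leb)) => // I.
suff h : lam (box I) = (box_volume I)%:E by exact: h.
apply/eqP; rewrite eq_le lam_box_le -nu_box; apply: nu_le_lam.
exact: measurable_box.
Qed.

Lemma integral_lebesgue_rV (f : brv R d.+1 -> \bar R) :
  measurable_fun setT f -> (forall x, 0 <= f x) ->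
  \int[lebesgue_measure_rV R d]_x f x = \int[nu d.+1]_x f x.
Proof.
move=> mf f0; transitivity (\int[leb]_x f x).
  by rewrite ge0_integral_pushforward//; exact: measurable_id_brv.
by apply: eq_measure_integral => A mA _; exact: lamE.
Qed.

Definition shift_rv (c : 'rV[R]_d.+1) (x : brv R d.+1) : brv R d.+1 := (x - c)%R.

Lemma measurable_shift_rv c : measurable_fun setT (shift_rv c).
Proof.
apply: measurable_fun_brvP => i.
rewrite (_ : (fun t => _) = fun x : brv R d.+1 => x ord0 i - c ord0 i)%R.
  by apply: measurable_funB => //; exact: measurable_coord.
by apply/funext => x; rewrite !mxE.
Qed.

(** The image of [nu] under a translation still gives every box its volume, so [nu_unique]
    identifies it with [nu]. *)
Lemma integral_nu_shift c (f : brv R d.+1 -> \bar R) :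
  measurable_fun setT f -> (forall x, 0 <= f x) ->
  \int[nu d.+1]_x f (x - c)%R = \int[nu d.+1]_x f x.
Proof.
move=> mf f0.
pose m := measure_function_pushforward__canonical__measure_function_Measure
     (nu d.+1) (measurable_shift_rv c).
transitivity (\int[m]_x f x).
  by rewrite (ge0_integral_pushforward (measurable_shift_rv c)).
apply: eq_measure_integral => A mA _.
apply: (@nu_unique m _ A mA) => I.
rewrite /m /= /pushforward (_ : _ @^-1` _ = box (I.1 + c, I.2 + c)%R).
  rewrite nu_box; congr EFin; apply: eq_bigr => i _.
  by rewrite !mxE; congr (Num.max _ _); lra.
by rewrite eqEsubset; split=> x xI i; have := xI i; rewrite !mxE lerBrDr lerBlDr.
Qed.

End lebesgue_rV.

(** * Cauchy kernels *)

Section cauchy_kernel1.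
Context {R : realType}.
Local Notation mu := (@lebesgue_measure R).

(** The Fourier transform of [lap e], that is 2 pi times the Cauchy density of scale [e]; with this
    normalisation [integral_fourier] carries no factor 2 pi. *)
Definition cau (e z : R) : R := (2 * e) / (e ^+ 2 + z ^+ 2).

Definition lap (e x : R) : R := expR (- e * `|x|).

Lemma lap_gt0 e x : 0 < lap e x.
Proof. exact: expR_gt0. Qed.

Lemma lap_ge0 e x : 0 <= lap e x.
Proof. exact: ltW (lap_gt0 _ _). Qed.

Lemma cau_gt0 e z : 0 < e -> 0 < cau e z.
Proof.
by move=> e0; rewrite divr_gt0 ?mulr_gt0// ltr_wpDr ?sqr_ge0// exprn_gt0.
Qed.

Lemma cau_ge0 e z : 0 < e -> 0 <= cau e z.
Proof. by move=> e0; exact: ltW (cau_gt0 _ _). Qed.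

Lemma cau_le e z : 0 < e -> cau e z <= 2 / e.
Proof.
move=> e0; have h : 0 < e ^+ 2 + z ^+ 2 by rewrite ltr_wpDr ?sqr_ge0// exprn_gt0.
rewrite ler_pdivrMr// mulrAC ler_pdivlMr//.
by have := sqr_ge0 z; nra.
Qed.

Lemma cauN e z : cau e (- z) = cau e z.
Proof. by rewrite /cau sqrrN. Qed.

Lemma measurable_lap e : measurable_fun setT (lap e).
Proof.
by apply: measurableT_comp => //; exact: measurable_funM.
Qed.

Lemma continuous_cau e : 0 < e -> continuous (cau e).
Proof.
move=> e0 z; apply: cvgM; first exact: cvg_cst.
apply: cvgV; first by rewrite gt_eqF// ltr_wpDr ?sqr_ge0// exprn_gt0.
apply: cvgD; first exact: cvg_cst.
by rewrite expr2; apply: cvgM.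
Qed.

Lemma measurable_cau e : 0 < e -> measurable_fun setT (cau e).
Proof. by move=> e0; apply: continuous_measurable_fun; exact: continuous_cau. Qed.

Lemma lap_pos e x : 0 <= x -> lap e x = expR (- e * x).
Proof. by move=> x0; rewrite /lap ger0_norm. Qed.

Local Notation H e c z :=
  (fun a : R => expR (- e * a) * (1 + c * cos (a * z))).

(** The summand 1 makes the integrand nonnegative, as the fundamental theorem on the half-line
    requires here and Tonelli's theorem later; [F] is the explicit antiderivative. *)
Lemma integral_half_laplace (e c z : R) : 0 < e -> `|c| <= 1 ->
  (\int[mu]_(a in `[0%R, +oo[) (H e c z a)%:E = (e^-1 + c / 2 * cau e z)%:E)%E.
Proof.
move=> e0 c1.
have ez : 0 < e ^+ 2 + z ^+ 2 by rewrite ltr_wpDr ?sqr_ge0// exprn_gt0.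
pose F (a : R) := expR (- e * a) *
  (- e^-1 + c * (z * sin (a * z) - e * cos (a * z)) / (e ^+ 2 + z ^+ 2)).
have dF (a : R) : is_derive a 1 F (H e c z a).
  rewrite /F; apply: is_derive_eq.
  by rewrite /GRing.scale/=; field; rewrite !gt_eqF.
have F0 : F x @[x --> +oo] --> (0 : R).
  pose B : R := e^-1 + (`|z| + e) / (e ^+ 2 + z ^+ 2).
  have FB a : `|F a| <= expR (- (e * a)) * B.
    rewrite /F normrM ger0_norm ?expR_ge0// mulNr ler_wpM2l ?expR_ge0//.
    rewrite (le_trans (ler_normD _ _))// normrN (@ger0_norm _ e^-1) ?invr_ge0 ?(ltW e0)// /B lerD2l.
    rewrite !normrM normrV ?unitfE ?gt_eqF// (ger0_norm (ltW ez)).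
    rewrite ler_wpM2r ?invr_ge0 ?(ltW ez)//.
    rewrite (le_trans (ler_piMl _ c1))// (le_trans (ler_normB _ _))// !normrM.
    rewrite (ger0_norm (ltW e0)) lerD// ?ler_piMr//.
      by rewrite ler_norml sin_geN1 sin_le1.
    by rewrite ltW.
    by rewrite ler_norml cos_geN1 cos_le1.
  have G0 : expR (- (e * a)) * B @[a --> +oo] --> (0 : R).
    rewrite -[X in _ --> X](mul0r B); apply: cvgM; last exact: cvg_cst.
    apply: (@cvg_comp _ _ _ (fun a => e * a) (fun x => expR (- x)) _ (+oo%R : set_system R)).
      exact: gt0_cvgMry.
    exact: cvgr_expR.
  apply/cvgr0Pnorm_le => eps eps0.
  near=> a; apply: (le_trans (FB a)).
  have : `|expR (- (e * a)) * B| <= eps.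
    by near: a; exact: cvgr0_norm_le.
  by apply: le_trans; exact: ler_norm.
rewrite (ge0_continuous_FTC2y _ _ F0)//.
- rewrite -EFinB; congr EFin; rewrite /F /cau mulr0 mul0r expR0 sin0 cos0.
  by field; rewrite !gt_eqF.
- move=> x _; rewrite mulr_ge0 ?expR_ge0// -lerBlDl sub0r.
  have : `|c * cos (x * z)| <= 1.
    rewrite normrM mulr_ile1//; by rewrite ler_norml cos_geN1 cos_le1.
  by rewrite ler_norml => /andP[].
- apply: continuous_subspaceT => x.
  apply: differentiable_continuous; apply/derivable1_diffP.
  exact: ex_derive.
- by apply: cvg_at_right_filter; apply: differentiable_continuous; apply/derivable1_diffP; exact: ex_derive.
- by move=> x _; rewrite derive1E; exact: derive_val.
Unshelve. all: by end_near. Qed.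

(** The phase [th] will carry the contribution of the other coordinates. Adding the values at a and
    -a cancels the term in sin th: f(a) + f(-a) = 2 g(a). *)
Lemma integral_laplace (e th z : R) : 0 < e ->
  (\int[mu]_a (lap e a * (1 + cos (th + a * z)))%:E =
   (2 / e + cos th * cau e z)%:E)%E.
Proof.
move=> e0.
pose f (a : R) := lap e a * (1 + cos (th + a * z)).
pose g (a : R) := lap e a * (1 + cos th * cos (a * z)).
have mf : measurable_fun setT f.
  apply: measurable_funM; first exact: measurable_lap.
  apply: measurable_funD => //; apply: continuous_measurable_fun => x.
  by apply: differentiable_continuous; apply/derivable1_diffP; exact: ex_derive.
have f0 a : 0 <= f a by rewrite mulr_ge0 ?lap_ge0// -lerBlDl sub0r cos_geN1.
have cg : continuous g.
  move=> x; apply: cvgM; last first.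
    suff ch : continuous (fun a : R => 1 + cos th * cos (a * z)) by exact: ch.
    move=> y; apply: differentiable_continuous; apply/derivable1_diffP.
    exact: ex_derive.
  apply: (@continuous_comp _ _ _ (fun x => - e * `|x|) expR); last exact: continuous_expR.
  by apply: cvgM; [exact: cvg_cst|exact: norm_continuous].
have g0 a : 0 <= g a.
  apply: mulr_ge0; first exact: lap_ge0.
  rewrite -lerBlDl sub0r.
  have : `|cos th * cos (a * z)| <= 1.
    by rewrite normrM mulr_ile1// ler_norml cos_geN1 cos_le1.
  by rewrite ler_norml => /andP[].
have fN : (\int[mu]_a (f (- a))%:E = \int[mu]_a (f a)%:E)%E.
  have mN : measurable_fun setT (-%R : measurableTypeR R -> measurableTypeR R).
    exact: measurable_funN.
  pose m := measure_function_pushforward__canonical__measure_function_Measure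
     (@lebesgue_measure R) mN.
  transitivity (\int[m]_a (f a)%:E)%E.
    rewrite (ge0_integral_pushforward mN)//; first exact/measurable_EFinP.
    by move=> y _; rewrite lee_fin.
  by apply: eq_measure_integral => A mA _; exact: lebesgue_measureN.
have fg : (2%:E * \int[mu]_a (f a)%:E = 2%:E * \int[mu]_a (g a)%:E)%E.
  rewrite [LHS]mule_natl mule2n -{1}fN -ge0_integralD//; last 4 first.
  - by move=> x _; rewrite lee_fin.
  - by apply/measurable_EFinP; apply: measurableT_comp.
  - by move=> x _; rewrite lee_fin.
  - exact/measurable_EFinP.
  rewrite -ge0_integralZl//; last 2 first.
  - by apply/measurable_EFinP; exact: continuous_measurable_fun.
  - by move=> x _; rewrite lee_fin.
  apply: eq_integral => a _; rewrite -EFinD -EFinM; congr EFin.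
  rewrite /f /g mulNr !cosD cosN sinN /lap normrN; ring.
have two : (\int[mu]_a (f a)%:E = \int[mu]_a (g a)%:E)%E.
  have : (2^-1%:E * (2%:E * \int[mu]_a (f a)%:E) =
          2^-1%:E * (2%:E * \int[mu]_a (g a)%:E))%E by rewrite fg.
  by rewrite !muleA -EFinM mulVf// !mul1e.
rewrite [LHS]two ge0_symfun_integralT//; last first.
  by move=> x /=; rewrite /g /lap normrN (mulNr x) cosN.
have c1 : `|cos th| <= 1 by rewrite ler_norml cos_geN1 cos_le1.
rewrite -set_itvcy [X in (_ * X)%E = _](_ : _ = (e^-1 + cos th / 2 * cau e z)%:E); last first.
  rewrite -(integral_half_laplace z e0 c1); apply: eq_integral => a.
  by rewrite inE/= in_itv/= andbT => a0; rewrite /g lap_pos.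
by rewrite -EFinM; congr EFin; rewrite /cau; field; rewrite !gt_eqF// ltr_wpDr ?sqr_ge0// exprn_gt0.
Qed.

Lemma integral_cau e : 0 < e -> (\int[mu]_a (cau e a)%:E = (2 * pi)%:E)%E.
Proof.
move=> e0; rewrite ge0_symfun_integralT//; last 3 first.
- by move=> x; exact: cau_ge0.
- exact: continuous_cau.
- by move=> x /=; rewrite cauN.
pose F (x : R) := 2 * atan (e^-1 * x).
have Fl : F x @[x --> +oo] --> (2 * (pi / 2) : R).
  apply: cvgM; first exact: cvg_cst.
  apply: (@cvg_comp _ _ _ (fun a => e^-1 * a) (@atan R) _ (+oo%R : set_system R)).
    by apply: gt0_cvgMry; rewrite ?invr_gt0.
  exact: cvgy_atan.
have dF (x : R) : is_derive x 1 F (cau e x).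
  rewrite /F; apply: is_derive_eq; rewrite /GRing.scale/= /cau.
  have h : 0 < e ^+ 2 + x ^+ 2 by rewrite ltr_wpDr ?sqr_ge0// exprn_gt0.
  by field; rewrite !gt_eqF//= mulr1 addrC.
rewrite -set_itvcy (ge0_continuous_FTC2y _ _ Fl)//.
- by rewrite -EFinB -EFinM; congr EFin; rewrite /F mulr0 atan0; lra.
- by move=> x _; exact: cau_ge0.
- by apply: continuous_subspaceT; exact: continuous_cau.
- by apply: cvg_at_right_filter; apply: differentiable_continuous; apply/derivable1_diffP; exact: ex_derive.
- by move=> x _; rewrite derive1E; exact: derive_val.
Qed.

(* One of [|y - a|], [|y - b|] is at least [|a - b| / 2]. *)
Lemma cauM_le e a b y : 0 < e ->
  cau e (y - a) * cau e (y - b) <=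
  4 * cau e (a - b) * (cau e (y - a) + cau e (y - b)).
Proof.
move=> e0.
have key u v : (u - v) ^+ 2 <= 4 * u ^+ 2 -> cau e u <= 4 * cau e (u - v).
  move=> uv; rewrite /cau mulrA ler_pdivlMr ?ltr_wpDr ?sqr_ge0 ?exprn_gt0//.
  rewrite mulrAC ler_pdivrMr ?ltr_wpDr ?sqr_ge0 ?exprn_gt0//.
  by have := sqr_ge0 e; nra.
have ab : cau e (a - b) = cau e ((y - b) - (y - a)) by congr cau; lra.
have ba : cau e (a - b) = cau e ((y - a) - (y - b)) by rewrite -cauN; congr cau; lra.
have c1 := cau_ge0 (y - a) e0; have c2 := cau_ge0 (y - b) e0.
have c3 := cau_ge0 (a - b) e0.
have [h|h] : (y - a - (y - b)) ^+ 2 <= 4 * (y - a) ^+ 2 \/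
             (y - b - (y - a)) ^+ 2 <= 4 * (y - b) ^+ 2.
- have uv := sqr_ge0 ((y - a) + (y - b)).
  by have [h|h] := leP ((y - a) ^+ 2) ((y - b) ^+ 2); [right|left]; lra.
- by have := key _ _ h; rewrite -ba => /(ler_wpM2r c2); nra.
- by have := key _ _ h; rewrite -ab => /(ler_wpM2l c1); nra.
Qed.

Lemma lebesgue_integral_shift (c : R) (f : R -> \bar R) :
  measurable_fun setT f -> (forall x, 0 <= f x)%E ->
  (\int[mu]_a f (a - c)%R = \int[mu]_a f a)%E.
Proof.
move=> mf f0.
have mc : measurable_fun setT (fun a : measurableTypeR R => a - c : measurableTypeR R).
  exact: measurable_funB.
pose m := measure_function_pushforward__canonical__measure_function_Measure
     (@lebesgue_measure R) mc.
transitivity (\int[m]_a f a)%E; first by rewrite (ge0_integral_pushforward mc).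
apply: eq_measure_integral => A mA _.
apply/esym/(@lebesgue_measure_unique R m) => // _ [[a b]] _ <-.
rewrite /m /= /pushforward (_ : _ @^-1` _ = `]a + c, b + c]%classic); last first.
  by rewrite eqEsubset; split=> x /=; rewrite !in_itv/= ltrBrDr lerBlDr.
rewrite !lebesgue_measure_itv/= !lte_fin ltrD2r; case: ifP => // _.
by rewrite -!EFinB; congr EFin; lra.
Qed.

(** Each translate of the kernel has mass 2 pi, so the pointwise bound [cauM_le] integrates to 4(2
    pi + 2 pi) = 16 pi times [cau e (a - b)]. *)
Lemma integral_cauM_le e a b : 0 < e ->
  (\int[mu]_y (cau e (y - a) * cau e (y - b))%:E <=
   (16 * pi * cau e (a - b))%:E)%E.
Proof.
move=> e0.
have mcau c : measurable_fun setT (fun y : R => cau e (y - c)).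
  by apply: (measurableT_comp (measurable_cau e0)); exact: measurable_funB.
have icau c : (\int[mu]_y (cau e (y - c))%:E = (2 * pi)%:E)%E.
  rewrite (lebesgue_integral_shift c (f := fun y : R => (cau e y)%:E)) ?integral_cau//.
  - by apply/measurable_EFinP; exact: measurable_cau.
  - by move=> x; rewrite lee_fin cau_ge0.
apply: (@le_trans _ _ (\int[mu]_y
    ((4 * cau e (a - b))%:E * ((cau e (y - a))%:E + (cau e (y - b))%:E)))%E).
  apply: ge0_le_integral => //.
  - by move=> x _; rewrite lee_fin mulr_ge0 ?cau_ge0.
  - by apply/measurable_EFinP; apply: measurable_funM; exact: mcau.
  - by apply: emeasurable_funM => //; apply: emeasurable_funD; apply/measurable_EFinP; exact: mcau.
  - by move=> y _; rewrite -EFinD -EFinM lee_fin cauM_le.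
rewrite ge0_integralZl//; last 3 first.
- by apply: emeasurable_funD; apply/measurable_EFinP; exact: mcau.
- by move=> x _; rewrite -EFinD lee_fin addr_ge0 ?cau_ge0.
- by rewrite lee_fin mulr_ge0 ?cau_ge0.
rewrite ge0_integralD//; last 4 first.
- by move=> x _; rewrite lee_fin cau_ge0.
- by apply/measurable_EFinP; exact: mcau.
- by move=> x _; rewrite lee_fin cau_ge0.
- by apply/measurable_EFinP; exact: mcau.
by rewrite !icau -EFinD -EFinM lee_fin; lra.
Qed.

End cauchy_kernel1.

Section cauchy_kernel.
Context {R : realType} {d : nat}.
Implicit Types (e : R) (x y z a b : 'rV[R]_d).

Definition pk e z : R := \prod_i cau e (z ord0 i).
Definition qk e x : R := \prod_i lap e (x ord0 i).

Lemma pk_gt0 e z : 0 < e -> 0 < pk e z.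
Proof. by move=> e0; apply: prodr_gt0 => i _; exact: cau_gt0. Qed.

Lemma pk_ge0 e z : 0 < e -> 0 <= pk e z.
Proof. by move=> e0; exact: ltW (pk_gt0 _ _). Qed.

Lemma pk_le e z : 0 < e -> pk e z <= (2 / e) ^+ d.
Proof.
move=> e0; rewrite -[X in _ ^+ X]card_ord -prodr_const.
by apply: ler_prod => i _; rewrite cau_ge0//= cau_le.
Qed.

Lemma pkN e z : pk e (- z) = pk e z.
Proof. by apply: eq_bigr => i _; rewrite mxE cauN. Qed.

Lemma qk_ge0 e x : 0 <= qk e x.
Proof. by apply: prodr_ge0 => i _; exact: lap_ge0. Qed.

Lemma measurable_pk e : 0 < e -> measurable_fun setT (pk e : brv R d -> R).
Proof.
by move=> e0; apply: (@measurable_prod_coord R d (fun=> cau e)) => _; exact: measurable_cau.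
Qed.

Lemma measurable_qk e : measurable_fun setT (qk e : brv R d -> R).
Proof.
by apply: (@measurable_prod_coord R d (fun=> lap e)) => _; exact: measurable_lap.
Qed.

(** In each coordinate (z + y)^2 <= 2 z^2 + 2 e^2, so the denominator e^2 + z^2 grows by a factor of
    at most 3. *)
Lemma pk_harnack e z y : 0 < e -> (forall i, `|y ord0 i| <= e) ->
  3^-1 ^+ d * pk e z <= pk e (z + y).
Proof.
move=> e0 ye; rewrite -[X in _ ^+ X]card_ord -prodr_const -big_split/=.
apply: ler_prod => i _; rewrite mulr_ge0 ?cau_ge0//= mxE.
have h u : 0 < e ^+ 2 + u ^+ 2 by rewrite ltr_wpDr ?sqr_ge0// exprn_gt0.
have yi : (y ord0 i) ^+ 2 <= e ^+ 2.
  by rewrite -(real_normK (num_real _)) lerXn2r ?nnegrE// ltW.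
rewrite /cau mulrCA ler_pM2l ?mulr_gt0// -invfM lef_pV2 ?posrE ?mulr_gt0//.
by have := sqr_ge0 (z ord0 i - y ord0 i); have := sqr_ge0 (z ord0 i); nra.
Qed.

Lemma pk_ge e z : 0 < e -> (forall i, `|z ord0 i| <= e) -> e^-1 ^+ d <= pk e z.
Proof.
move=> e0 ze; rewrite -[X in _ ^+ X]card_ord -prodr_const.
apply: ler_prod => i _; rewrite invr_ge0 ltW//=.
have zi : (z ord0 i) ^+ 2 <= e ^+ 2.
  by rewrite -(real_normK (num_real _)) lerXn2r ?nnegrE// ltW.
rewrite /cau ler_pdivlMr ?ltr_wpDr ?sqr_ge0 ?exprn_gt0// mulrC ler_pdivrMr//.
by nra.
Qed.

Local Open Scope ereal_scope.

Lemma integral_lap e : (0 < e)%R ->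
  \int[@lebesgue_measure R]_a (lap e a)%:E = (2 / e)%:E.
Proof.
move=> e0; have := integral_laplace (pi / 2) 0 e0.
rewrite cos_pihalf mul0r addr0 => <-; apply: eq_integral => a _.
by rewrite mulr0 addr0 cos_pihalf addr0 mulr1.
Qed.

Lemma integral_qk e : (0 < e)%R -> \int[nu d]_x (qk e x)%:E = ((2 / e) ^+ d)%:E.
Proof.
move=> e0; rewrite (@integral_nu_prod R d (fun=> lap e)); last 2 first.
- by move=> _; exact: measurable_lap.
- by move=> _ x; exact: lap_ge0.
rewrite integral_lap// -[in RHS](card_ord d) -prodr_const.
by elim/big_rec2 : _ => // i u v _ ->; rewrite EFinM.
Qed.

(** This turns the L^2 norm of a density smoothed by [pk e] into a [pk e]-energy at the same
    scale. *)
Lemma integral_pkM_le e a b : (0 < e)%R ->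
  \int[nu d]_y (pk e (y - a) * pk e (y - b))%:E <=
  ((16 * pi) ^+ d * pk e (a - b))%:E.
Proof.
move=> e0.
pose f i (t : R) : R := (cau e (t - a ord0 i) * cau e (t - b ord0 i))%R.
have mf i : measurable_fun setT (f i).
  apply: measurable_funM; apply: (measurableT_comp (measurable_cau e0));
    exact: measurable_funB.
rewrite (eq_integral (fun u : brv R d => (\prod_i f i (u ord0 i))%:E)); last first.
  move=> y _; rewrite -big_split/=; congr EFin.
  by apply: eq_bigr => i _; rewrite !mxE.
rewrite integral_nu_prod//; last by move=> i x; rewrite mulr_ge0 ?cau_ge0.
rewrite -[X in (_ ^+ X)%R]card_ord -prodr_const -big_split/=.
have h i : exists2 r : R, \int[@lebesgue_measure R]_t (f i t)%:E = r%:E &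
    (0 <= r <= 16 * pi * cau e ((a - b)%R ord0 i))%R.
  have k := integral_cauM_le (a ord0 i) (b ord0 i) e0.
  have k0 : 0 <= \int[@lebesgue_measure R]_t (f i t)%:E.
    by apply: integral_ge0 => t _; rewrite lee_fin mulr_ge0 ?cau_ge0.
  exists (fine (\int[@lebesgue_measure R]_t (f i t)%:E)).
    by rewrite fineK// ge0_fin_numE// (le_lt_trans k) ?ltry.
  by rewrite fine_ge0//= -lee_fin fineK ?ge0_fin_numE// ?(le_lt_trans k) ?ltry// !mxE.
have [r rE r0] : exists2 r : 'I_d -> R,
    forall i, \int[@lebesgue_measure R]_t (f i t)%:E = (r i)%:E &
    forall i, (0 <= r i <= 16 * pi * cau e ((a - b)%R ord0 i))%R.
  have /choice[r rP] : forall i, exists r : R, \int[@lebesgue_measure R]_t (f i t)%:E = r%:E /\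
    (0 <= r <= 16 * pi * cau e ((a - b)%R ord0 i))%R.
    by move=> i; have [r ? ?] := h i; exists r.
  by exists r => i; have [] := rP i.
rewrite (eq_bigr (fun i => (r i)%:E))// (_ : \prod_i (r i)%:E = (\prod_i r i)%:E).
  by rewrite lee_fin; apply: ler_prod => i _; exact: r0.
by elim/big_rec2 : _ => // i u v _ ->; rewrite EFinM.
Qed.

End cauchy_kernel.

(** * Fourier transform of the Laplace weight *)

Section fourier.
Context {R : realType}.
Local Open Scope ereal_scope.

Lemma measurable_cos_dot d (th : R) (z : 'rV[R]_d) :
  measurable_fun setT (fun x : brv R d => cos (th + dot x z))%R.
Proof.
apply: measurableT_comp; first by apply: continuous_measurable_fun; exact: continuous_cos.
apply: measurable_funD => //; apply: measurable_sum => i.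
by apply: measurable_funM => //; exact: measurable_coord.
Qed.

(** Induction on the dimension: the inner integral is the inductive hypothesis at the phase th + a
    z_0, which is why the statement has an arbitrary phase, and [integral_laplace] evaluates the
    outer one. *)
Lemma integral_fourier d e th (z : 'rV[R]_d) : (0 < e)%R ->
  \int[nu d]_x (qk e x * (1 + cos (th + dot x z)))%:E =
  ((2 / e) ^+ d + cos th * pk e z)%:E.
Proof.
move=> e0; elim: d th z => [|d IH] th z.
  rewrite (eq_integral (cst (1 + cos th)%:E)); last first.
    by move=> x _; rewrite /qk /dot !big_ord0 mul1r addr0.
  by rewrite integral_cst//= diracT mule1 /pk big_ord0 mulr1 expr0.
pose z' : 'rV[R]_d := \row_i z ord0 (lift ord0 i).
have pkE : pk e z = (cau e (z ord0 ord0) * pk e z')%R.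
  by rewrite /pk big_ord_recl; congr (_ * _)%R; apply: eq_bigr => i _; rewrite mxE.
rewrite integral_nuS; last 2 first.
- apply/measurable_EFinP; apply: measurable_funM; first exact: measurable_qk.
  by apply: measurable_funD => //; exact: measurable_cos_dot.
- by move=> x; rewrite lee_fin mulr_ge0 ?qk_ge0// -lerBlDl sub0r cos_geN1.
set p' := pk e z' in pkE *; set C := ((2 / e) ^+ d)%R.
have p'0 : (0 <= p')%R by exact: pk_ge0.
have p'C : (0 <= C - p')%R by rewrite subr_ge0; exact: pk_le.
(* C + p' cos is written as (C - p') + p'(1 + cos), whose terms are nonnegative since [pk_le] gives
   p' <= C. *)
transitivity (\int[@lebesgue_measure R]_a ((C - p')%:E * (lap e a)%:E +
   p'%:E * (lap e a * (1 + cos (th + a * z ord0 ord0)))%:E)).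
  apply: eq_integral => a _.
  transitivity ((lap e a)%:E * \int[nu d]_v (qk e v * (1 + cos ((th + a * z ord0 ord0) + dot v z')))%:E).
    rewrite -ge0_integralZl//; last 3 first.
    - apply/measurable_EFinP; apply: measurable_funM; first exact: measurable_qk.
      by apply: measurable_funD => //; exact: measurable_cos_dot.
    - by move=> x _; rewrite lee_fin mulr_ge0 ?qk_ge0// -lerBlDl sub0r cos_geN1.
    - by rewrite lee_fin lap_ge0.
    apply: eq_integral => v _; rewrite -EFinM mulrA; congr (_ * (1 + cos _))%:E.
      rewrite /qk big_ord_recl rv_cons0; congr (_ * _)%R.
      by apply: eq_bigr => i _; rewrite rv_consS.
    rewrite /dot big_ord_recl rv_cons0 addrA; congr (_ + _)%R.
    by apply: eq_bigr => i _; rewrite rv_consS mxE.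
  by rewrite IH -!EFinM -EFinD; congr EFin; rewrite -/p' -/C; ring.
have mg : measurable_fun setT (fun a : R => (lap e a * (1 + cos (th + a * z ord0 ord0)))%R).
  apply: measurable_funM; first exact: measurable_lap.
  apply: measurable_funD => //; apply: measurableT_comp.
    by apply: continuous_measurable_fun; exact: continuous_cos.
  by apply: measurable_funD => //; exact: measurable_funM.
have g0 a : (0 <= lap e a * (1 + cos (th + a * z ord0 ord0)))%R.
  by rewrite mulr_ge0 ?lap_ge0// -lerBlDl sub0r cos_geN1.
rewrite ge0_integralD//; last 4 first.
- by move=> a _; rewrite -EFinM lee_fin mulr_ge0// lap_ge0.
- by apply/measurable_EFinP; apply: measurable_funM => //; exact: measurable_lap.
- by move=> a _; rewrite -EFinM lee_fin mulr_ge0.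
- by apply/measurable_EFinP; exact: measurable_funM.
rewrite ge0_integralZl//; last 2 first.
- by apply/measurable_EFinP; exact: measurable_lap.
- by move=> a _; rewrite lee_fin lap_ge0.
rewrite ge0_integralZl//; last 2 first.
- exact/measurable_EFinP.
- by move=> a _; rewrite lee_fin.
rewrite integral_lap// integral_laplace// -!EFinM -EFinD; congr EFin.
by rewrite pkE exprS -/C; ring.
Qed.

End fourier.

(** * Bounded measurable functions *)

(** This class is closed under the operations used below and integrable for every probability, so
    that real-valued integrals over it are linear and monotone without side conditions. *)
Definition bmf {R : realType} d (T : measurableType d) (f : T -> R) :=
  measurable_fun setT f /\ exists M : R, forall x, `|f x| <= M.

Section bmf.
Context {R : realType} d (T : measurableType d).
Implicit Types f g : T -> R.

Lemma bmf_cst (r : R) : bmf (fun _ : T => r).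
Proof. by split=> //; exists `|r|. Qed.

Lemma bmfD f g : bmf f -> bmf g -> bmf (fun x => f x + g x).
Proof.
move=> [mf [M fM]] [mg [L gL]]; split; first exact: measurable_funD.
by exists (M + L) => x; rewrite (le_trans (ler_normD _ _))// lerD.
Qed.

Lemma bmfM f g : bmf f -> bmf g -> bmf (fun x => f x * g x).
Proof.
move=> [mf [M fM]] [mg [L gL]]; split; first exact: measurable_funM.
by exists (M * L) => x; rewrite normrM ler_pM.
Qed.

Lemma bmf_max f g : bmf f -> bmf g -> bmf (fun x => Num.max (f x) (g x)).
Proof.
move=> [mf [M fM]] [mg [L gL]]; split; first exact: measurable_maxr.
exists (Num.max M L) => x; case: (leP (f x) (g x)) => _.
  by rewrite (le_trans (gL x))// le_max lexx orbT.
by rewrite (le_trans (fM x))// le_max lexx.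
Qed.

Lemma bmf_sum I (r : seq I) (P : pred I) (f : I -> T -> R) :
  (forall i, P i -> bmf (f i)) -> bmf (fun x => \sum_(i <- r | P i) f i x).
Proof.
move=> bf; elim: r => [|i r IH].
  by under eq_fun do rewrite big_nil; exact: bmf_cst.
under eq_fun do rewrite big_cons; have [Pi|_] := boolP (P i) => //.
by apply: bmfD => //; exact: bf.
Qed.

Lemma bmf_comp d' (S : measurableType d') (h : S -> T) f :
  measurable_fun setT h -> bmf f -> bmf (f \o h).
Proof.
by move=> mh [mf [M fM]]; split; [exact: measurableT_comp|exists M => x; exact: fM].
Qed.

Lemma bmf_cos f : measurable_fun setT f -> bmf (fun x => cos (f x)).
Proof.
move=> mf; split.
  apply: measurableT_comp => //; apply: continuous_measurable_fun.
  exact: continuous_cos.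
by exists 1 => x; rewrite ler_norml cos_geN1 cos_le1.
Qed.

Lemma bmf_sin f : measurable_fun setT f -> bmf (fun x => sin (f x)).
Proof.
move=> mf; split.
  apply: measurableT_comp => //; apply: continuous_measurable_fun.
  exact: continuous_sin.
by exists 1 => x; rewrite ler_norml sin_geN1 sin_le1.
Qed.

Context (Q : probability T R).

Lemma bmf_integrable f : bmf f -> Q.-integrable setT (EFin \o f).
Proof.
move=> [mf [M fM]]; apply: measurable_bounded_integrable => //.
  exact: le_lt_trans (probability_le1 Q measurableT) (ltry _).
by exists M; split=> [|x Mx]; [exact: num_real|move=> y _; rewrite /= (le_trans (fM y))// ltW].
Qed.

Lemma EFin_Rintegral f : bmf f ->
  (\int[Q]_x f x)%R%:E = (\int[Q]_x (f x)%:E)%E.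
Proof. by move=> bf; rewrite fineK//; exact: integrable_fin_num (bmf_integrable bf). Qed.

Lemma bmf_RintegralD f g : bmf f -> bmf g ->
  \int[Q]_x (f x + g x) = \int[Q]_x f x + \int[Q]_x g x.
Proof. by move=> bf bg; apply: RintegralD => //; exact: bmf_integrable. Qed.

Lemma bmf_RintegralZl r f : bmf f -> \int[Q]_x (r * f x) = r * \int[Q]_x f x.
Proof. by move=> bf; apply: RintegralZl => //; exact: bmf_integrable. Qed.

Lemma bmf_Rintegral_cst r : \int[Q]_x r = r.
Proof. by rewrite Rintegral_cst//= probability_setT/= mulr1. Qed.

Lemma bmf_le_Rintegral f g : bmf f -> bmf g -> (forall x, f x <= g x) ->
  \int[Q]_x f x <= \int[Q]_x g x.
Proof.
move=> bf bg fg; apply: le_Rintegral => //; try exact: bmf_integrable.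
Qed.

Lemma bmf_Rintegral_ge0 f : (forall x, 0 <= f x) -> 0 <= \int[Q]_x f x.
Proof. by move=> f0; exact: Rintegral_ge0. Qed.

Lemma bmf_Rintegral_sum I (r : seq I) (P : pred I) (f : I -> T -> R) :
  (forall i, P i -> bmf (f i)) ->
  \int[Q]_x (\sum_(i <- r | P i) f i x) = \sum_(i <- r | P i) \int[Q]_x f i x.
Proof.
move=> bf; elim: r => [|i r IH].
  rewrite big_nil; under eq_Rintegral do rewrite big_nil.
  exact: bmf_Rintegral_cst.
rewrite big_cons; under eq_Rintegral do rewrite big_cons.
case: ifPn => // Pi; rewrite bmf_RintegralD ?IH//; first exact: bf.
exact: bmf_sum.
Qed.

Lemma bmf_param d' (S : measurableType d') (F : S * T -> R) :
  bmf F -> bmf (fun s => \int[Q]_x F (s, x)).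
Proof.
move=> bF; have [mF [M FM]] := bF.
have bs s : bmf (fun x => F (s, x)).
  by split; [exact: measurableT_comp|exists M].
split; last first.
  exists M => s; rewrite (le_trans (le_normr_Rintegral _ (bmf_integrable (bs s))))//.
  rewrite -[leRHS](bmf_Rintegral_cst M); apply: bmf_le_Rintegral => //.
    split; last by exists M => x; rewrite normr_id; exact: FM.
    by apply: measurableT_comp => //; exact: (bs s).1.
  exact: bmf_cst.
(* Adding the bound [M] makes the integrand nonnegative, so that Tonelli's theorem yields
   measurability in the parameter. *)
rewrite (_ : (fun s => _) = fun s => \int[Q]_x (F (s, x) + M) - M); last first.
  apply/funext => s; rewrite bmf_RintegralD//; last exact: bmf_cst.
  by rewrite bmf_Rintegral_cst addrK.
apply: measurable_funB => //; apply: measurableT_comp => //.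
apply: (@measurable_fun_fubini_tonelli_F _ _ S T R Q (fun p => (F p + M)%:E)).
  by apply/measurable_EFinP; exact: measurable_funD.
by move=> p; rewrite lee_fin -lerBlDr sub0r; have := FM p; rewrite ler_norml => /andP[].
Qed.

End bmf.

(** * Independent coordinates and the Cairoli inequality *)

Lemma prode_mul (R : realType) I (r : seq I) (f g : I -> \bar R) :
  ((\prod_(i <- r) f i) * (\prod_(i <- r) g i) = \prod_(i <- r) (f i * g i))%E.
Proof.
by elim: r => [|i r IH]; rewrite ?big_nil ?mule1// !big_cons muleACA IH.
Qed.

Section product_law.
Context {dT} {T : measurableType dT} {J : finType} {R : realType}.
Context (Q : probability (fprod T J) R).

Definition product_law := forall B : J -> set T,
  (forall i, measurable (B i)) ->
  Q [set v | forall i, B i (v i)] =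
  (\prod_i Q [set v | B i (v i)])%E.

(** Resampling: the coordinates in [S] are taken from a second point. Under a product law this
    preserves [Q] ([mix_measure]), so integrating over the second point gives a conditional
    expectation. *)
Definition mix (S : {set J}) (v v' : J -> T) : J -> T :=
  fun i => if i \in S then v' i else v i.

Lemma measurable_mix S :
  measurable_fun setT (fun p : fprod T J * fprod T J => mix S p.1 p.2 : fprod T J).
Proof.
apply: measurable_fun_fprodP => i; rewrite /mix.
case: (i \in S).
  exact: (measurableT_comp (@measurable_fproj _ T J i) measurable_snd).
exact: (measurableT_comp (@measurable_fproj _ T J i) measurable_fst).
Qed.

Hypothesis Qprod : product_law.

Lemma measurable_cyl (B : J -> set T) : (forall i, measurable (B i)) ->
  measurable ([set v | forall i, B i (v i)] : set (fprod T J)).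
Proof. by move=> mB; apply: sub_sigma_algebra; exists B. Qed.

Lemma mix_measure S (A : set (fprod T J)) : measurable A ->
  (Q \x Q)%E ((fun p => mix S p.1 p.2) @^-1` A) = Q A.
Proof.
move=> mA.
pose m := measure_function_pushforward__canonical__measure_function_Measure
  (Q \x Q)%E (measurable_mix S).
suff : m A = Q A by [].
apply: (@measure_unique _ R (fprod T J) (@rect _ T J) (fun=> setT) _ _ _ _ m Q) => //.
- exact: rect_setI.
- by move=> i; exists (fun=> setT) => //; rewrite eqEsubset; split.
- by rewrite bigcup_const.
- move=> _ [B mB ->]; rewrite /m /= /pushforward.
  pose B1 i := if i \in S then setT else B i.
  pose B2 i := if i \in S then B i else setT.
  have mB1 i : measurable (B1 i) by rewrite /B1; case: ifP.
  have mB2 i : measurable (B2 i) by rewrite /B2; case: ifP.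
  rewrite (_ : _ @^-1` _ = [set v | forall i, B1 i (v i)] `*` [set v | forall i, B2 i (v i)]).
    transitivity (Q [set v | forall i, B1 i (v i)] * Q [set v | forall i, B2 i (v i)])%E.
      by apply: product_measure1E; exact: measurable_cyl.
    rewrite (Qprod mB1) (Qprod mB2) (Qprod mB).
    have QT i : Q [set v | [set: T] (v i)] = 1%E.
      by rewrite (_ : [set _ | _] = setT) ?probability_setT// eqEsubset; split.
    rewrite prode_mul; apply: eq_bigr => i _.
    by rewrite /B1 /B2; case: ifP => _; rewrite QT ?mul1e ?mule1.
  rewrite eqEsubset /mix /B1 /B2; split=> -[v v'] /=.
    by move=> h; split=> i; have := h i; case: ifP.
  by move=> [h1 h2] i; have := h1 i; have := h2 i; case: ifP.
- by move=> k; rewrite /m /= /pushforward preimage_setT; exact: le_lt_trans (probability_le1 (Q \x Q)%E measurableT) (ltry _).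
Qed.

Lemma mix_integral S (F : fprod T J -> \bar R) :
  measurable_fun setT F -> (forall v, 0 <= F v)%E ->
  (\int[Q]_v \int[Q]_v' F (mix S v v') = \int[Q]_v F v)%E.
Proof.
move=> mF F0.
pose m := measure_function_pushforward__canonical__measure_function_Measure
  (Q \x Q)%E (measurable_mix S).
transitivity (\int[Q \x Q]_p F (mix S p.1 p.2))%E.
  rewrite fubini_tonelli1//.
  by apply: (measurableT_comp mF); exact: measurable_mix.
transitivity (\int[m]_v F v)%E.
  by rewrite (ge0_integral_pushforward (measurable_mix S)).
by apply: eq_measure_integral => A mA _; apply: (etrans _ (mix_measure S mA)).
Qed.

Lemma mix_Rintegral S (F : fprod T J -> R) : bmf F ->
  \int[Q]_v \int[Q]_v' F (mix S v v') = \int[Q]_v F v.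
Proof.
move=> bF; have [mF [M FM]] := bF.
have bm : bmf (fun p : fprod T J * fprod T J => F (mix S p.1 p.2)).
  exact: (bmf_comp (measurable_mix S) bF).
have bs v : bmf (fun v' : fprod T J => F (mix S v v')).
  by split; [exact: measurable_fun_pair2 bm.1|exists M].
have bb : bmf (fun v : fprod T J => \int[Q]_v' F (mix S v v')) by exact: bmf_param bm.
apply: (@addIr _ M); apply: EFin_inj.
rewrite -{1 2}(bmf_Rintegral_cst Q M) -!bmf_RintegralD//; [|exact: bmf_cst..].
have bFM : bmf (fun v : fprod T J => F v + M) by apply: bmfD => //; exact: bmf_cst.
rewrite !EFin_Rintegral//; last by apply: bmfD => //; exact: bmf_cst.
rewrite -(@mix_integral S (fun v => (F v + M)%:E)).
- apply: eq_integral => v _; rewrite -EFin_Rintegral; last first.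
    by apply: bmfD => //; exact: bmf_cst.
  by rewrite bmf_RintegralD// ?bmf_Rintegral_cst//; exact: bmf_cst.
- by apply/measurable_EFinP; exact: bFM.1.
- by move=> v; rewrite lee_fin -lerBlDr sub0r; have := FM v; rewrite ler_norml => /andP[].
Qed.

Definition cchar (a : J -> T -> R) (i : J) : R[i] :=
  Complex (\int[Q]_v cos (a i (v i))) (\int[Q]_v sin (a i (v i))).

Lemma sin_cos_shift (x : R) : sin x = cos (x - pi / 2).
Proof. by rewrite cosB cos_pihalf sin_pihalf mulr0 add0r mulr1. Qed.

(** Coordinates are split off one at a time. Resampling coordinate [i] and applying the addition
    formula leaves a cosine and a sine; the sine is a cosine with phase shifted by pi / 2, so the
    induction runs over all phases. *)
Lemma Rintegral_cos_sum (a : J -> T -> R) (th : R) :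
  (forall i, measurable_fun setT (a i)) ->
  \int[Q]_v cos (th + \sum_i a i (v i)) =
  complex.Re (Complex (cos th) (sin th) * \prod_i cchar a i).
Proof.
move=> ma.
have mai i : measurable_fun setT (fun v : fprod T J => a i (v i)).
  by apply: (measurableT_comp (ma i)); exact: measurable_fproj.
have ms r (t : R) : measurable_fun setT (fun v : fprod T J => t + \sum_(i <- r) a i (v i)).
  by apply: measurable_funD => //; exact: measurable_sum.
suff H r : uniq r -> forall t, \int[Q]_v cos (t + \sum_(i <- r) a i (v i)) =
    complex.Re (Complex (cos t) (sin t) * \prod_(i <- r) cchar a i).
  by rewrite H// index_enum_uniq.
elim: r => [_ t|i r IH /= /andP[ir ur] t].
  under eq_Rintegral do rewrite big_nil addr0.
  by rewrite big_nil mulr1 bmf_Rintegral_cst.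
set f := fun v : fprod T J => cos (t + \sum_(i <- i :: r) a i (v i)).
have bf : bmf f by apply: bmf_cos; exact: ms.
rewrite -(mix_Rintegral [set i]%SET bf).
set c := \int[Q]_v cos (a i (v i)); set s := \int[Q]_v sin (a i (v i)).
transitivity (\int[Q]_v (c * cos (t + \sum_(i <- r) a i (v i)) +
   (- s) * cos ((t - pi / 2) + \sum_(i <- r) a i (v i)))).
  apply: eq_Rintegral => v _.
  set S := \sum_(i <- r) a i (v i).
  transitivity (\int[Q]_v' (cos (t + S) * cos (a i (v' i)) + (- sin (t + S)) * sin (a i (v' i)))).
    apply: eq_Rintegral => v' _; rewrite /f big_cons /mix finset.in_set1 eqxx.
    rewrite (_ : \sum_(_ <- r) _ = S); last first.
      apply: eq_big_seq => l lr; rewrite finset.in_set1; case: eqP => // li.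
      by move: ir; rewrite -li lr.
    by rewrite [X in cos X]addrCA [X in cos X]addrC [LHS]cosD; ring.
  have bc : bmf (fun v' : fprod T J => cos (a i (v' i))) by exact: bmf_cos.
  have bs : bmf (fun v' : fprod T J => sin (a i (v' i))) by exact: bmf_sin.
  rewrite bmf_RintegralD; [|by apply: bmfM => //; exact: bmf_cst..].
  rewrite !bmf_RintegralZl// -/c -/s.
  by rewrite addrAC -sin_cos_shift; ring.
have bc u : bmf (fun v : fprod T J => cos (u + \sum_(i <- r) a i (v i))).
  by apply: bmf_cos; exact: ms.
rewrite bmf_RintegralD; [|by apply: bmfM => //; exact: bmf_cst..].
rewrite !bmf_RintegralZl// !IH// big_cons.
have -> : cchar a i = Complex c s by [].
case: (\prod_(j <- r) cchar a j) => x y /=.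
rewrite cosB sinB cos_pihalf sin_pihalf; ring.
Qed.

End product_law.

Section averaging.
Context {dT} {T : measurableType dT} {J : finType} {R : realType}.
Context (Q : probability (fprod T J) R).
Hypothesis Qprod : product_law Q.
Implicit Types (F G : fprod T J -> R) (S : {set J}).

(* The conditional expectation of [F] given the coordinates outside [S]. *)
Definition avg S F : fprod T J -> R := fun v => \int[Q]_v' F (mix S v v').

Definition free S F := forall v v', F (mix S v v') = F v.

Lemma mix_mixr S S' (v v' v'' : J -> T) : S' \subset S ->
  mix S (mix S' v v') v'' = mix S v v''.
Proof.
move=> /fintype.subsetP SS; apply/funext => i; rewrite /mix.
by case: (boolP (i \in S)) => // /(contra (SS i))/negbTE ->.
Qed.

Lemma bmf_mix S F v : bmf F -> bmf (fun v' : fprod T J => F (mix S v v')).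
Proof.
move=> bF; have bm := bmf_comp (measurable_mix S) bF.
split; first exact: measurable_fun_pair2 bm.1.
by have [_ [M FM]] := bF; exists M.
Qed.

Lemma bmf_avg S F : bmf F -> bmf (avg S F).
Proof. by move=> bF; apply: (bmf_param _ (bmf_comp (measurable_mix S) bF)). Qed.

Lemma avg_ge0 S F : (forall v, 0 <= F v) -> forall v, 0 <= avg S F v.
Proof. by move=> F0 v; exact: bmf_Rintegral_ge0. Qed.

Lemma le_avg S F G : bmf F -> bmf G -> (forall v, F v <= G v) ->
  forall v, avg S F v <= avg S G v.
Proof. by move=> bF bG FG v; apply: bmf_le_Rintegral => //; exact: bmf_mix. Qed.

Lemma free_avg S S' F : S' \subset S -> free S' (avg S F).
Proof. by move=> SS v v'; apply: eq_Rintegral => w _; rewrite mix_mixr. Qed.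

Lemma freeS S S' F : S' \subset S -> free S F -> free S' F.
Proof. by move=> SS fF v v'; rewrite -(fF (mix S' v v') v) mix_mixr// fF. Qed.

(** As [free S G] says that [G] does not depend on the coordinates in [S], this is the defining
    property of the conditional expectation. *)
Lemma Rintegral_avg S F G : bmf F -> bmf G -> free S G ->
  \int[Q]_v (G v * avg S F v) = \int[Q]_v (G v * F v).
Proof.
move=> bF bG fG; rewrite -(mix_Rintegral Qprod S (bmfM bG bF)).
apply: eq_Rintegral => v _; rewrite -bmf_RintegralZl; last exact: bmf_mix.
by apply: eq_Rintegral => v' _; rewrite fG.
Qed.

(** Resampling two disjoint sets of coordinates in turn amounts to resampling their union. In
    particular the conditional expectations commute, as Cairoli's inequality requires. *)
Lemma avg_avg S S' F : bmf F -> (forall i, i \in S -> i \notin S') ->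
  avg S (avg S' F) = avg (S :|: S')%SET F.
Proof.
move=> bF SS; apply/funext => v.
rewrite /avg -(mix_Rintegral Qprod S' (bmf_mix _ v bF)).
apply: eq_Rintegral => v' _; apply: eq_Rintegral => v'' _; congr F.
apply/funext => i; rewrite /mix finset.in_setU.
case: (boolP (i \in S)) => [/SS/negbTE ->|_] /=; by case: (i \in S').
Qed.

(** For a decreasing chain [C] the averages [avg (C k) F] form a martingale, of which this is the
    running maximum. *)
Fixpoint rmax (C : nat -> {set J}) (F : fprod T J -> R) (m : nat) : fprod T J -> R :=
  if m is m'.+1 then fun v => Num.max (rmax C F m' v) (avg (C m) F v)
  else avg (C 0%N) F.

Lemma bmf_rmax C F m : bmf F -> bmf (rmax C F m).
Proof.
move=> bF; elim: m => [|m IH] /=; first exact: bmf_avg.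
by apply: bmf_max => //; exact: bmf_avg.
Qed.

Lemma rmax_ge C F m k v : (k <= m)%N -> avg (C k) F v <= rmax C F m v.
Proof.
elim: m => [|m IH]; first by rewrite leqn0 => /eqP ->.
rewrite leq_eqVlt ltnS => /orP[/eqP ->|/IH h] /=; first by rewrite le_max lexx orbT.
by rewrite le_max h.
Qed.

Lemma rmax_ge0 C F m v : (forall v, 0 <= F v) -> 0 <= rmax C F m v.
Proof.
by move=> F0; apply: le_trans (rmax_ge C F v (leq0n m)); exact: avg_ge0.
Qed.

Lemma free_rmax (C : nat -> {set J}) F m : {homo C : k l / (k <= l)%N >-> l \subset k} ->
  free (C m) (rmax C F m).
Proof.
move=> dC; elim: m => [|m IH] v v' /=; first by rewrite free_avg.
by rewrite (freeS (dC _ _ (leqnSn m)) IH) free_avg.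
Qed.

(** For s' = max(s, M) one has s'^2 + 2 s M <= s^2 + 2 s' M, by (M - s)^2 >= 0. Under the integral
    [M] may be replaced by [F], since s and s' are free of the coordinates in [C k.+1]. Induction
    gives the bound [key], and 2 s F <= s^2 / 2 + 2 F^2 then absorbs half of the left-hand side,
    whence the constant 4. *)
Lemma doob (C : nat -> {set J}) F m : bmf F -> (forall v, 0 <= F v) ->
  {homo C : k l / (k <= l)%N >-> l \subset k} ->
  \int[Q]_v (rmax C F m v) ^+ 2 <= 4 * \int[Q]_v (F v) ^+ 2.
Proof.
move=> bF F0 dC.
have bsq G : bmf G -> bmf (fun v => G v ^+ 2).
  by move=> bG; exact: (bmfM bG bG).
have bs k := bmf_rmax C k bF.
have bM k := bmf_avg (C k) bF.
have key k : \int[Q]_v (rmax C F k v) ^+ 2 <= 2 * \int[Q]_v (rmax C F k v * F v).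
  elim: k => [|k IH] /=.
    rewrite -(Rintegral_avg bF (bM 0%N) (free_avg _ (subxx _))).
    under [in leRHS]eq_Rintegral do rewrite -expr2.
    by rewrite ler_peMl ?ler1n//; apply: bmf_Rintegral_ge0 => v; exact: sqr_ge0.
  set s := rmax C F k; set s' := fun v => Num.max (s v) (avg (C k.+1) F v).
  set M := avg (C k.+1) F.
  have bs' : bmf s' := bs k.+1.
  have b1 := bmfM (bs k) (bM k.+1); have b2 := bmfM bs' (bM k.+1).
  have fs : free (C k.+1) s.
    by apply: (freeS (dC _ _ (leqnSn k))); exact: free_rmax.
  have fs' : free (C k.+1) s' by exact: (@free_rmax C F k.+1 dC).
  have : \int[Q]_v (s' v ^+ 2 + 2 * (s v * M v)) <=
         \int[Q]_v (s v ^+ 2 + 2 * (s' v * M v)).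
    apply: bmf_le_Rintegral.
    - exact: (bmfD (bsq _ bs') (bmfM (bmf_cst _ 2) b1)).
    - exact: (bmfD (bsq _ (bs k)) (bmfM (bmf_cst _ 2) b2)).
    - move=> v; rewrite /s' -/M; case: (leP (s v) (M v)) => h //.
      by have := sqr_ge0 (M v - s v); lra.
  rewrite (bmf_RintegralD Q (bsq _ bs') (bmfM (bmf_cst _ 2) b1)) -/s.
  rewrite (bmf_RintegralD Q (bsq _ (bs k)) (bmfM (bmf_cst _ 2) b2)).
  rewrite (bmf_RintegralZl Q 2 b1) (bmf_RintegralZl Q 2 b2).
  rewrite !Rintegral_avg//; move: IH; rewrite -/s; lra.
have : 2 * \int[Q]_v (rmax C F m v * F v) <=
    2^-1 * \int[Q]_v (rmax C F m v) ^+ 2 + 2 * \int[Q]_v (F v) ^+ 2.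
  have b1 := bmfM (bs m) bF.
  rewrite -(bmf_RintegralZl Q 2 b1) -(bmf_RintegralZl Q _ (bsq _ (bs m))).
  rewrite -(bmf_RintegralZl Q _ (bsq _ bF)).
  rewrite -(bmf_RintegralD Q (bmfM (bmf_cst _ _) (bsq _ (bs m))) (bmfM (bmf_cst _ _) (bsq _ bF))).
  apply: bmf_le_Rintegral.
  - exact: (bmfM (bmf_cst _ 2) b1).
  - exact: (bmfD (bmfM (bmf_cst _ _) (bsq _ (bs m))) (bmfM (bmf_cst _ _) (bsq _ bF))).
  - by move=> v; have := sqr_ge0 (rmax C F m v - 2 * F v); lra.
have := key m; lra.
Qed.

Section cairoli.
Context (I : eqType) (C : I -> nat -> {set J}) (m : nat).
Hypothesis dC : forall j, {homo C j : k l / (k <= l)%N >-> l \subset k}.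
Hypothesis disjC : forall j j' k k', j != j' -> forall i,
  i \in C j k -> i \notin C j' k'.

Definition crmax (r : seq I) F := foldr (fun j G => rmax (C j) G m) F r.

Lemma bmf_crmax r F : bmf F -> bmf (crmax r F).
Proof. by move=> bF; elim: r => //= j r; exact: bmf_rmax. Qed.

Lemma crmax_ge0 r F : (forall v, 0 <= F v) -> forall v, 0 <= crmax r F v.
Proof. by move=> F0; elim: r => //= j r IH v; exact: rmax_ge0. Qed.

Lemma cairoli r F : bmf F -> (forall v, 0 <= F v) ->
  \int[Q]_v (crmax r F v) ^+ 2 <= 4 ^+ size r * \int[Q]_v (F v) ^+ 2.
Proof.
move=> bF F0; elim: r => [|j r IH] /=; first by rewrite expr0 mul1r.
apply: (le_trans (doob _ _ _ (dC j))).
- exact: bmf_crmax.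
- exact: crmax_ge0.
- by rewrite exprS -mulrA ler_pM2l.
Qed.

(** By [avg_avg] the average over a union of disjoint sets is taken one direction at a time, and
    each inner average lies below the iterated maximum over the remaining directions. *)
Lemma crmax_ge (k : I -> nat) r F v : uniq r -> bmf F -> (forall j, (k j <= m)%N) ->
  avg [set i | has (fun j => i \in C j (k j)) r]%SET F v <= crmax r F v.
Proof.
move=> + bF km; elim: r v => [|j r IH] v /=.
  rewrite /avg => _; under eq_Rintegral => v' _.
    rewrite (_ : mix _ v v' = v); last by apply/funext => i; rewrite /mix inE.
    over.
  by rewrite bmf_Rintegral_cst.
move=> /andP[jr ur].
rewrite (_ : [set _ | _]%SET = (C j (k j) :|: [set i | has (fun j => i \in C j (k j)) r])%SET); last first.
  by apply/setP => i; rewrite !inE.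
rewrite -avg_avg//; last first.
  move=> i ij; rewrite inE; apply/hasPn => j' j'r.
  have jj : j != j' by apply: contraNneq jr => ->.
  by apply: disjC ij.
apply: (le_trans _ (rmax_ge _ _ _ (km j))).
apply: le_avg; [exact: bmf_avg|exact: bmf_crmax|].
by move=> w; exact: IH.
Qed.

End cairoli.
End averaging.

(** * Occupation measures of a multiparameter walk *)

Section joint.
Context {R : realType} {dT dY} {T : measurableType dT} {Y : measurableType dY} {J : finType}.
Context (Q : probability (fprod T J) R).
Implicit Types (F : Y -> fprod T J -> R).

Definition bmf2 F := bmf (fun p : Y * fprod T J => F p.1 p.2).

Lemma bmf2_sec F y : bmf2 F -> bmf (F y).
Proof.
move=> [mF [M FM]]; split; last by exists M => v; exact: (FM (y, v)).
exact: (measurable_fun_pair2 y mF).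
Qed.

Lemma bmf2_avg S F : bmf2 F -> bmf2 (fun y => avg Q S (F y)).
Proof.
move=> bF.
have mh : measurable_fun setT (fun q : (Y * fprod T J) * fprod T J =>
    (q.1.1, mix S q.1.2 q.2 : fprod T J)).
  apply: measurable_fun_pair.
    exact: (measurableT_comp measurable_fst measurable_fst).
  have h : measurable_fun setT (fun q : (Y * fprod T J) * fprod T J => (q.1.2, q.2)).
    apply: measurable_fun_pair => //.
    exact: (measurableT_comp measurable_snd measurable_fst).
  exact: (measurableT_comp (measurable_mix S) h).
exact: (bmf_param Q (bmf_comp mh bF)).
Qed.

Lemma bmf2_rmax C F m : bmf2 F -> bmf2 (fun y => rmax Q C (F y) m).
Proof.
move=> bF; elim: m => [|m IH] /=; first exact: bmf2_avg.
exact: (bmf_max IH (bmf2_avg _ bF)).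
Qed.

Lemma bmf2_crmax (I : eqType) C m (r : seq I) F :
  bmf2 F -> bmf2 (fun y => crmax Q C m r (F y)).
Proof. by move=> bF; elim: r => //= j r; exact: bmf2_rmax. Qed.

End joint.

Section array.
Context {R : realType} {d n m : nat}.
Local Notation rv := (brv R d.+1).
Local Notation J := ('I_n * 'I_m)%type.
Local Notation V := (fprod rv J).
Local Notation idx := {ffun 'I_n -> 'I_m.+1}.
Context (Q : probability V R) (Qprod : product_law Q).
Context (e : R) (e0 : 0 < e).
Implicit Types (s k : idx) (v : V) (x y : rv) (g : {set 'I_n}).

Definition lc (c : J -> R) (v : J -> 'rV[R]_d.+1) : 'rV[R]_d.+1 := \sum_p c p *: v p.

Definition cwalk s (p : J) : R := (p.2 < s p.1)%N%:R.

(** In the index (j, i), j is the process and i the time step; the walk at [s] adds up the first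
    [s j] increments of every process j. *)
Definition walk s := lc (cwalk s).

Lemma lcB c c' v : lc c v - lc c' v = lc (fun p => c p - c' p) v.
Proof. by rewrite /lc -sumrB; apply: eq_bigr => p _; rewrite scalerBl. Qed.

Lemma measurable_sub_lc c :
  measurable_fun setT (fun q : rv * V => (q.1 - lc c q.2 : rv)).
Proof.
apply: measurable_fun_brvP => i.
rewrite (_ : (fun t => _) =
    fun q : rv * V => q.1 ord0 i - \sum_p c p * q.2 p ord0 i); last first.
  apply/funext => q; rewrite !mxE summxE; congr (_ - _).
  by apply: eq_bigr => p _; rewrite mxE.
apply: measurable_funB.
  exact: (measurableT_comp (measurable_coord i) measurable_fst).
apply: measurable_sum => p; apply: measurable_funM => //.
exact: (measurableT_comp (measurable_coord i)
  (measurableT_comp (measurable_fproj p) measurable_snd)).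
Qed.

Lemma measurable_lc c : measurable_fun setT (lc c : V -> rv).
Proof.
apply: measurable_fun_brvP => i.
rewrite (_ : (fun t => _) = fun v : V => \sum_p c p * v p ord0 i); last first.
  by apply/funext => v; rewrite summxE; apply: eq_bigr => p _; rewrite mxE.
apply: measurable_sum => p; apply: measurable_funM => //.
exact: (measurableT_comp (measurable_coord i) (measurable_fproj p)).
Qed.

Lemma bmf_pk : bmf (pk e : rv -> R).
Proof.
split; first exact: measurable_pk.
by exists ((2 / e) ^+ d.+1) => x; rewrite ger0_norm ?pk_ge0// pk_le.
Qed.

Definition gk s k : R := \int[Q]_v pk e (walk s v - walk k v).

Lemma bmf_gk s k : bmf (fun v : V => pk e (walk s v - walk k v)).
Proof.
rewrite (_ : (fun v => _) = pk e \o (lc (fun p => cwalk s p - cwalk k p))).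
  by apply: (bmf_comp _ bmf_pk); exact: measurable_lc.
by apply/funext => v /=; rewrite /walk lcB.
Qed.

Lemma gk_ge0 s k : 0 <= gk s k.
Proof. by apply: bmf_Rintegral_ge0 => v; exact: pk_ge0. Qed.

Section orthant.
Context (g : {set 'I_n}).

(* Subtracting the end point [base] in the coordinates of [g] turns the walk at
   [k] into a function of the increments outside [corner k]; shifting [y] by
   [base v] preserves [nu \x Q]. *)
Definition corth s (p : J) : R := cwalk s p - (p.1 \in g)%:R.

Definition base : V -> rv := lc (fun p => (p.1 \in g)%:R).

Definition corner (k : idx) : {set J} :=
  [set p : J | if p.1 \in g then (p.2 < k p.1)%N else (k p.1 <= p.2)%N]%SET.

(** The quadrant with corner [k] that points backwards in the directions of [g] and forwards in the
    others. *)
Definition quad (k : idx) : pred idx := fun s =>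
  [forall j, if j \in g then (s j <= k j)%N else (k j <= s j)%N].

Lemma lc_corth s v : lc (corth s) v = walk s v - base v.
Proof. by rewrite /walk /base lcB. Qed.

(** The position at [k] uses only increments outside [corner k], while the displacement from [k] to
    a time of the quadrant uses only increments in it. Resampling the corner therefore makes this
    displacement independent of the position at [k]. *)
Lemma lc_mix s k v v' : quad k s ->
  lc (corth s) (mix (corner k) v v') =
  lc (corth k) v + (walk s v' - walk k v').
Proof.
move=> /forallP sk; rewrite /walk lcB /lc -big_split/=; apply: eq_bigr => -[j i] _.
rewrite /mix inE /corth /cwalk /=; have := sk j.
case: (boolP (j \in g)) => jg /= sj.
  case: (ltnP i (k j)) => ik /=; last first.
    by rewrite ltnNge (leq_trans sj ik)/= subrr scale0r addr0.
  by rewrite subrr scale0r add0r.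
case: (leqP (k j) i) => ik /=.
  by rewrite !subr0 scale0r add0r.
by rewrite (leq_trans ik sj)/= subrr scale0r addr0.
Qed.

Context (w : idx -> R) (w0 : forall s, 0 <= w s).

Definition occ y v : R := \sum_s w s * pk e (y - lc (corth s) v).

Lemma bmf2_term c : bmf2 (fun y v => pk e (y - lc c v)).
Proof. exact: (bmf_comp (measurable_sub_lc c) bmf_pk). Qed.

Lemma bmf2_occ : bmf2 occ.
Proof.
apply: bmf_sum => s _.
exact: (bmfM (bmf_cst _ (w s)) (bmf2_term (corth s))).
Qed.

Lemma occ_ge0 y v : 0 <= occ y v.
Proof. by apply: sumr_ge0 => s _; rewrite mulr_ge0 ?pk_ge0. Qed.

(** Times outside the quadrant are discarded. By [lc_mix] each remaining term is the kernel at a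
    fresh displacement, shifted by x - walk k v, and [pk_harnack] removes this shift at the price of
    3^-(d+1). *)
Lemma avg_occ_ge k x v : (forall i, `|(x - walk k v) ord0 i| <= e) ->
  3^-1 ^+ d.+1 * (\sum_(s | quad k s) w s * gk s k) <=
  avg Q (corner k) (occ (x - base v)) v.
Proof.
move=> xk; set y : rv := x - base v.
have bt s : bmf (fun v' : V => pk e (y - lc (corth s) (mix (corner k) v v'))).
  exact: (bmf_mix (corner k) v (bmf2_sec y (bmf2_term (corth s)))).
rewrite /avg /occ bmf_Rintegral_sum; last first.
  by move=> s _; exact: (bmfM (bmf_cst _ (w s)) (bt s)).
rewrite [leRHS](bigID (quad k))/= -[leLHS]addr0 lerD//; last first.
  apply: sumr_ge0 => s _; apply: bmf_Rintegral_ge0 => v'.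
  by rewrite mulr_ge0 ?pk_ge0.
rewrite mulr_sumr; apply: ler_sum => s sk.
rewrite (bmf_RintegralZl Q _ (bt s)) mulrCA ler_wpM2l//.
rewrite /gk -(bmf_RintegralZl Q _ (bmf_gk s k)).
apply: bmf_le_Rintegral; [exact: (bmfM (bmf_cst _ _) (bmf_gk s k))|exact: bt|].
move=> v'; rewrite (lc_mix v v' sk) lc_corth.
rewrite -[leLHS](congr1 (fun t => 3^-1 ^+ d.+1 * t) (pkN e _)).
have -> : y - (walk k v - base v + (walk s v' - walk k v')) =
    - (walk s v' - walk k v') + (x - walk k v).
  by rewrite /y; apply/rowP => i; rewrite !mxE; lra.
exact: pk_harnack.
Qed.

(** Time is reversed in the directions of [g], so that the chain decreases in [k] for either
    orientation; each [corner] is a union of one member from every direction. *)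
Definition chain (j : 'I_n) (k : nat) : {set J} :=
  [set p : J | (p.1 == j) && (if j \in g then (p.2 < m - k)%N else (k <= p.2)%N)]%SET.

Definition maxocc y : V -> R := crmax Q chain m (enum 'I_n) (occ y).

Lemma maxocc_ge k x v : (forall i, `|(x - walk k v) ord0 i| <= e) ->
  3^-1 ^+ d.+1 * (\sum_(s | quad k s) w s * gk s k) <= maxocc (x - base v) v.
Proof.
move=> xk; apply: (le_trans (avg_occ_ge xk)).
pose kk (j : 'I_n) : nat := if j \in g then (m - k j)%N else k j.
have -> : corner k = [set p : J | has (fun j => p \in chain j (kk j)) (enum 'I_n)]%SET.
  apply/setP => -[j i]; rewrite !inE /=.
  have km : (k j <= m)%N by rewrite -ltnS.
  apply/idP/hasP => [h|[j' _]].
    exists j; first by rewrite mem_enum.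
    by rewrite inE /= eqxx /kk; case: ifP h; rewrite ?subKn.
  rewrite inE /= /kk => /andP[/eqP jj']; rewrite -jj'.
  by case: (j \in g) => //=; rewrite subKn.
apply: crmax_ge => //.
- move=> j j' k1 k2 jj p; rewrite !inE => /andP[/eqP -> _].
  by rewrite negb_and (negbTE jj).
- exact: enum_uniq.
- exact: bmf2_sec bmf2_occ.
- by move=> j; rewrite /kk; case: ifP => _; [exact: leq_subr|rewrite -ltnS].
Qed.

Lemma Rintegral_maxocc y :
  \int[Q]_v (maxocc y v) ^+ 2 <= 4 ^+ n * \int[Q]_v (occ y v) ^+ 2.
Proof.
rewrite -[X in _ ^+ X](size_enum_ord n); apply: cairoli => //.
- move=> j k l kl; apply/fintype.subsetP => p; rewrite !inE => /andP[-> /=].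
  by case: ifP => _ h; [exact: leq_trans h (leq_sub2l _ kl)|exact: leq_trans kl h].
- exact: bmf2_sec bmf2_occ.
- exact: occ_ge0.
Qed.

(** The square is expanded and integrated over [y] first. [integral_pkM_le] leaves the kernel at the
    difference of two positions, in which [base] cancels. *)
Lemma integral_occ2 :
  (\int[nu d.+1]_y (\int[Q]_v (occ y v) ^+ 2)%R%:E <=
   ((16 * pi) ^+ d.+1 * \sum_s \sum_k w s * w k * gk s k)%:E)%E.
Proof.
have bo := bmf2_occ.
have msq : measurable_fun setT (fun q : rv * V => ((occ q.1 q.2) ^+ 2)%:E).
  by apply/measurable_EFinP; exact: (bmfM bo bo).1.
have inner v : (\int[nu d.+1]_y ((occ y v) ^+ 2)%:E <=
    ((16 * pi) ^+ d.+1 * \sum_s \sum_k w s * w k * pk e (walk s v - walk k v))%:E)%E.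
  pose t s k (y : rv) : R := pk e (y - lc (corth s) v) * pk e (y - lc (corth k) v).
  have mt s k : measurable_fun setT (t s k).
    by apply: measurable_funM; exact: (measurable_fun_pair1 v (bmf2_term _).1).
  have t0 s k y : 0 <= t s k y by rewrite mulr_ge0 ?pk_ge0.
  rewrite (eq_integral (fun y => \sum_s \sum_k ((w s * w k)%:E * (t s k y)%:E)))%E; last first.
    move=> y _; rewrite /occ expr2 big_distrlr/= -sumEFin; apply: eq_bigr => s _.
    rewrite -sumEFin; apply: eq_bigr => k _.
    by rewrite -EFinM; congr EFin; rewrite /t; ring.
  have w2 s k : (0 <= (w s * w k)%:E)%E by rewrite lee_fin mulr_ge0.
  have wt s k y : (0 <= (w s * w k)%:E * (t s k y)%:E)%E by rewrite mule_ge0// lee_fin.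
  have mwt s k : measurable_fun setT (fun y => (w s * w k)%:E * (t s k y)%:E)%E.
    by apply: emeasurable_funM => //; exact/measurable_EFinP.
  rewrite ge0_integral_sum//; last 2 first.
  - by move=> s; exact: emeasurable_sum.
  - by move=> s y _; exact: sume_ge0.
  rewrite mulr_sumr -sumEFin; apply: lee_sum => s _.
  rewrite ge0_integral_sum//.
  rewrite mulr_sumr -sumEFin; apply: lee_sum => k _.
  rewrite ge0_integralZl//; last 2 first.
  - exact/measurable_EFinP.
  - by move=> y _; rewrite lee_fin.
  rewrite [X in (_ <= X%:E)%E]mulrCA [X in (_ <= X)%E]EFinM lee_wpmul2l//.
  have -> : walk s v - walk k v = lc (corth s) v - lc (corth k) v.
    by rewrite !lc_corth; apply/rowP => i; rewrite !mxE; lra.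
  exact: integral_pkM_le.
apply: (@le_trans _ _ (\int[Q]_v \int[nu d.+1]_y ((occ y v) ^+ 2)%:E)%E).
  rewrite -(fubini_tonelli (fun q : rv * V => ((occ q.1 q.2) ^+ 2)%:E))//; last first.
    by move=> q; rewrite lee_fin sqr_ge0.
  rewrite le_eqVlt; apply/orP; left; apply/eqP.
  apply: eq_integral => y _; rewrite EFin_Rintegral//; exact: (bmfM (bmf2_sec y bo) (bmf2_sec y bo)).
have bg s k : bmf (fun v : V => w s * w k * pk e (walk s v - walk k v)).
  exact: (bmfM (bmf_cst _ (w s * w k)) (bmf_gk s k)).
have bgs s : bmf (fun v : V => \sum_k w s * w k * pk e (walk s v - walk k v)).
  by apply: bmf_sum => k _; exact: bg.
have bgss : bmf (fun v : V => \sum_s \sum_k w s * w k * pk e (walk s v - walk k v)).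
  by apply: bmf_sum => s _; exact: bgs.
have -> : (16 * pi) ^+ d.+1 * (\sum_s \sum_k w s * w k * gk s k) =
    \int[Q]_v ((16 * pi) ^+ d.+1 * \sum_s \sum_k w s * w k * pk e (walk s v - walk k v)).
  rewrite (bmf_RintegralZl Q _ bgss) bmf_Rintegral_sum//; congr (_ * _).
  apply: eq_bigr => s _; rewrite bmf_Rintegral_sum//; apply: eq_bigr => k _.
  by rewrite (bmf_RintegralZl Q _ (bmf_gk s k)).
have bC := bmfM (bmf_cst _ ((16 * pi) ^+ d.+1)) bgss.
rewrite (EFin_Rintegral Q bC); apply: ge0_le_integral => //.
- by move=> v _; apply: integral_ge0 => y _; rewrite lee_fin sqr_ge0.
- apply: (measurable_fun_fubini_tonelli_G (fun q : rv * V => ((occ q.1 q.2) ^+ 2)%:E)) => //.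
  by move=> q; rewrite lee_fin sqr_ge0.
- by apply/measurable_EFinP; exact: bC.1.
Qed.

End orthant.
Definition near_walk (K : pred idx) : set (rv * V) :=
  [set q | exists2 k, K k & forall i, `|(q.1 - walk k q.2) ord0 i| <= e].

Lemma measurable_near_walk K : measurable (near_walk K).
Proof.
have -> : near_walk K = \bigcup_(k in [set k : idx | K k])
    \bigcap_(i in [set: 'I_d.+1])
      (fun q : rv * V => (q.1 - walk k q.2) ord0 i) @^-1` [set r | `|r| <= e].
  rewrite eqEsubset; split=> q /=.
    by move=> [k Kk qk]; exists k => // i _; exact: qk.
  by move=> [k Kk qk]; exists k => // i; exact: qk.
apply: fin_bigcup_measurable => // k _; apply: fin_bigcap_measurable => // i _.
rewrite -[X in measurable X]setTI.
apply: (measurableT_comp (measurable_coord i) (measurable_sub_lc (cwalk k))) => //.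
rewrite (_ : [set r | `|r| <= e] = `[- e, e]%classic); first exact: measurable_itv.
by rewrite eqEsubset; split=> r /=; rewrite in_itv/= ler_norml.
Qed.

Lemma sqr_sum_le (I : finType) (a : I -> R) :
  (\sum_i a i) ^+ 2 <= #|I|%:R * \sum_i a i ^+ 2.
Proof.
set S := \sum_i a i ^+ 2.
have cst (x : R) : \sum_(i : I) x = #|I|%:R * x by rewrite sumr_const mulr_natl.
have h : \sum_i \sum_j (a i ^+ 2 + a j ^+ 2) = 2 * (#|I|%:R * S).
  transitivity (\sum_i (#|I|%:R * a i ^+ 2 + S)).
    by apply: eq_bigr => i _; rewrite big_split/= cst.
  by rewrite big_split/= -mulr_sumr cst -/S; ring.
have : \sum_i \sum_j 2 * (a i * a j) <= \sum_i \sum_j (a i ^+ 2 + a j ^+ 2).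
  apply: ler_sum => i _; apply: ler_sum => j _.
  by have := sqr_ge0 (a i - a j); lra.
rewrite h (_ : \sum_i _ = 2 * (\sum_i a i) ^+ 2); first by lra.
rewrite expr2 big_distrlr/= mulr_sumr; apply: eq_bigr => i _.
by rewrite mulr_sumr.
Qed.

(** At a point of [near_walk] one and the same [k] gives the bound [maxocc_ge] for every [g], so
    only the sum over the quadrants needs to be bounded below by [G]. Cauchy-Schwarz over the sets
    [g] then costs the factor [#|{set 'I_n}|], and each [g] is estimated separately in L^2. *)
Lemma array_ineq (K : pred idx) (W : {set 'I_n} -> idx -> R) (G : R) :
  (forall g s, 0 <= W g s) -> 0 <= G ->
  (forall k, K k -> G <= \sum_g \sum_(s | quad g k s) W g s * gk s k) ->
  (((3^-1 ^+ d.+1 * G) ^+ 2)%:E * (nu d.+1 \x Q) (near_walk K) <=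
   (#|{set 'I_n}|%:R * (4 ^+ n * ((16 * pi) ^+ d.+1 *
     \sum_g \sum_s \sum_k W g s * W g k * gk s k)))%:E)%E.
Proof.
move=> W0 G0 KG.
pose M g (q : rv * V) : R := maxocc g (W g) (q.1 - base g q.2) q.2.
have bmo g : bmf2 (maxocc g (W g)) by exact: (bmf2_crmax _ _ _ _ (bmf2_occ g (W g))).
have msh g : measurable_fun setT (fun q : rv * V => (q.1 - base g q.2 : rv, q.2)).
  by apply: measurable_fun_pair => //; exact: measurable_sub_lc.
have bM g : bmf (M g) by exact: (bmf_comp (msh g) (bmo g)).
have bM2 g : bmf (fun q => M g q ^+ 2) by exact: (bmfM (bM g) (bM g)).
have mA := measurable_near_walk K.
set c := 3^-1 ^+ d.+1 * G.
have c0 : 0 <= c by rewrite mulr_ge0// exprn_ge0.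
have -> : ((c ^+ 2)%:E * (nu d.+1 \x Q) (near_walk K) =
    \int[nu d.+1 \x Q]_q (c ^+ 2 * \1_(near_walk K) q)%:E)%E.
  under [RHS]eq_integral do rewrite EFinM.
  rewrite ge0_integralZl ?lee_fin ?sqr_ge0//; last first.
    by apply/measurable_EFinP; exact: measurable_indic.
  by rewrite integral_indic// setIT.
apply: (@le_trans _ _ (\int[nu d.+1 \x Q]_q
    (#|{set 'I_n}|%:R%:E * \sum_g (M g q ^+ 2)%:E))%E).
  apply: ge0_le_integral => //.
  - by move=> q _; rewrite lee_fin mulr_ge0 ?sqr_ge0.
  - by apply/measurable_EFinP; apply: measurable_funM => //; exact: measurable_indic.
  - apply: emeasurable_funM => //; apply: emeasurable_sum => g.
    by apply/measurable_EFinP; exact: (bM2 g).1.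
  - move=> q _; rewrite sumEFin -EFinM lee_fin indicE.
    apply: (le_trans _ (sqr_sum_le _)).
    case: (boolP (q \in near_walk K)) => [/set_mem[k Kk qk]|_]; last by rewrite mulr0 sqr_ge0.
    rewrite mulr1 lerXn2r ?nnegrE//.
      by apply: sumr_ge0 => g _; apply: crmax_ge0 => v; exact: occ_ge0.
    apply: (@le_trans _ _ (\sum_g 3^-1 ^+ d.+1 * \sum_(s | quad g k s) W g s * gk s k)).
      by rewrite -mulr_sumr ler_wpM2l ?exprn_ge0// KG.
    by apply: ler_sum => g _; exact: maxocc_ge.
rewrite ge0_integralZl//; last 2 first.
- by apply: emeasurable_sum => g; apply/measurable_EFinP; exact: (bM2 g).1.
- by move=> q _; apply: sume_ge0 => g _; rewrite lee_fin sqr_ge0.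
rewrite [leRHS]EFinM lee_wpmul2l//.
rewrite ge0_integral_sum//; last 2 first.
- by move=> g; apply/measurable_EFinP; exact: (bM2 g).1.
- by move=> g q _; rewrite lee_fin sqr_ge0.
rewrite !mulr_sumr -sumEFin; apply: lee_sum => g _.
have bmo2 : bmf (fun q : rv * V => maxocc g (W g) q.1 q.2 ^+ 2) by exact: (bmfM (bmo g) (bmo g)).
apply: (@le_trans _ _ (\int[nu d.+1]_y (\int[Q]_v (maxocc g (W g) y v) ^+ 2)%R%:E)%E).
  rewrite (fubini_tonelli2 (fun q => (M g q ^+ 2)%:E))//; last 2 first.
  - by apply/measurable_EFinP; exact: (bM2 g).1.
  - by move=> q; rewrite lee_fin sqr_ge0.
  rewrite (_ : (\int[nu d.+1]_y _ = \int[Q]_v \int[nu d.+1]_y (maxocc g (W g) y v ^+ 2)%:E)%E); last first.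
    rewrite -(fubini_tonelli (fun q : rv * V => ((maxocc g (W g) q.1 q.2) ^+ 2)%:E))//; last 2 first.
    - by apply/measurable_EFinP; exact: bmo2.1.
    - by move=> q; rewrite lee_fin sqr_ge0.
    apply: eq_integral => y _; rewrite EFin_Rintegral//.
    exact: (bmfM (bmf2_sec y (bmo g)) (bmf2_sec y (bmo g))).
  rewrite le_eqVlt; apply/orP; left; apply/eqP; apply: eq_integral => v _.
  rewrite /fubini_G /M /=.
  (* The shift depends on [v]; it disappears when the space variable is integrated first, by
     translation invariance. *)
  apply: (integral_nu_shift (base g v) (f := fun y : rv => (maxocc g (W g) y v ^+ 2)%:E)).
  - by apply/measurable_EFinP; exact: (measurable_fun_pair1 v bmo2.1).
  - by move=> y; rewrite lee_fin sqr_ge0.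
apply: (@le_trans _ _ (\int[nu d.+1]_y ((4 ^+ n)%:E * (\int[Q]_v (occ g (W g) y v) ^+ 2)%R%:E))%E).
  have bo := bmf2_occ g (W g).
  have bo2 : bmf (fun q : rv * V => occ g (W g) q.1 q.2 ^+ 2) by exact: (bmfM bo bo).
  apply: ge0_le_integral => //.
  - by move=> y _; rewrite lee_fin; apply: bmf_Rintegral_ge0 => v; exact: sqr_ge0.
  - by apply/measurable_EFinP; exact: (bmf_param Q bmo2).1.
  - apply: emeasurable_funM => //; apply/measurable_EFinP.
    exact: (bmf_param Q bo2).1.
  - by move=> y _; rewrite -EFinM lee_fin; exact: Rintegral_maxocc.
have bo := bmf2_occ g (W g).
have bo2 : bmf (fun q : rv * V => occ g (W g) q.1 q.2 ^+ 2) by exact: (bmfM bo bo).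
rewrite ge0_integralZl//; last 2 first.
- by apply/measurable_EFinP; exact: (bmf_param Q bo2).1.
- by move=> y _; rewrite lee_fin; apply: bmf_Rintegral_ge0 => v; exact: sqr_ge0.
by rewrite [leRHS]EFinM lee_wpmul2l ?lee_fin ?exprn_ge0//; exact: integral_occ2.
Qed.

End array.

(** * Integrals against the Laplace weight and the Fourier form of the potential *)

Section laplace_integral.
Context {R : realType} {d : nat}.
Local Notation rv := (brv R d).
Context (e : R) (e0 : 0 < e).
Implicit Types h : rv -> R.

Definition IQ h : R := \int[nu d]_x (qk e x * h x).

Lemma qk_integrable : (nu d).-integrable setT (EFin \o (qk e : rv -> R)).
Proof.
apply/integrableP; split; first by apply/measurable_EFinP; exact: measurable_qk.
rewrite (eq_integral (fun x : rv => (qk e x)%:E)); first by rewrite integral_qk ?ltry.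
by move=> x _ /=; rewrite ger0_norm ?qk_ge0.
Qed.

Lemma IQ_integrable h : bmf h ->
  (nu d).-integrable setT (EFin \o (fun x : rv => qk e x * h x)).
Proof.
move=> [mh [M hM]].
apply: (le_integrable measurableT _ _ (integrableZl measurableT M qk_integrable)).
  by apply/measurable_EFinP; apply: measurable_funM => //; exact: measurable_qk.
move=> x _ /=; rewrite lee_fin !normrM mulrC.
by rewrite ler_wpM2r// (le_trans (hM x))// ler_norm.
Qed.

Lemma EFin_IQ h : bmf h -> (IQ h)%:E = (\int[nu d]_x (qk e x * h x)%:E)%E.
Proof.
by move=> bh; rewrite fineK//; exact: integrable_fin_num (IQ_integrable bh).
Qed.

Lemma IQD h h' : bmf h -> bmf h' -> IQ (fun x => h x + h' x) = IQ h + IQ h'.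
Proof.
move=> bh bh'; rewrite /IQ -RintegralD//; try exact: IQ_integrable.
by apply: eq_Rintegral => x _; rewrite mulrDr.
Qed.

Lemma IQZ r h : bmf h -> IQ (fun x => r * h x) = r * IQ h.
Proof.
move=> bh; rewrite /IQ -RintegralZl//; last exact: IQ_integrable.
by apply: eq_Rintegral => x _; rewrite mulrCA.
Qed.

Lemma IQ_cst r : IQ (fun=> r) = r * (2 / e) ^+ d.
Proof.
have b1 : bmf (fun _ : rv => 1 : R) by exact: bmf_cst.
have -> : IQ (fun=> r) = IQ (fun=> r * 1) by congr IQ; apply/funext => x; rewrite mulr1.
rewrite (IQZ r b1); congr (_ * _); apply: EFin_inj; rewrite EFin_IQ// -integral_qk//.
by apply: eq_integral => x _; rewrite mulr1.
Qed.

Lemma IQ_sum I (r : seq I) (P : pred I) (f : I -> rv -> R) :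
  (forall i, bmf (f i)) ->
  IQ (fun x => \sum_(i <- r | P i) f i x) = \sum_(i <- r | P i) IQ (f i).
Proof.
move=> bf; elim: r => [|i r IH].
  rewrite big_nil -[RHS](mul0r ((2 / e) ^+ d)) -IQ_cst; congr IQ.
  by apply/funext => x; rewrite big_nil.
rewrite big_cons -IH; case: ifPn => Pi.
  rewrite -IQD//; last by apply: bmf_sum => j _; exact: bf.
  by congr IQ; apply/funext => x; rewrite big_cons Pi.
by congr IQ; apply/funext => x; rewrite big_cons (negbTE Pi).
Qed.

Lemma IQ_cvg (f : nat -> rv -> R) (g : rv -> R) (B : R) :
  (forall k, measurable_fun setT (f k)) -> (forall k x, `|f k x| <= B) ->
  bmf g -> (forall x, f k x @[k --> \oo] --> g x) ->
  IQ (f k) @[k --> \oo] --> IQ g.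
Proof.
move=> mf fB bg fg.
have bf k : bmf (f k) by split => //; exists B.
have : (\int[nu d]_x (qk e x * f k x)%:E @[k --> \oo] --> \int[nu d]_x (qk e x * g x)%:E)%E.
  apply: (@dominated_cvg _ _ R (nu d) setT measurableT
    (fun k x => (qk e x * f k x)%:E) (fun x => (qk e x * g x)%:E)
    (fun x => (B * qk e x)%:E)) => //.
  - by move=> k; apply/measurable_EFinP; apply: measurable_funM => //; exact: measurable_qk.
  - by move=> x _; apply: cvg_EFin; [exact: nearW|apply: cvgM; [exact: cvg_cst|exact: fg]].
  - exact: (integrableZl measurableT B qk_integrable).
  - move=> k x _ /=; rewrite lee_fin normrM ger0_norm ?qk_ge0// mulrC.
    by rewrite ler_wpM2r// qk_ge0.
rewrite -EFin_IQ// => /fine_cvg.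
by under eq_fun do rewrite -EFin_IQ//.
Qed.

End laplace_integral.

Section zpw.
Context {R : realType}.
Implicit Types z : R[i].

(* If [z] is the characteristic function of one increment, [zpw z a b] is that of
   the walk at time [a] minus the walk at time [b]. *)
Definition zpw z (a b : nat) : R[i] :=
  if (b <= a)%N then z ^+ (a - b) else (conjc z) ^+ (b - a).

Lemma prod_interval (m k s : nat) z : (s <= m)%N ->
  \prod_(i < m) (if (k <= i < s)%N then z else 1) = z ^+ (s - k).
Proof.
move=> sm; suff -> : \prod_(i < m) (if (k <= i < s)%N then z else 1) = z ^+ (minn s m - k).
  by rewrite (minn_idPl sm).
elim: m {sm} => [|m IH]; first by rewrite big_ord0 minn0 sub0n.
rewrite big_ord_recr/= IH; case: ifP => h.
  by rewrite -exprSr; congr (_ ^+ _); lia.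
by rewrite mulr1; congr (_ ^+ _); lia.
Qed.

(** In the difference of the walks at [s] and [k], increment i has coefficient 1 for k <= i < s,
    coefficient -1 for s <= i < k, and 0 otherwise. *)
Lemma prod_zpw (m k s : nat) z : (s <= m)%N -> (k <= m)%N ->
  \prod_(i < m) (if (i < s)%N then if (i < k)%N then 1 else z
                 else if (i < k)%N then conjc z else 1) = zpw z s k.
Proof.
move=> sm km; rewrite /zpw; case: leqP => ks.
  rewrite -(prod_interval k z sm); apply: eq_bigr => i _.
  case: (ltnP i s) => is_; case: (ltnP i k) => ik //=.
  by have := leq_trans ik ks; rewrite ltnNge is_.
rewrite -(prod_interval s (conjc z) km); apply: eq_bigr => i _.
case: (ltnP i s) => is_; case: (ltnP i k) => ik //=.
by have := leq_trans (leq_trans is_ (ltnW ks)) ik; rewrite ltnn.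
Qed.

End zpw.

Section gk_fourier.
Context {R : realType} {d n m : nat}.
Local Notation rv := (brv R d.+1).
Local Notation J := ('I_n * 'I_m)%type.
Local Notation V := (fprod rv J).
Local Notation idx := {ffun 'I_n -> 'I_m.+1}.
Context (Q : probability V R) (Qprod : product_law Q).
Context (e : R) (e0 : 0 < e).
Context (phi : 'I_n -> rv -> R[i]).
Hypothesis Qphi : forall j i xi,
  Complex (\int[Q]_v cos (dot xi (v (j, i)))) (\int[Q]_v sin (dot xi (v (j, i))))
  = phi j xi.
Implicit Types (s k : idx) (xi : rv).

Definition zprod s k xi : R[i] := \prod_j zpw (phi j xi) (s j) (k j).

Lemma dot_lc xi (c : J -> R) v : dot xi (lc c v) = \sum_p c p * dot xi (v p).
Proof.
rewrite /dot /lc; under eq_bigr do rewrite summxE mulr_sumr.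
rewrite exchange_big; apply: eq_bigr => p _.
by rewrite mulr_sumr; apply: eq_bigr => i _; rewrite mxE mulrCA.
Qed.

Lemma measurable_dotr xi : measurable_fun setT (dot xi : rv -> R).
Proof.
apply: measurable_sum => i; apply: measurable_funM => //.
exact: measurable_coord.
Qed.

Lemma zprodE s k xi :
  \int[Q]_v cos (dot xi (walk s v - walk k v)) = complex.Re (zprod s k xi).
Proof.
pose a (p : J) (x : rv) : R := (cwalk s p - cwalk k p) * dot xi x.
have ma p : measurable_fun setT (a p).
  by apply: measurable_funM => //; exact: measurable_dotr.
transitivity (\int[Q]_v cos (0 + \sum_p a p (v p))).
  by apply: eq_Rintegral => v _; rewrite add0r /walk lcB dot_lc.
rewrite (Rintegral_cos_sum Qprod 0 ma) cos0 sin0 (_ : Complex 1 0 = 1)// mul1r.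
congr complex.Re; rewrite /zprod.
transitivity (\prod_j \prod_i cchar Q a (j, i)).
  by rewrite pair_big; apply: eq_bigr => -[].
apply: eq_bigr => j _.
rewrite -(@prod_zpw _ m) ?leq_ord//; apply: eq_bigr => i _.
rewrite /cchar /a /cwalk /= -(Qphi j i).
have one : Complex (\int[Q]_v cos (0 * dot xi (v (j, i))))
                   (\int[Q]_v sin (0 * dot xi (v (j, i)))) = 1.
  under eq_Rintegral do rewrite mul0r cos0.
  rewrite bmf_Rintegral_cst; under eq_Rintegral do rewrite mul0r sin0.
  by rewrite bmf_Rintegral_cst.
case: ltnP => is_; case: ltnP => ik /=.
- by rewrite subrr.
- by rewrite subr0; congr Complex; apply: eq_Rintegral => v _; rewrite mul1r.
- have bs : bmf (fun v : V => sin (dot xi (v (j, i)))).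
    apply: bmf_sin; apply: (measurableT_comp (measurable_dotr xi)).
    exact: measurable_fproj.
  rewrite sub0r; congr Complex.
    by apply: eq_Rintegral => v _; rewrite mulN1r cosN.
  rewrite -[RHS]mulN1r -(bmf_RintegralZl Q _ bs).
  by apply: eq_Rintegral => v _; rewrite mulN1r sinN mulN1r.
- by rewrite subr0.
Qed.

Lemma measurable_dot2 c :
  measurable_fun setT (fun q : rv * V => dot q.1 (lc c q.2)).
Proof.
apply: measurable_sum => i; apply: measurable_funM.
  exact: (measurableT_comp (measurable_coord i) measurable_fst).
exact: (measurableT_comp (measurable_coord i)
  (measurableT_comp (measurable_lc c) measurable_snd)).
Qed.

Lemma bmf_zprod s k : bmf (fun xi => complex.Re (zprod s k xi)).
Proof.
have -> : (fun xi => complex.Re (zprod s k xi)) =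
    (fun xi => \int[Q]_v cos (dot xi (lc (fun p => cwalk s p - cwalk k p) v))).
  apply/funext => xi; rewrite -zprodE; apply: eq_Rintegral => v _.
  by rewrite /walk lcB.
by apply: bmf_param (bmf_cos (measurable_dot2 _)).
Qed.

(** The kernel is written as a Fourier integral and the expectation is moved inside by Tonelli. The
    total mass (2 / e)^(d+1) of [qk e] is added on both sides to keep the integrands nonnegative. *)
Lemma gk_IQ s k : gk Q e s k = IQ e (fun xi => complex.Re (zprod s k xi)).
Proof.
pose D : V -> rv := lc (fun p => cwalk s p - cwalk k p).
have DE v : walk s v - walk k v = D v by rewrite /walk lcB.
have bc : bmf (fun q : rv * V => 1 + cos (dot q.1 (D q.2))).
  by apply: bmfD; [exact: bmf_cst|exact: (bmf_cos (measurable_dot2 _))].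
have c0 (q : rv * V) : 0 <= 1 + cos (dot q.1 (D q.2)).
  by rewrite -lerBlDl sub0r cos_geN1.
pose f (q : rv * V) := (qk e q.1 * (1 + cos (dot q.1 (D q.2))))%:E.
have mf : measurable_fun setT f.
  apply/measurable_EFinP; apply: measurable_funM; last exact: bc.1.
  exact: (measurableT_comp (measurable_qk e) measurable_fst).
have f0 q : (0 <= f q)%E by rewrite lee_fin mulr_ge0// qk_ge0.
have bcx xi : bmf (fun v : V => cos (dot xi (D v))).
  apply: bmf_cos; exact: (measurable_fun_pair2 xi (measurable_dot2 _)).
apply: (@addrI _ (1 * (2 / e) ^+ d.+1)).
rewrite -{2}(IQ_cst e0) -IQD//; [|exact: bmf_cst|exact: bmf_zprod].
have bg : bmf (fun v : V => pk e (walk s v - walk k v)) by exact: bmf_gk.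
rewrite mul1r -{1}(bmf_Rintegral_cst Q ((2 / e) ^+ d.+1)) -(bmf_RintegralD Q (bmf_cst _ _) bg).
apply: EFin_inj; rewrite EFin_Rintegral; last exact: (bmfD (bmf_cst _ _) bg).
rewrite EFin_IQ//; last by apply: bmfD; [exact: bmf_cst|exact: bmf_zprod].
transitivity (\int[Q]_v \int[nu d.+1]_xi f (xi, v))%E.
  apply: eq_integral => v _; rewrite /f /=.
  have := integral_fourier 0 (D v) e0; rewrite cos0 mul1r DE => <-.
  by apply: eq_integral => xi _; rewrite add0r.
rewrite -(fubini_tonelli f)//; apply: eq_integral => xi _.
rewrite /fubini_F /f /= -zprodE.
have -> : \int[Q]_v cos (dot xi (walk s v - walk k v)) = \int[Q]_v cos (dot xi (D v)).
  by apply: eq_Rintegral => v _; rewrite DE.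
have b1 := bmfD (bmf_cst _ (1:R)) (bcx xi).
have -> : 1 + \int[Q]_v cos (dot xi (D v)) = \int[Q]_v (1 + cos (dot xi (D v))).
  by rewrite (bmf_RintegralD Q (bmf_cst _ _) (bcx xi)) bmf_Rintegral_cst.
rewrite -(bmf_RintegralZl Q _ b1) EFin_Rintegral//.
exact: (bmfM (bmf_cst _ _) b1).
Qed.

End gk_fourier.

(** * The hitting inequality *)

Section resolvent_sums.
Context {R : realType}.
Local Open Scope complex_scope.
Implicit Types (z : R[i]) (r del q : R).

Lemma Re_sum I (r : seq I) (P : pred I) (F : I -> R[i]) :
  complex.Re (\sum_(i <- r | P i) F i) = \sum_(i <- r | P i) complex.Re (F i).
Proof. by apply: (big_morph (@complex.Re R)) => // -[? ?] [? ?]. Qed.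

Lemma ReZ r z : complex.Re (r%:C * z) = r * complex.Re z.
Proof. by case: z => x y /=; rewrite mul0r subr0. Qed.

Lemma conjcM z z' : conjc (z * z') = conjc z * conjc z'.
Proof. exact: rmorphM. Qed.

Lemma conjcX z k : conjc (z ^+ k) = conjc z ^+ k.
Proof. exact: rmorphXn. Qed.

Lemma conj_zpw z a b : conjc (zpw z a b) = zpw z b a.
Proof.
rewrite /zpw; case: (ltngtP a b) => [ab|ab|->]; last by rewrite subnn !expr0 conjc1.
  by rewrite conjcX conjcK.
by rewrite rmorphXn.
Qed.

(** A truncated discrete resolvent: for q = e^(-del) and z = e^(-del w) it is a Riemann sum of the
    integral of e^(-(1 + w) t). *)
Definition gA del q (L : nat) z : R[i] :=
  \sum_(u < L.+1) (del * q ^+ u)%:C * z ^+ u.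

(** The Fourier form of the energy of the measure with mass [del * q ^+ a] at the times a = 0, ...,
    M of one process. *)
Definition gB del q (M : nat) z : R[i] :=
  \sum_(a < M.+1) \sum_(b < M.+1)
    (del * q ^+ a * (del * q ^+ b))%:C * zpw z a b.

Lemma gA_conj del q L z : conjc (gA del q L z) = gA del q L (conjc z).
Proof.
rewrite /gA raddf_sum; apply: eq_bigr => u _.
by rewrite /= conjcM conjcX conjc_real.
Qed.

Lemma gB_conj del q M z : conjc (gB del q M z) = gB del q M z.
Proof.
rewrite /gB raddf_sum exchange_big; apply: eq_bigr => a _.
rewrite /= raddf_sum; apply: eq_bigr => b _.
by rewrite /= conjcM conjc_real conj_zpw [X in X%:C * _]mulrC.
Qed.

Lemma gB_real del q M z : gB del q M z = (complex.Re (gB del q M z))%:C.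
Proof.
have := gB_conj del q M z; case: (gB _ _ _ _) => x y [] /eqP.
by rewrite eq_sym -subr_eq0 opprK -mulr2n mulrn_eq0/= => /eqP ->.
Qed.

Lemma sum_shift L M (F : nat -> R[i]) :
  \sum_(a < (L + M).+1) (if (L <= a)%N then F (a - L)%N else 0) =
  \sum_(a < M.+1) F a.
Proof.
rewrite -(big_mkord xpredT (fun a => if (L <= a)%N then F (a - L)%N else 0)).
rewrite -addnS (big_cat_nat (n := L)) ?leq_addr//= big_nat_cond big1 ?add0r; last first.
  by move=> a; rewrite andbT => /andP[_]; rewrite ltnNge => /negbTE ->.
rewrite -{1}(add0n L) big_addn addKn big_mkord; apply: eq_bigr => a _.
by rewrite leq_addl addnK.
Qed.

Lemma sum_reflect L M (F : nat -> R[i]) :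
  \sum_(a < (L + M).+1) (if (a <= M)%N then F (M - a)%N else 0) =
  \sum_(a < M.+1) F a.
Proof.
rewrite -(big_mkord xpredT (fun a => if (a <= M)%N then F (M - a)%N else 0)).
rewrite -addSn addnC (big_cat_nat (n := M.+1)) ?leq_addr//=; last by lia.
rewrite [X in _ + X]big_nat_cond [X in _ + X]big1 ?addr0; last first.
  by move=> a; rewrite andbT => /andP[]; rewrite ltnNge => /negbTE ->.
rewrite big_mkord [RHS](reindex_inj rev_ord_inj)/=; apply: eq_bigr => a _.
by rewrite -ltnS ltn_ord subSS.
Qed.

Section windows.
Context (del q : R) (L M : nat).
Local Notation m := (L + M)%N.

(** Geometric weights on two windows of M + 1 times: [L, L + M], decaying upwards from L, for
    forward directions, and [0, M], decaying downwards from M, for backward ones. From any time in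
    [L, M] one can move L steps in the given direction without leaving the window. *)
Definition win (b : bool) (a : nat) : R :=
  if b then (if (a <= M)%N then del * q ^+ (M - a) else 0)
  else (if (L <= a)%N then del * q ^+ (a - L) else 0).

(** A shift or a reflection carries the window to 0, ..., M. [zpw] depends only on the difference of
    its arguments, and the exchange of the two sums undoes the swap caused by the reflection. *)
Lemma sum_win b z :
  \sum_(a < m.+1) \sum_(c < m.+1) (win b a * win b c)%:C * zpw z a c =
  gB del q M z.
Proof.
case: b; rewrite /win /gB.
- pose G (a c : nat) := (del * q ^+ a * (del * q ^+ c))%:C * zpw z c a.
  transitivity (\sum_(a < m.+1) (if (a <= M)%N then
      (\sum_(c < m.+1) if (c <= M)%N then G (M - a)%N (M - c)%N else 0) else 0)).
    apply: eq_bigr => a _; case: ifP => aM; last first.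
      by rewrite big1// => c _; rewrite mul0r mul0r.
    apply: eq_bigr => c _; case: ifP => cM; last by rewrite mulr0 mul0r.
    congr (_ * _); rewrite /zpw; case: (ltngtP c a) => ca.
    + by rewrite leq_sub2l 1?ltnW//; congr (_ ^+ _); lia.
    + by rewrite leqNgt (_ : (M - c < M - a)%N)/=; [congr (_ ^+ _); lia|lia].
    + by rewrite ca leqnn subnn subnn.
  rewrite (@sum_reflect L M (fun a => \sum_(c < m.+1) if (c <= M)%N then G a (M - c)%N else 0)).
  rewrite [RHS]exchange_big; apply: eq_bigr => a _.
  rewrite (@sum_reflect L M (fun c => G a c)); apply: eq_bigr => c _.
  by rewrite /G [X in X%:C * _]mulrC.
- pose G (a c : nat) := (del * q ^+ a * (del * q ^+ c))%:C * zpw z a c.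
  transitivity (\sum_(a < m.+1) (if (L <= a)%N then
      (\sum_(c < m.+1) if (L <= c)%N then G (a - L)%N (c - L)%N else 0) else 0)).
    apply: eq_bigr => a _; case: ifP => aM; last first.
      by rewrite big1// => c _; rewrite mul0r mul0r.
    apply: eq_bigr => c _; case: ifP => cM; last by rewrite mulr0 mul0r.
    congr (_ * _); rewrite /zpw (_ : (c - L <= a - L)%N = (c <= a)%N); last by lia.
    by case: leqP => ca; congr (_ ^+ _); lia.
  rewrite (@sum_shift L M (fun a => \sum_(c < m.+1) if (L <= c)%N then G a (c - L)%N else 0)).
  by apply: eq_bigr => a _; rewrite (@sum_shift L M (fun c => G a c)).
Qed.

End windows.
End resolvent_sums.

Section hitting.
Context {R : realType} {d n L K : nat}.
Local Notation M := (L + K)%N.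
Local Notation m := (L + M)%N.
Local Notation rv := (brv R d.+1).
Local Notation J := ('I_n * 'I_m)%type.
Local Notation V := (fprod rv J).
Local Notation idx := {ffun 'I_n -> 'I_m.+1}.
Context (Q : probability V R) (Qprod : product_law Q).
Context (e : R) (e0 : 0 < e).
Context (phi : 'I_n -> rv -> R[i]).
Hypothesis Qphi : forall j i xi,
  Complex (\int[Q]_v cos (dot xi (v (j, i)))) (\int[Q]_v sin (dot xi (v (j, i))))
  = phi j xi.
Context (del q : R) (del0 : 0 <= del) (q0 : 0 <= q) (q1 : q <= 1).
Implicit Types (s k : idx) (xi : rv) (g : {set 'I_n}).
Local Open Scope complex_scope.

Definition WW g s : R := \prod_j win del q L M (j \in g) (s j).

Lemma win_ge0 b a : 0 <= win del q L M b a.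
Proof. by rewrite /win; do 2?case: ifP => // _; rewrite mulr_ge0// exprn_ge0. Qed.

Lemma WW_ge0 g s : 0 <= WW g s.
Proof. by apply: prodr_ge0 => j _; exact: win_ge0. Qed.

Lemma Re_prod_sum (I : finType) (w : 'I_n -> I -> R) (z : 'I_n -> I -> R[i]) :
  complex.Re (\prod_j \sum_a (w j a)%:C * z j a) =
  \sum_(s : {ffun 'I_n -> I}) (\prod_j w j (s j)) * complex.Re (\prod_j z j (s j)).
Proof.
rewrite bigA_distr_bigA Re_sum; apply: eq_bigr => s _.
by rewrite big_split/= -[X in X * _](rmorph_prod (real_complex R)) ReZ.
Qed.

(** By distributivity the double sum over multi-indices factorises over the processes; each factor
    is real by [gB_real], so that the real part passes inside the product. *)
Lemma sum_WW_gk g :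
  \sum_s \sum_k WW g s * WW g k * gk Q e s k =
  IQ e (fun xi => \prod_j complex.Re (gB del q M (phi j xi))).
Proof.
have bz s k := bmf_zprod Qprod Qphi s k.
transitivity (\sum_s \sum_k IQ e (fun xi => WW g s * WW g k * complex.Re (zprod phi s k xi))).
  apply: eq_bigr => s _; apply: eq_bigr => k _.
  by rewrite (IQZ e0 _ (bz s k)) (gk_IQ Qprod e0 Qphi).
have bw s k : bmf (fun xi => WW g s * WW g k * complex.Re (zprod phi s k xi)).
  exact: (bmfM (bmf_cst _ (WW g s * WW g k)) (bz s k)).
under eq_bigr do rewrite -(IQ_sum e0)//.
rewrite -(IQ_sum e0); last by move=> s; apply: bmf_sum => k _; exact: bw.
congr IQ; apply/funext => xi.
transitivity (complex.Re (\prod_j \sum_(p : 'I_m.+1 * 'I_m.+1)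
   (win del q L M (j \in g) p.1 * win del q L M (j \in g) p.2)%:C *
   zpw (phi j xi) p.1 p.2)); last first.
  transitivity (complex.Re (\prod_j gB del q M (phi j xi))).
    congr complex.Re; apply: eq_bigr => j _; rewrite -(sum_win del q L M (j \in g)).
    by rewrite pair_big.
  under eq_bigr do rewrite gB_real.
  by rewrite -(rmorph_prod (real_complex R)).
transitivity (complex.Re (\sum_(s : idx) \sum_(k : idx) \prod_j
   ((win del q L M (j \in g) (s j) * win del q L M (j \in g) (k j))%:C *
   zpw (phi j xi) (s j) (k j)))).
  rewrite Re_sum; apply: eq_bigr => s _; rewrite Re_sum; apply: eq_bigr => k _.
  rewrite [X in _ = complex.Re X]big_split/= -(rmorph_prod (real_complex R)) ReZ.
  by rewrite big_split.
congr complex.Re.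
transitivity (\prod_j \sum_(a < m.+1) \sum_(b < m.+1)
   ((win del q L M (j \in g) (nat_of_ord a) * win del q L M (j \in g) (nat_of_ord b))%:C *
   zpw (phi j xi) (nat_of_ord a) (nat_of_ord b))); last first.
  by apply: eq_bigr => j _; rewrite pair_big.
rewrite bigA_distr_bigA; apply: eq_bigr => s _.
by rewrite bigA_distr_bigA.
Qed.

(** Corners at distance at least L from both ends of [0, m], so that a cube of side L fits into each
    of their quadrants. *)
Definition allowed : pred idx := fun k => [forall j, (L <= k j <= M)%N].

Definition dirn g (k : idx) (u : {ffun 'I_n -> 'I_L.+1}) : idx :=
  [ffun j => inord (if j \in g then k j - u j else k j + u j)%N].

Lemma dirnE g k u j : allowed k ->
  dirn g k u j = (if j \in g then k j - u j else k j + u j)%N :> nat.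
Proof.
move=> /forallP/(_ j)/andP[Lk kM]; rewrite ffunE inordK//.
by have := ltn_ord (u j); case: ifP => _; lia.
Qed.

Lemma dirn_inj g k : allowed k -> injective (dirn g k).
Proof.
move=> ak u u' uu; apply/ffunP => j; apply: val_inj => /=.
have := dirnE g u j ak; have := dirnE g u' j ak; rewrite uu => ->.
have /forallP/(_ j)/andP[Lk kM] := ak.
have := ltn_ord (u j); have := ltn_ord (u' j); case: ifP => _; lia.
Qed.

Lemma quad_dirn g k u : allowed k -> quad g k (dirn g k u).
Proof.
move=> ak; apply/forallP => j; rewrite dirnE//.
by case: (j \in g); [exact: leq_subr|exact: leq_addr].
Qed.

(** The window weights decay from an end of the window rather than from [k]; as [k] is at most K
    steps away from that end, the change of origin costs at most q^K in each of the n directions. *)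
Lemma WW_dirn g k (u : {ffun 'I_n -> 'I_L.+1}) : allowed k ->
  q ^+ (K * n) * \prod_j (del * q ^+ u j) <= WW g (dirn g k u).
Proof.
move=> ak; rewrite exprM -[X in _ ^+ X * _](card_ord n) -prodr_const -big_split/=.
apply: ler_prod => j _; rewrite !mulr_ge0 ?exprn_ge0//=.
have /forallP/(_ j)/andP[Lk kM] := ak.
have uL := ltn_ord (u j).
rewrite dirnE// /win; case: (j \in g).
  rewrite (_ : (k j - u j <= M)%N); last by lia.
  rewrite mulrCA ler_wpM2l// -exprD ler_wiXn2l//; lia.
rewrite (_ : (L <= k j + u j)%N); last by lia.
rewrite mulrCA ler_wpM2l// -exprD ler_wiXn2l//; lia.
Qed.

Lemma sum_dirn g k : allowed k ->
  q ^+ (K * n) * \sum_(u : {ffun 'I_n -> 'I_L.+1}) (\prod_j (del * q ^+ u j)) * gk Q e (dirn g k u) k <=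
  \sum_(s | quad g k s) WW g s * gk Q e s k.
Proof.
move=> ak.
have g0 s : 0 <= WW g s * gk Q e s k by rewrite mulr_ge0 ?WW_ge0 ?gk_ge0.
apply: (@le_trans _ _ (\sum_(u in [set: {ffun 'I_n -> 'I_L.+1}]%SET) WW g (dirn g k u) * gk Q e (dirn g k u) k)).
  rewrite big_set mulr_sumr; apply: ler_sum => u _.
  by rewrite mulrA ler_wpM2r ?gk_ge0// WW_dirn.
rewrite -(big_imset (fun s => WW g s * gk Q e s k)); last first.
  by move=> u u' _ _; exact: dirn_inj.
rewrite [leRHS](bigID (mem (dirn g k @: [set: {ffun 'I_n -> 'I_L.+1}]%SET)))/=.
rewrite [X in _ <= X + _](eq_bigl (mem (dirn g k @: [set: {ffun 'I_n -> 'I_L.+1}]%SET))).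
  by rewrite lerDl; exact: sumr_ge0.
move=> s /=; apply/andb_idl => /imsetP[u _ ->]; exact: quad_dirn.
Qed.

(** A backward displacement contributes the conjugate characteristic function, hence the conjugate
    of the same truncated resolvent. *)
Lemma sum_dirn_zprod g k xi : allowed k ->
  \sum_(u : {ffun 'I_n -> 'I_L.+1}) (\prod_j (del * q ^+ u j)) * complex.Re (zprod phi (dirn g k u) k xi) =
  complex.Re (\prod_j (if j \in g then conjc (gA del q L (phi j xi))
                       else gA del q L (phi j xi))).
Proof.
move=> ak; transitivity (complex.Re (\prod_j \sum_(u < L.+1) (del * q ^+ u)%:C *
    (if j \in g then conjc (phi j xi) ^+ u else phi j xi ^+ u))).
  rewrite Re_prod_sum; apply: eq_bigr => u _; congr (_ * complex.Re _).
  apply: eq_bigr => j _; rewrite /zpw dirnE//; case: (j \in g).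
    have /forallP/(_ j)/andP[Lk kM] := ak; have := ltn_ord (u j) => uL.
    have uk : (u j <= k j)%N by rewrite (leq_trans _ Lk)// -ltnS.
    case: leqP => h; last by rewrite subKn.
    have /eqP -> : nat_of_ord (u j) == 0%N.
      by move: h; rewrite -{1}(subnK uk) -[X in (_ <= X)%N]addn0 leq_add2l leqn0.
    by rewrite subn0 subnn !expr0.
  by rewrite leq_addr addKn.
congr complex.Re; apply: eq_bigr => j _; case: ifP => _ //.
by rewrite gA_conj.
Qed.

Lemma bmf_dirn g k u :
  bmf (fun xi => (\prod_j (del * q ^+ nat_of_ord ((u : {ffun 'I_n -> 'I_L.+1}) j))) *
                 complex.Re (zprod phi (dirn g k u) k xi)).
Proof. exact: (bmfM (bmf_cst _ _) (bmf_zprod Qprod Qphi _ _)). Qed.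

Lemma sum_dirn_gk g k : allowed k ->
  \sum_(u : {ffun 'I_n -> 'I_L.+1}) (\prod_j (del * q ^+ u j)) * gk Q e (dirn g k u) k =
  IQ e (fun xi => complex.Re (\prod_j
    (if j \in g then conjc (gA del q L (phi j xi)) else gA del q L (phi j xi)))).
Proof.
move=> ak.
have bz s := bmf_zprod Qprod Qphi s k.
transitivity (\sum_(u : {ffun 'I_n -> 'I_L.+1}) IQ e (fun xi => (\prod_j (del * q ^+ u j)) * complex.Re (zprod phi (dirn g k u) k xi))).
  by apply: eq_bigr => u _; rewrite (IQZ e0 _ (bz _)) (gk_IQ Qprod e0 Qphi).
rewrite -(IQ_sum e0); last by move=> u; exact: bmf_dirn.
by congr IQ; apply/funext => xi; exact: sum_dirn_zprod.
Qed.

(** The product of the sums of conjugate pairs expands over the sets [g], one term for each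
    quadrant. The resulting symbol does not depend on the corner, so it supplies the constant that
    [array_ineq] asks for. *)
Lemma hitting_ineq :
  (((3^-1 ^+ d.+1 * (q ^+ (K * n) *
      IQ e (fun xi => \prod_j (2 * complex.Re (gA del q L (phi j xi)))))) ^+ 2)%:E *
   (nu d.+1 \x Q) (near_walk e allowed) <=
   (#|{set 'I_n}|%:R * (4 ^+ n * ((16 * pi) ^+ d.+1 * (#|{set 'I_n}|%:R *
     IQ e (fun xi => \prod_j complex.Re (gB del q M (phi j xi)))))))%:E)%E.
Proof.
have GE k : allowed k ->
    IQ e (fun xi => \prod_j (2 * complex.Re (gA del q L (phi j xi)))) =
    \sum_g \sum_(u : {ffun 'I_n -> 'I_L.+1}) (\prod_j (del * q ^+ u j)) * gk Q e (dirn g k u) k.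
  move=> ak; under [RHS]eq_bigr do rewrite sum_dirn_gk//.
  rewrite -(IQ_sum e0); last first.
    move=> g.
    have -> : (fun xi => complex.Re (\prod_j
        (if j \in g then conjc (gA del q L (phi j xi)) else gA del q L (phi j xi)))) =
        (fun xi => \sum_(u : {ffun 'I_n -> 'I_L.+1})
          (\prod_j (del * q ^+ u j)) * complex.Re (zprod phi (dirn g k u) k xi)).
      by apply/funext => xi; rewrite sum_dirn_zprod.
    by apply: bmf_sum => u _; exact: bmf_dirn.
  congr IQ; apply/funext => xi; rewrite -Re_sum.
  transitivity (complex.Re (\prod_j (conjc (gA del q L (phi j xi)) + gA del q L (phi j xi)))).
    rewrite [in RHS](eq_bigr (fun j => (2 * complex.Re (gA del q L (phi j xi)))%:C)).
      by rewrite -(rmorph_prod (real_complex R)).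
    by move=> j _; rewrite addrC addcJ rmorphM/= rmorph_nat.
  by rewrite bigA_distr; congr complex.Re; apply: eq_bigl => g; rewrite inE.
(* One allowed corner suffices to see that the integral is nonnegative: there it is a weighted sum
   of values of [gk]. *)
have ak0 : allowed [ffun=> inord L].
  by apply/forallP => j; rewrite ffunE inordK ?leqnn ?leq_addr// ltnS leq_addr.
have G0 : 0 <= q ^+ (K * n) * IQ e (fun xi => \prod_j (2 * complex.Re (gA del q L (phi j xi)))).
  rewrite (GE _ ak0) mulr_ge0 ?exprn_ge0//; apply: sumr_ge0 => g _; apply: sumr_ge0 => u _.
  by rewrite mulr_ge0 ?gk_ge0// prodr_ge0// => j _; rewrite mulr_ge0 ?exprn_ge0.
apply: (le_trans (@array_ineq _ _ _ _ Q Qprod e e0 allowed WW _ WW_ge0 G0 _)).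
  move=> k ak; rewrite (GE _ ak) mulr_sumr; apply: ler_sum => g _; exact: sum_dirn.
rewrite lee_fin (eq_bigr (fun=> IQ e (fun xi => \prod_j complex.Re (gB del q M (phi j xi))))); last first.
  by move=> g _; exact: sum_WW_gk.
by rewrite sumr_const -[X in _ * (_ * (_ * X)) <= _]mulr_natl.
Qed.

End hitting.

(** * Resolvent limits *)

Section closed_forms.
Import Normc.
Context {R : realType}.
Local Open Scope complex_scope.
Context (del q : R) (del0 : 0 < del) (q0 : 0 < q) (q1 : q < 1).
Context (delq : del <= 2 * (1 - q)) (del1 : del <= 1).
Context (z : R[i]) (z1 : normc z <= 1).
Local Notation r := (q%:C * z).

Lemma Re_le_normc (w : R[i]) : `|complex.Re w| <= normc w.
Proof.
case: w => x y /=; rewrite -sqrtr_sqr ler_wsqrtr// lerDl sqr_ge0//.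
Qed.

Lemma normc_ge0 (w : R[i]) : 0 <= normc w.
Proof. by case: w => x y /=; exact: sqrtr_ge0. Qed.

Lemma normcR (x : R) : normc x%:C = `|x|.
Proof. by rewrite /= expr0n/= addr0 sqrtr_sqr. Qed.

Lemma normcX (w : R[i]) k : normc (w ^+ k) = normc w ^+ k.
Proof. by elim: k => [|k IH]; rewrite ?normc1// !exprS normcM IH. Qed.

Lemma normc_r : normc r <= q.
Proof. by rewrite normcM normcR gtr0_norm// ler_piMr// ltW. Qed.

Lemma normc_1Br : 1 - q <= normc (1 - r).
Proof.
have := le_normcD (1 - r) r; rewrite subrK normc1.
by have := normc_r; lra.
Qed.

Lemma r_neq1 : 1 - r != 0.
Proof.
by apply: contraTneq normc_1Br => ->; rewrite normc0 -ltNge subr_gt0.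
Qed.

Definition Ainf : R[i] := del%:C / (1 - r).

Lemma gAE L : gA del q L z = Ainf - Ainf * r ^+ L.+1.
Proof.
have -> : gA del q L z = del%:C * \sum_(u < L.+1) r ^+ u.
  rewrite mulr_sumr; apply: eq_bigr => u _.
  by rewrite exprMn mulrA; congr (_ * _); rewrite -rmorphXn -rmorphM.
have h : \sum_(u < L.+1) r ^+ u = (1 - r ^+ L.+1) / (1 - r).
  apply: (mulIf r_neq1); rewrite divfK ?r_neq1//.
  by rewrite mulrC -[1 - r]opprB mulNr -subrX1 opprB.
by rewrite h /Ainf; field; exact: r_neq1.
Qed.

(** The modulus of 1 - q z is at least 1 - q, hence at least del / 2. *)
Lemma normc_Ainf : normc Ainf <= 2.
Proof.
rewrite normcM normcV normcR gtr0_norm//.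
have h := normc_1Br; have : 0 < normc (1 - r) by apply: lt_le_trans h; rewrite subr_gt0.
move=> n0; rewrite ler_pdivrMr//; apply: (le_trans delq).
by rewrite ler_pM2l.
Qed.

Lemma gA_err L : `|complex.Re (gA del q L z) - complex.Re Ainf| <= 2 * q ^+ L.+1.
Proof.
rewrite gAE.
have -> : complex.Re (Ainf - Ainf * r ^+ L.+1) - complex.Re Ainf = - complex.Re (Ainf * r ^+ L.+1).
  by case: Ainf => a b; case: (_ * r ^+ _) => c e /=; lra.
rewrite normrN (le_trans (Re_le_normc _))// normcM normcX.
apply: ler_pM.
- exact: normc_ge0.
- by rewrite exprn_ge0// normc_ge0.
- exact: normc_Ainf.
- by rewrite lerXn2r ?nnegrE ?normc_ge0 ?(ltW q0)// normc_r.
Qed.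

Lemma Re_zpwC (a b : nat) : complex.Re (zpw z a b) = complex.Re (zpw z b a).
Proof. by rewrite -(conj_zpw z a b); case: (zpw z a b). Qed.

Lemma zpwSS (a b : nat) : zpw z a.+1 b.+1 = zpw z a b.
Proof. by rewrite /zpw ltnS !subSS. Qed.

(** The pairs with a zero index contribute 2 del Re A - del^2, where the correction counts the pair
    (0, 0) only once. All other pairs reproduce the previous sum with a factor q^2. *)
Lemma gB_rec M : complex.Re (gB del q M.+1 z) =
  q ^+ 2 * complex.Re (gB del q M z) + 2 * del * complex.Re (gA del q M.+1 z) - del ^+ 2.
Proof.
pose t (a b : nat) : R := del * q ^+ a * (del * q ^+ b) * complex.Re (zpw z a b).
have BE N : complex.Re (gB del q N z) = \sum_(a < N.+1) \sum_(b < N.+1) t a b.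
  rewrite Re_sum; apply: eq_bigr => a _; rewrite Re_sum; apply: eq_bigr => b _.
  by rewrite ReZ.
have AE : del * complex.Re (gA del q M.+1 z) = t 0%N 0%N + \sum_(a < M.+1) t a.+1 0%N.
  rewrite -(big_ord_recl _ (fun a : 'I_M.+2 => t a 0%N)).
  rewrite Re_sum mulr_sumr; apply: eq_bigr => a _.
  by rewrite ReZ /t /zpw leq0n subn0 expr0; ring.
have tC a b : t a b = t b a by rewrite /t Re_zpwC; ring.
rewrite !BE big_ord_recl (eq_bigr (fun b : 'I_M.+2 => t b 0%N)); last by move=> b _; rewrite tC.
rewrite -mulrA AE (eq_bigr (fun a : 'I_M.+1 => t a.+1 0%N + q ^+ 2 * \sum_(b < M.+1) t a b)); last first.
  move=> a _; rewrite big_ord_recl mulr_sumr; congr (_ + _).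
  by apply: eq_bigr => b _; rewrite /t /bump/= ?add1n zpwSS !exprS; ring.
rewrite big_split/= -mulr_sumr big_ord_recl/=.
have t00 : t 0%N 0%N = del ^+ 2 by rewrite /t /zpw leqnn subnn !expr0 /=; ring.
by rewrite t00 /=; ring.
Qed.

(** The fixed point of the recursion [gB_rec] once [gA] is replaced by its limit [Ainf]. *)
Definition Binf : R := (2 * del * complex.Re Ainf - del ^+ 2) / (1 - q ^+ 2).

(** The numerator is at most 4 del + del^2 <= 5 del <= 10 (1 - q) in absolute value, and 1 - q <= 1
    - q^2. *)
Lemma normr_Binf : `|Binf| <= 10.
Proof.
have q2 : 1 - q <= 1 - q ^+ 2 by have := q0; have := q1; nra.
have q20 : 0 < 1 - q ^+ 2 by apply: lt_le_trans q2; rewrite subr_gt0.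
rewrite normrM normfV (gtr0_norm q20) ler_pdivrMr//.
have /ler_normlP[] := le_trans (Re_le_normc Ainf) normc_Ainf.
rewrite ler_norml => h1 h2; apply/andP.
have := del0; have := del1; have := delq; split; nra.
Qed.

(** At M = 0 the error is at most 1 + 10. The induction closes because q (11 + 4 del) <= 11, which
    follows from del <= 2 (1 - q) and q < 1. *)
Lemma gB_err M : `|complex.Re (gB del q M z) - Binf| <= 11 * q ^+ M.
Proof.
elim: M => [|M IH].
  have -> : complex.Re (gB del q 0 z) = del * del.
    by rewrite /gB !big_ord1 ReZ /zpw leqnn subnn !expr0 /=; ring.
  rewrite expr0 mulr1.
  apply: (le_trans (ler_normB _ _)); have := normr_Binf.
  have : `|del * del| <= 1 by rewrite ger0_norm ?mulr_ge0 ?(ltW del0)//; apply: mulr_ile1; rewrite ?(ltW del0).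
  by rewrite /=; lra.
have BE : Binf = q ^+ 2 * Binf + 2 * del * complex.Re Ainf - del ^+ 2.
  rewrite /Binf; field; have := q0; have := q1; nra.
have -> : complex.Re (gB del q M.+1 z) - Binf =
    q ^+ 2 * (complex.Re (gB del q M z) - Binf) +
    2 * del * (complex.Re (gA del q M.+1 z) - complex.Re Ainf).
  by rewrite gB_rec {1}BE; ring.
apply: (le_trans (ler_normD _ _)).
rewrite [`|q ^+ 2 * _|]normrM [`|2 * del * _|]normrM.
rewrite (ger0_norm (exprn_ge0 2 (ltW q0))) (@ger0_norm _ (2 * del)); last first.
  by rewrite mulr_ge0// ltW.
have := gA_err M.+1; have := IH.
set E := `|_ - Binf|; set F := `|_ - complex.Re Ainf|; move=> hE hF.
have qM : 0 <= q ^+ M by rewrite exprn_ge0// ltW.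
have h1 : q ^+ 2 * E <= q * (q * (11 * q ^+ M)).
  by rewrite expr2 -mulrA !ler_wpM2l// ltW.
have h2 : 2 * del * F <= 2 * del * (2 * (q * (q * q ^+ M))).
  by rewrite -!exprS ler_wpM2l// mulr_ge0// ltW.
apply: (le_trans (lerD h1 h2)); rewrite exprS.
have -> : q * (q * (11 * q ^+ M)) + 2 * del * (2 * (q * (q * q ^+ M))) =
   (q * (11 + 4 * del)) * (q * q ^+ M) by ring.
rewrite ler_wpM2r ?mulr_ge0 ?(ltW q0)//; have := delq; have := q0; have := q1; nra.
Qed.

End closed_forms.

Section resolvent_limits.
Import Normc.
Context {R : realType}.
Local Open Scope complex_scope.

Definition dl (k : nat) : R := 2^-1 ^+ k.
Definition qq (k : nat) : R := expR (- dl k).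
(** [LL k] steps of length [dl k] last for time k, so that the truncation error [qq k ^+ LL k] =
    e^(-k) vanishes in the limit. *)
Definition LL (k : nat) : nat := (k * 2 ^ k)%N.

Lemma dl_gt0 k : 0 < dl k. Proof. by rewrite exprn_gt0// invr_gt0. Qed.

Lemma dl_le1 k : dl k <= 1.
Proof. by rewrite exprn_ile1 ?invr_ge0// invf_le1// ler1n. Qed.

Lemma qq_gt0 k : 0 < qq k. Proof. exact: expR_gt0. Qed.

Lemma qq_lt1 k : qq k < 1.
Proof. by rewrite -expR0 ltr_expR oppr_lt0 dl_gt0. Qed.

Lemma dl_qq k : dl k <= 2 * (1 - qq k).
Proof.
have d0 := dl_gt0 k; have d1 := dl_le1 k.
have h : qq k * (1 + dl k) <= 1.
  have e2 : 1 + dl k <= expR (dl k).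
    by have := expR_ge1Dxn 0 (ltW d0); rewrite expr1 divr1.
  by rewrite -[leRHS](expRxMexpNx_1 (dl k)) mulrC ler_wpM2r ?expR_ge0.
have := qq_gt0 k; nra.
Qed.

Lemma dl_cvg : dl k @[k --> \oo] --> (0 : R).
Proof. by apply: cvg_expr; rewrite ger0_norm ?invr_ge0// invf_lt1// ltr1n. Qed.

Lemma qq_LL k : qq k ^+ LL k = expR (- k%:R).
Proof.
rewrite /qq -expRM_natr /LL natrM natrX /dl; congr expR.
by rewrite mulNr mulrCA -exprMn mulVf// expr1n mulr1.
Qed.

Lemma qq_LL_cvg : qq k ^+ LL k @[k --> \oo] --> (0 : R).
Proof. by under eq_fun do rewrite qq_LL; exact: cvgn_expR. Qed.

Lemma diff_quotient_cvg (f : R -> R) (df : R) : is_derive (0 : R) 1 f df ->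
  (f (dl k) - f 0) / dl k @[k --> \oo] --> df.
Proof.
move=> df0.
have h0 : (fun h : R => h^-1 *: (f (h *: 1 + 0) - f 0)) h @[h --> 0^'] --> df.
  have := @ex_derive _ _ _ _ _ _ _ df0; rewrite /derivable => /cvg_ex[l hl].
  suff -> : df = l by exact: hl.
  by rewrite -(@derive_val _ _ _ _ _ _ _ df0); apply/cvg_lim.
have : (fun h : R => h^-1 *: (f (h *: 1 + 0) - f 0)) (dl k) @[k --> \oo] --> df.
  apply: (cvg_comp _ _ _ h0).
  move=> A; rewrite /dnbhs /within /= => h.
  have [e /= e0 He] : nbhs_ball (0:R) [set x | x != 0 -> A x] by apply/nbhs_ballP.
  have /cvgrPdist_lt/(_ _ e0)[N _ NH] := dl_cvg.
  exists N => // k Nk; apply: He; last by rewrite gt_eqF ?dl_gt0.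
  by rewrite -ball_normE; exact: NH.
apply: cvg_trans; apply: near_eq_cvg; apply: nearW => k.
by rewrite /GRing.scale/= mulr1 addr0 mulrC.
Qed.

Context (w : R[i]) (w0 : 0 <= complex.Re w).

Definition ph (k : nat) : R[i] := cexp (- ((dl k)%:C * w)).

Local Notation x := (1 + complex.Re w).
Local Notation y := (complex.Im w).

Lemma ph_le1 k : normc (ph k) <= 1.
Proof.
rewrite /ph /cexp normcM normcR ger0_norm ?expR_ge0//.
case: w w0 => u v /= u0.
rewrite [X in _ * X](_ : _ = 1); last by rewrite /normc cos2Dsin2 sqrtr1.
rewrite mulr1 -expR0 ler_expR mul0r subr0.
by rewrite oppr_le0 mulr_ge0// ltW// dl_gt0.
Qed.

(** [ak + i bk] equals (1 - exp (- dl (1 + w))) / dl, a difference quotient at 0; its limit is 1 +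
    w. *)
Definition ak (k : nat) : R := (1 - expR (- (dl k * x)) * cos (dl k * y)) / dl k.
Definition bk (k : nat) : R := expR (- (dl k * x)) * sin (dl k * y) / dl k.

Lemma ak_cvg : ak k @[k --> \oo] --> x.
Proof.
pose f (t : R) : R := - (expR (- (t * x)) * cos (t * y)).
have df : is_derive (0 : R) 1 f x.
  apply: is_derive_eq; rewrite /GRing.scale/= !mul0r oppr0 expR0 cos0 sin0.
  by ring.
apply: cvg_trans (diff_quotient_cvg df); apply: near_eq_cvg; apply: nearW => k.
by rewrite /ak /f !mul0r oppr0 expR0 cos0; congr (_ / _); ring.
Qed.

Lemma bk_cvg : bk k @[k --> \oo] --> y.
Proof.
pose f (t : R) : R := expR (- (t * x)) * sin (t * y).
have df : is_derive (0 : R) 1 f y.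
  apply: is_derive_eq; rewrite /GRing.scale/= !mul0r oppr0 expR0 cos0 sin0.
  by ring.
apply: cvg_trans (diff_quotient_cvg df); apply: near_eq_cvg; apply: nearW => k.
by rewrite /bk /f !mul0r sin0 mulr0 subr0.
Qed.

Lemma qph k : 1 - (qq k)%:C * ph k = (dl k)%:C * (ak k +i* bk k).
Proof.
have d0 : dl k != 0 by rewrite gt_eqF// dl_gt0.
rewrite /ph /cexp /ak /bk; case: w => u v /=.
have e1 : expR (- (dl k * (1 + u))) = qq k * expR (- (dl k * u)).
  by rewrite /qq -expRD; congr expR; ring.
apply/eqP; rewrite eq_complex /= e1 !mul0r !subr0 ?addr0 cosN sinN.
by apply/andP; split; apply/eqP; field.
Qed.

Lemma Re_AinfE k : complex.Re (Ainf (dl k) (qq k) (ph k)) =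
  ak k / (ak k ^+ 2 + bk k ^+ 2).
Proof.
rewrite /Ainf qph.
have d0 : (dl k)%:C != 0 :> R[i] by rewrite eq_complex /= gt_eqF// dl_gt0.
by rewrite invfM mulrA divff// mul1r.
Qed.

Definition rho : R := complex.Re (1 / (1 + w)).

Lemma rhoE : rho = x / (x ^+ 2 + y ^+ 2).
Proof. by rewrite /rho mul1r; case: w => u v /=; rewrite add0r. Qed.

Lemma rho_ge0 : 0 <= rho.
Proof.
rewrite rhoE divr_ge0 ?addr_ge0 ?sqr_ge0//.
Qed.

Lemma Ainf_cvg : complex.Re (Ainf (dl k) (qq k) (ph k)) @[k --> \oo] --> rho.
Proof.
under eq_fun do rewrite Re_AinfE; rewrite rhoE.
have h : x ^+ 2 + y ^+ 2 != 0.
  by rewrite gt_eqF// ltr_wpDr ?sqr_ge0// exprn_gt0// ltr_wpDr.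
apply: cvgM; first exact: ak_cvg.
apply: cvgV => //; apply: cvgD; rewrite expr2.
  by under eq_fun do rewrite expr2; apply: cvgM; exact: ak_cvg.
by under eq_fun do rewrite expr2; apply: cvgM; exact: bk_cvg.
Qed.

(** (1 - qq^2) / dl tends to 2, which cancels the factor 2 in front of Re [Ainf]; the term del^2
    disappears after division by [dl]. *)
Lemma Binf_cvg : Binf (dl k) (qq k) (ph k) @[k --> \oo] --> rho.
Proof.
pose f (t : R) : R := - expR (- (2 * t)).
have df : is_derive (0 : R) 1 f 2.
  by apply: is_derive_eq; rewrite /GRing.scale/= !mulr0 oppr0 expR0; ring.
have h : (1 - qq k ^+ 2) / dl k @[k --> \oo] --> (2 : R).
  apply: cvg_trans (diff_quotient_cvg df); apply: near_eq_cvg; apply: nearW => k.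
  rewrite /f !mulr0 oppr0 expR0 opprK addrC; congr ((_ - _) / _).
  by rewrite /qq -expRM_natr; congr expR; ring.
have -> : rho = (2 * rho - 0) / 2 by field.
have : (2 * complex.Re (Ainf (dl k) (qq k) (ph k)) - dl k) / ((1 - qq k ^+ 2) / dl k) @[k --> \oo]
    --> (2 * rho - 0) / 2.
  apply: cvgM; last by apply: cvgV.
  apply: cvgB; last exact: dl_cvg.
  by apply: cvgM; [exact: cvg_cst|exact: Ainf_cvg].
apply: cvg_trans; apply: near_eq_cvg; apply: nearW => k.
rewrite /Binf.
have d0 : dl k != 0 by rewrite gt_eqF// dl_gt0.
have q2 : 1 - qq k ^+ 2 != 0.
  by rewrite subr_eq0 eq_sym lt_eqF// exprn_ilt1 ?qq_lt1// ltW// qq_gt0.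
by field; rewrite ?d0 ?q2 ?andbT ?q2.
Qed.

Lemma gA_cvg : complex.Re (gA (dl k) (qq k) (LL k) (ph k)) @[k --> \oo] --> rho.
Proof.
have h : complex.Re (gA (dl k) (qq k) (LL k) (ph k)) - complex.Re (Ainf (dl k) (qq k) (ph k)) @[k --> \oo] --> (0 : R).
  apply/cvgr0Pnorm_le => eps eps0.
  have h : 2 * qq k ^+ LL k @[k --> \oo] --> (0 : R).
    by rewrite -[X in _ --> X](mulr0 2); apply: cvgM; [exact: cvg_cst|exact: qq_LL_cvg].
  near=> k.
  apply: (le_trans (gA_err (dl_gt0 k) (qq_gt0 k) (qq_lt1 k) (dl_qq k) (ph_le1 k) (LL k))).
  apply: (@le_trans _ _ (2 * qq k ^+ LL k)).
    by rewrite ler_pM2l// exprS ler_piMl ?exprn_ge0 ?(ltW (qq_lt1 k)) ?(ltW (qq_gt0 k)).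
  apply: (le_trans (ler_norm _)).
  by near: k; move/cvgr0Pnorm_le : h; exact.
rewrite (_ : (fun k => complex.Re (gA (dl k) (qq k) (LL k) (ph k))) = (fun k => (complex.Re (gA (dl k) (qq k) (LL k) (ph k)) - complex.Re (Ainf (dl k) (qq k) (ph k))) + complex.Re (Ainf (dl k) (qq k) (ph k)))).
  by rewrite -[X in _ --> X](add0r rho); apply: cvgD => //; exact: Ainf_cvg.
by apply/funext => k; rewrite subrK.
Unshelve. all: by end_near. Qed.

Lemma gB_cvg (M : nat -> nat) : (forall k, (LL k <= M k)%N) ->
  complex.Re (gB (dl k) (qq k) (M k) (ph k)) @[k --> \oo] --> rho.
Proof.
move=> LM.
have h : complex.Re (gB (dl k) (qq k) (M k) (ph k)) - Binf (dl k) (qq k) (ph k) @[k --> \oo] --> (0 : R).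
  apply/cvgr0Pnorm_le => eps eps0.
  have h : 11 * qq k ^+ LL k @[k --> \oo] --> (0 : R).
    by rewrite -[X in _ --> X](mulr0 11); apply: cvgM; [exact: cvg_cst|exact: qq_LL_cvg].
  near=> k.
  apply: (le_trans (gB_err (dl_gt0 k) (qq_gt0 k) (qq_lt1 k) (dl_qq k) (dl_le1 k) (ph_le1 k) (M k))).
  apply: (@le_trans _ _ (11 * qq k ^+ LL k)).
    by rewrite ler_pM2l// ler_wiXn2l ?(ltW (qq_lt1 k)) ?(ltW (qq_gt0 k)).
  apply: (le_trans (ler_norm _)).
  by near: k; move/cvgr0Pnorm_le : h; exact.
rewrite (_ : (fun k => complex.Re (gB (dl k) (qq k) (M k) (ph k))) = (fun k => (complex.Re (gB (dl k) (qq k) (M k) (ph k)) - Binf (dl k) (qq k) (ph k)) + Binf (dl k) (qq k) (ph k))).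
  by rewrite -[X in _ --> X](add0r rho); apply: cvgD => //; exact: Binf_cvg.
by apply/funext => k; rewrite subrK.
Unshelve. all: by end_near. Qed.

Lemma gA_bound k L : `|complex.Re (gA (dl k) (qq k) L (ph k))| <= 4.
Proof.
have := gA_err (dl_gt0 k) (qq_gt0 k) (qq_lt1 k) (dl_qq k) (ph_le1 k) L.
have := le_trans (Re_le_normc _) (normc_Ainf (dl_gt0 k) (qq_gt0 k) (qq_lt1 k) (dl_qq k) (ph_le1 k)).
have : qq k ^+ L.+1 <= 1 by rewrite exprn_ile1 ?(ltW (qq_lt1 k)) ?(ltW (qq_gt0 k)).
set A := complex.Re (gA _ _ _ _); set B := complex.Re (Ainf _ _ _) => h1 h2 h3.
have := ler_normD (A - B) B; rewrite subrK; lra.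
Qed.

Lemma gB_bound k M : `|complex.Re (gB (dl k) (qq k) M (ph k))| <= 21.
Proof.
have := gB_err (dl_gt0 k) (qq_gt0 k) (qq_lt1 k) (dl_qq k) (dl_le1 k) (ph_le1 k) M.
have := normr_Binf (dl_gt0 k) (qq_gt0 k) (qq_lt1 k) (dl_qq k) (dl_le1 k) (ph_le1 k).
have : qq k ^+ M <= 1 by rewrite exprn_ile1 ?(ltW (qq_lt1 k)) ?(ltW (qq_gt0 k)).
set A := complex.Re (gB _ _ _ _); set B := Binf _ _ _ => h1 h2 h3.
have := ler_normD (A - B) B; rewrite subrK; lra.
Qed.

End resolvent_limits.

(** * Increments of a Levy process *)

Section law.
Context {R : realType} {d1 d2} {S : measurableType d1} {T : measurableType d2}.
Context (P : probability S R) (X : S -> T) (mX : measurable_fun setT X).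

Let mX_mixin := isMeasurableFun.Build _ _ _ _ X mX.
Let X_pack : {mfun S >-> T} := HB.pack X mX_mixin.

Definition law : probability T R := distribution P X_pack.

Lemma lawE A : law A = P (X @^-1` A).
Proof. by []. Qed.

Lemma ge0_integral_law (f : T -> \bar R) :
  measurable_fun setT f -> (forall x, 0 <= f x)%E ->
  (\int[law]_x f x = \int[P]_s f (X s))%E.
Proof. by move=> mf f0; rewrite (ge0_integral_distribution X_pack). Qed.

Lemma Rintegral_law (f : T -> R) : bmf f ->
  \int[law]_x f x = \int[P]_s f (X s).
Proof.
move=> bf; congr fine; rewrite (integral_distribution (X := X_pack))//.
  by apply/measurable_EFinP; exact: bf.1.
exact: (bmf_integrable P (bmf_comp mX bf)).
Qed.

End law.

Section increments.
Context {R : realType} {dO} {Omega : measurableType dO} (P : probability Omega R).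
Context {d n m : nat} (Y : 'I_n -> R -> Omega -> 'rV[R]_d.+1).
Hypothesis levyY : forall j, levy_process P (Y j).
Hypothesis indepY : mutually_independent P (fun j => sigma_process (Y j)).
Context (Psi : 'I_n -> 'rV[R]_d.+1 -> R[i]).
Hypothesis expY : forall j, has_levy_exponent P (Y j) (Psi j).
Context (del : R) (del0 : 0 <= del) (sg sg' : 'I_m -> 'I_m).
Hypothesis sgK : cancel sg sg'.
Hypothesis sg'K : cancel sg' sg.
Local Notation rv := (brv R d.+1).
Local Notation J := ('I_n * 'I_m)%type.
Local Notation V := (fprod rv J).

Definition inc j (i : nat) (o : Omega) : rv := Y j (del * i.+1%:R) o - Y j (del * i%:R) o.

Lemma measurable_vecB dT (T : measurableType dT) (f g : T -> rv) :
  measurable_fun setT f -> measurable_fun setT g ->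
  measurable_fun setT (fun t => f t - g t : rv).
Proof.
move=> mf mg; apply: measurable_fun_brvP => i.
rewrite (_ : (fun t => _) = fun t => f t ord0 i - g t ord0 i); last first.
  by apply/funext => t; rewrite !mxE.
by apply: measurable_funB; exact: (measurableT_comp (measurable_coord i)).
Qed.

Lemma measurable_levy j t : 0 <= t -> measurable_fun setT (Y j t : Omega -> rv).
Proof.
move=> t0 _ B mB; rewrite setTI; apply: (levy_measurable (levyY j) t0).
by exists B.
Qed.

Lemma measurable_inc j i : measurable_fun setT (inc j i : Omega -> rv).
Proof. by apply: measurable_vecB; apply: measurable_levy; rewrite mulr_ge0. Qed.

(** The law of the increments is insensitive to their order, so they may be fed to the walk through
    any permutation [sg] of the time steps; later it will be a rotation. *)
Definition incs (o : Omega) : V := fun p => inc p.1 (sg p.2) o.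

Lemma measurable_incs : measurable_fun setT incs.
Proof. by apply: measurable_fun_fprodP => p; exact: measurable_inc. Qed.

Definition inc_law : probability V R := law P measurable_incs.

(** Independence of the processes is stated for events of [sigma_process]; a joint event for all
    increments of one process is of this kind. *)
Lemma sigma_process_inc j (B : 'I_m -> set rv) : (forall i, measurable (B i)) ->
  sigma_process (Y j) [set o | forall i : 'I_m, B i (inc j i o)].
Proof.
move=> mB.
pose W := g_sigma_algebraType [set A | exists2 t : R, 0 <= t & sigma_vector (Y j t) A].
have mY t : 0 <= t -> measurable_fun setT (Y j t : W -> rv).
  move=> t0 _ A mA; rewrite setTI; apply: sub_sigma_algebra; exists t => //.
  by exists A.
have minc i : measurable_fun setT (inc j i : W -> rv).
  by apply: measurable_vecB; apply: mY; rewrite mulr_ge0.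
suff : measurable ([set o | forall i : 'I_m, B i (inc j i o)] : set W) by [].
have -> : ([set o | forall i : 'I_m, B i (inc j i o)] : set W) =
    \bigcap_(i in [set: 'I_m]) (inc j i @^-1` B i).
  by rewrite eqEsubset; split=> o h i; [move=> _; exact: h|exact: (h i Logic.I)].
apply: fin_bigcap_measurable => // i _; rewrite -[X in measurable X]setTI.
exact: minc.
Qed.

Lemma inc_independent j (B : 'I_m -> set rv) : (forall i, measurable (B i)) ->
  P [set o | forall i : 'I_m, B i (inc j i o)] =
  (\prod_(i < m) P (inc j i @^-1` B i))%E.
Proof.
move=> mB.
have := @levy_independent_increments _ _ _ _ _ _ (levyY j) (fun k => del * k%:R) m.
rewrite mulr0 lexx => /(_ isT).
have mono : {homo (fun k : nat => del * k%:R) : k l / (k <= l)%N >-> k <= l}.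
  by move=> k l kl; rewrite ler_wpM2l// ler_nat.
move=> /(_ mono [set: 'I_m]%SET (fun i => inc j i @^-1` B i)).
have -> : \bigcap_(i in [set` [set: 'I_m]%SET]) (inc j i @^-1` B i) =
    [set o | forall i : 'I_m, B i (inc j i o)].
  rewrite eqEsubset; split=> o h i /=; last by move=> _; exact: h.
  by apply: (h i); rewrite /= inE.
move=> ->; last by move=> i _; exists (B i) => //; exact: mB.
by apply: eq_bigl => i; rewrite inE.
Qed.

Lemma inc_law_product : product_law inc_law.
Proof.
move=> B mB; rewrite lawE.
have -> : incs @^-1` [set v | forall p, B p (v p)] =
    \bigcap_(j in [set` [set: 'I_n]%SET])
      [set o | forall i : 'I_m, B (j, sg' i) (inc j i o)].
  rewrite eqEsubset; split=> o /= h.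
    by move=> j _ i; have := h (j, sg' i); rewrite /incs /= sg'K.
  move=> [j i]; have jT : [set` [set: 'I_n]%SET] j by rewrite /= inE.
  by have := h j jT (sg i); rewrite sgK.
rewrite (indepY (K := [set: 'I_n]%SET)); last first.
  by move=> j _; exact: (@sigma_process_inc j (fun i => B (j, sg' i)) (fun i => mB (j, sg' i))).
transitivity (\prod_j \prod_i inc_law [set v | B (j, i) (v (j, i))])%E; last first.
  by rewrite pair_bigA; apply: eq_bigr => -[].
rewrite (eq_bigl xpredT); last by move=> j; rewrite inE.
apply: eq_bigr => j _; rewrite (@inc_independent j (fun i => B (j, sg' i)) (fun i => mB (j, sg' i))).
rewrite [LHS](reindex_inj (can_inj sgK)); apply: eq_bigr => i _.
by rewrite sgK.
Qed.

Lemma cexp_i (a : R) : cexp ('i * (a%:C))%C = Complex (cos a) (sin a).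
Proof.
by rewrite /cexp; simpc; rewrite /= ?(mul0r,mul1r,addr0,sub0r,oppr0,subr0,expR0,add0r).
Qed.

Lemma levy_char j xi t : 0 <= t ->
  Complex (\int[P]_o cos (dot xi (Y j t o))) (\int[P]_o sin (dot xi (Y j t o))) =
  cexp (- (t%:C%C * Psi j xi)).
Proof.
move=> t0; rewrite -(expY j xi t0) /cexpectation.
by congr Complex; apply: eq_Rintegral => o _; rewrite cexp_i.
Qed.

Lemma inc_char j i xi :
  Complex (\int[inc_law]_v cos (dot xi (v (j, i))))
          (\int[inc_law]_v sin (dot xi (v (j, i)))) =
  cexp (- (del%:C%C * Psi j xi)).
Proof.
rewrite -(levy_char j xi del0).
have md := measurable_dotr xi.
have mp : measurable_fun setT (fun v : V => dot xi (v (j, i))).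
  by apply: (measurableT_comp md); exact: measurable_fproj.
rewrite !Rintegral_law; [|exact: bmf_sin|exact: bmf_cos].
have mD := measurable_levy j del0.
have same (f : rv -> R) : bmf f -> \int[P]_o f (inc j (sg i) o) = \int[P]_o f (Y j del o).
  move=> bf; rewrite -(Rintegral_law P (measurable_inc j (sg i)) bf) -(Rintegral_law P mD bf).
  congr fine; apply: eq_measure_integral => A mA _.
  change (P (inc j (sg i) @^-1` A) = P (Y j del @^-1` A)).
  have := @levy_stationary_increments _ _ _ _ _ _ (levyY j) (del * (sg i)%:R) del A.
  rewrite mulr_ge0// => /(_ isT del0 mA) <-; congr (P _).
  rewrite eqEsubset; split=> o /=; rewrite /inc -natr1 mulrDr mulr1; exact.
congr Complex.
  exact: (same (fun x : rv => cos (dot xi x)) (bmf_cos md)).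
exact: (same (fun x : rv => sin (dot xi x)) (bmf_sin md)).
Qed.

End increments.

(** * Measurability of the complex symbols *)

Section complex_measurability.
Context {R : realType} {dT} {T : measurableType dT}.
Local Open Scope complex_scope.
Implicit Types f g : T -> R[i].

Definition cmeas f :=
  measurable_fun setT (fun x => complex.Re (f x)) /\
  measurable_fun setT (fun x => complex.Im (f x)).

Lemma cmeas_cst c : cmeas (fun=> c).
Proof. by []. Qed.

Lemma cmeasM f g : cmeas f -> cmeas g -> cmeas (fun x => f x * g x).
Proof.
move=> [f1 f2] [g1 g2]; split.
  rewrite (_ : (fun x => _) = fun x => complex.Re (f x) * complex.Re (g x) -
      complex.Im (f x) * complex.Im (g x)).
    by apply: measurable_funB; apply: measurable_funM.
  by apply/funext => x; case: (f x) => ? ?; case: (g x).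
rewrite (_ : (fun x => _) = fun x => complex.Re (f x) * complex.Im (g x) +
    complex.Im (f x) * complex.Re (g x)).
  by apply: measurable_funD; apply: measurable_funM.
by apply/funext => x; case: (f x) => ? ?; case: (g x).
Qed.

Lemma cmeasX f n : cmeas f -> cmeas (fun x => f x ^+ n).
Proof.
move=> mf; elim: n => [|n ih]; first exact: cmeas_cst.
rewrite (_ : (fun x => _) = fun x => f x * f x ^+ n); first exact: cmeasM.
by apply/funext => x; rewrite exprS.
Qed.

Lemma cmeas_sum I (r : seq I) (f : I -> T -> R[i]) : (forall i, cmeas (f i)) ->
  cmeas (fun x => \sum_(i <- r) f i x).
Proof.
move=> mf; split.
  rewrite (_ : (fun x => _) = fun x => \sum_(i <- r) complex.Re (f i x)).
    by apply: measurable_sum => i; have [] := mf i.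
  by apply/funext => x; rewrite raddf_sum.
rewrite (_ : (fun x => _) = fun x => \sum_(i <- r) complex.Im (f i x)).
  by apply: measurable_sum => i; have [] := mf i.
by apply/funext => x; rewrite raddf_sum.
Qed.

Lemma cmeas_conj f : cmeas f -> cmeas (fun x => conjc (f x)).
Proof.
move=> [f1 f2]; split.
  by rewrite (_ : (fun x => _) = fun x => complex.Re (f x))//; apply/funext => x; case: (f x).
rewrite (_ : (fun x => _) = fun x => - complex.Im (f x)); first exact: measurableT_comp.
by apply/funext => x; case: (f x).
Qed.

Lemma cmeas_zpw f a b : cmeas f -> cmeas (fun x => zpw (f x) a b).
Proof.
move=> mf; rewrite /zpw; case: (b <= a)%N; first exact: cmeasX.
exact: (cmeasX _ (cmeas_conj mf)).
Qed.

Lemma measurable_Re_gA f del q L : cmeas f ->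
  measurable_fun setT (fun x => complex.Re (gA del q L (f x))).
Proof.
move=> mf; have [] // : cmeas (fun x => gA del q L (f x)).
by apply: cmeas_sum => i; apply: cmeasM; [exact: cmeas_cst|exact: cmeasX].
Qed.

Lemma measurable_Re_gB f del q M : cmeas f ->
  measurable_fun setT (fun x => complex.Re (gB del q M (f x))).
Proof.
move=> mf; have [] // : cmeas (fun x => gB del q M (f x)).
apply: cmeas_sum => i; apply: cmeas_sum => k.
by apply: cmeasM; [exact: cmeas_cst|exact: cmeas_zpw].
Qed.

End complex_measurability.

Lemma cvg_prodr (R : realType) I (r : seq I) (f : I -> nat -> R) (l : I -> R) :
  (forall i, f i k @[k --> \oo] --> l i) ->
  \prod_(i <- r) f i k @[k --> \oo] --> \prod_(i <- r) l i.
Proof.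
move=> fl; elim: r => [|i r ih].
  by under eq_fun do rewrite big_nil; rewrite big_nil; exact: cvg_cst.
by under eq_fun do rewrite big_cons; rewrite big_cons; exact: cvgM.
Qed.

Section exponent.
Context {R : realType} {dO} {Omega : measurableType dO} (P : probability Omega R).
Context {d n : nat} (Y : 'I_n -> R -> Omega -> 'rV[R]_d.+1).
Hypothesis levyY : forall j, levy_process P (Y j).
Context (Psi : 'I_n -> 'rV[R]_d.+1 -> R[i]).
Hypothesis expY : forall j, has_levy_exponent P (Y j) (Psi j).
Local Notation rv := (brv R d.+1).

Lemma measurable_dot_levy j xi t : 0 <= t ->
  measurable_fun setT (fun o => dot xi (Y j t o)).
Proof.
move=> t0; exact: (measurableT_comp (measurable_dotr xi) (measurable_levy levyY j t0)).
Qed.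

(** For the characteristic function c + i s at time 1, c^2 + s^2 is the expectation of c cos + s
    sin, which is at most (c^2 + s^2 + 1) / 2. So its squared modulus e^(-2 Re Psi) is at most 1. *)
Lemma Re_exponent_ge0 j xi : 0 <= complex.Re (Psi j xi).
Proof.
have := levy_char expY j xi (ler01 : 0 <= 1 :> R).
set c := Rintegral _ _ _; set s := Rintegral _ _ _ => cs.
have md := measurable_dot_levy j xi (ler01 : 0 <= 1 :> R).
have bc := bmf_cos md; have bs := bmf_sin md.
have : c ^+ 2 + s ^+ 2 <= 1.
  have : c * c + s * s <= 2^-1 * (c ^+ 2 + s ^+ 2 + 1).
    rewrite {2}/c {3}/s -!(bmf_RintegralZl P)// -bmf_RintegralD; last 2 first.
    - exact: (bmfM (bmf_cst _ _) bc).
    - exact: (bmfM (bmf_cst _ _) bs).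
    rewrite -[leRHS](bmf_Rintegral_cst P); apply: bmf_le_Rintegral.
    - exact: (bmfD (bmfM (bmf_cst _ _) bc) (bmfM (bmf_cst _ _) bs)).
    - exact: bmf_cst.
    move=> o; have := cos2Dsin2 (dot xi (Y j 1 o)).
    set u := cos _; set v := sin _ => uv.
    have := sqr_ge0 (c - u); have := sqr_ge0 (s - v); rewrite -/s; nra.
  nra.
move: cs; rewrite /cexp mul1r; case: (Psi j xi) => x y /=.
case; rewrite !mul0r subr0 addr0 => -> ->.
rewrite !exprMn -mulrDr cos2Dsin2 mulr1 -expRM_natl.
rewrite -[leRHS](expR0 R) ler_expR; lra.
Qed.

Lemma cmeas_ph j k : cmeas (fun xi : rv => ph (Psi j xi) k).
Proof.
have mD : measurable_fun setT (fun p : rv * Omega => dot p.1 (Y j (dl k) p.2)).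
  apply: measurable_sum => i; apply: measurable_funM.
    exact: (measurableT_comp (measurable_coord i) measurable_fst).
  exact: (measurableT_comp (measurable_coord i)
    (measurableT_comp (measurable_levy levyY j (ltW (dl_gt0 k))) measurable_snd)).
split.
  rewrite (_ : (fun xi => _) = fun xi => \int[P]_o cos (dot xi (Y j (dl k) o))).
    by have [] := bmf_param P (bmf_cos mD).
  by apply/funext => xi; rewrite /ph -(levy_char expY j xi (ltW (dl_gt0 k))).
rewrite (_ : (fun xi => _) = fun xi => \int[P]_o sin (dot xi (Y j (dl k) o))).
  by have [] := bmf_param P (bmf_sin mD).
by apply/funext => xi; rewrite /ph -(levy_char expY j xi (ltW (dl_gt0 k))).
Qed.

(** [Psi] is known only through the exponentials of - t Psi. Those are characteristic functions,
    hence measurable in xi, and rho is a pointwise limit of the functions [gA] of them. *)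
Lemma bmf_rho j : bmf (fun xi : rv => rho (Psi j xi)).
Proof.
split; last first.
  exists 1 => xi; rewrite ger0_norm ?rho_ge0 ?Re_exponent_ge0//.
  rewrite rhoE; have := Re_exponent_ge0 j xi; set x := complex.Re _ => x0.
  rewrite ler_pdivrMr; last by rewrite ltr_wpDr ?sqr_ge0// exprn_gt0// ltr_wpDr.
  have := sqr_ge0 (complex.Im (Psi j xi)); nra.
apply: (measurable_fun_cvg (h := fun k (xi : rv) =>
  complex.Re (gA (dl k) (qq k) (LL k) (ph (Psi j xi) k)))).
  by move=> k; apply: measurable_Re_gA; exact: cmeas_ph.
by move=> xi _; apply: gA_cvg; exact: Re_exponent_ge0.
Qed.

Definition rhos (xi : rv) : R := \prod_j rho (Psi j xi).

Lemma bmf_prod (I : finType) (f : I -> rv -> R) : (forall i, bmf (f i)) ->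
  bmf (fun xi => \prod_i f i xi).
Proof.
move=> bf; elim: (index_enum I) => [|i r ih].
  by rewrite (_ : (fun xi => _) = fun=> 1); [exact: bmf_cst|apply/funext => xi; rewrite big_nil].
rewrite (_ : (fun xi => _) = fun xi => f i xi * \prod_(j <- r) f j xi).
  exact: (bmfM (bf i) ih).
by apply/funext => xi; rewrite big_cons.
Qed.

Lemma bmf_rhos : bmf rhos.
Proof. by apply: bmf_prod => j; exact: bmf_rho. Qed.

Lemma rhos_ge0 xi : 0 <= rhos xi.
Proof. by apply: prodr_ge0 => j _; rewrite rho_ge0// Re_exponent_ge0. Qed.

Context (e : R) (e0 : 0 < e).

Lemma IQ_prod_cvg (f : nat -> 'I_n -> rv -> R) (l : 'I_n -> rv -> R) (B : R) :
  (forall k j, measurable_fun setT (f k j)) -> (forall k j xi, `|f k j xi| <= B) ->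
  (forall j, bmf (l j)) -> (forall j xi, f k j xi @[k --> \oo] --> l j xi) ->
  IQ e (fun xi => \prod_j f k j xi) @[k --> \oo] --> IQ e (fun xi => \prod_j l j xi).
Proof.
move=> mf fB bl fl; apply: (IQ_cvg e0 (B := B ^+ n)).
- move=> k; apply: measurable_prod => j _; exact: mf.
- move=> k xi; rewrite normr_prod -[X in _ ^+ X](card_ord n) -prodr_const.
  by apply: ler_prod => j _; rewrite normr_ge0 fB.
- exact: bmf_prod.
- by move=> xi; apply: cvg_prodr => j; exact: fl.
Qed.

Lemma IQ_gA_cvg :
  IQ e (fun xi => \prod_j (2 * complex.Re (gA (dl k) (qq k) (LL k) (ph (Psi j xi) k))))
    @[k --> \oo] --> 2 ^+ n * IQ e rhos.
Proof.
rewrite -(IQZ e0 _ bmf_rhos).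
rewrite (_ : (fun xi => _ * rhos xi) = fun xi => \prod_j (2 * rho (Psi j xi))); last first.
  by apply/funext => xi; rewrite big_split/= prodr_const card_ord.
apply: (IQ_prod_cvg (f := fun k j xi => 2 * complex.Re (gA (dl k) (qq k) (LL k) (ph (Psi j xi) k))) (B := 8)).
- by move=> k j; apply: measurable_funM => //; apply: measurable_Re_gA; exact: cmeas_ph.
- move=> k j xi; rewrite normrM ger0_norm//.
  have := gA_bound (Re_exponent_ge0 j xi) k (LL k); lra.
- by move=> j; exact: (bmfM (bmf_cst _ _) (bmf_rho j)).
- move=> j xi; apply: cvgM; first exact: cvg_cst.
  by apply: gA_cvg => //; exact: Re_exponent_ge0.
Qed.

Lemma IQ_gB_cvg M : (forall k, LL k <= M k)%N ->
  IQ e (fun xi => \prod_j complex.Re (gB (dl k) (qq k) (M k) (ph (Psi j xi) k)))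
    @[k --> \oo] --> IQ e rhos.
Proof.
move=> LM; apply: (IQ_prod_cvg (f := fun k j xi => complex.Re (gB (dl k) (qq k) (M k) (ph (Psi j xi) k)))
  (l := fun j xi => rho (Psi j xi)) (B := 21)).
- by move=> k j; apply: measurable_Re_gB; exact: cmeas_ph.
- by move=> k j xi; apply: gB_bound; exact: Re_exponent_ge0.
- exact: bmf_rho.
- by move=> j xi; apply: gB_cvg => //; exact: Re_exponent_ge0.
Qed.

End exponent.

(** * Limits inferior and lower integrals *)

Section limit_tools.
Context {R : realType}.
Local Open Scope ereal_scope.

Lemma limn_einfE_sup (u : (\bar R)^nat) : limn_einf u = ereal_sup (range (einfs u)).
Proof. by rewrite limn_einf_lim; apply/cvg_lim => //; exact: cvg_einfs_sup. Qed.

Lemma limn_einf_le_near (u : (\bar R)^nat) c n0 :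
  (forall k, (n0 <= k)%N -> u k <= c) -> limn_einf u <= c.
Proof.
move=> uc; rewrite limn_einfE_sup; apply: ge_ereal_sup => _ [n _ <-].
apply: (@le_trans _ _ (u (maxn n n0))); last by apply: uc; exact: leq_maxr.
by apply: ereal_inf_lbound; exists (maxn n n0) => //=; exact: leq_maxl.
Qed.

Lemma einfs_le_limn_einf (u : (\bar R)^nat) n : einfs u n <= limn_einf u.
Proof. by rewrite limn_einfE_sup; apply: ereal_sup_ubound; exists n. Qed.

Lemma limn_einf_ge0 (u : (\bar R)^nat) : (forall k, 0 <= u k) -> 0 <= limn_einf u.
Proof.
move=> u0; apply: (le_trans _ (einfs_le_limn_einf u 0)).
by apply: le_ereal_inf_tmp => _ [k _ <-].
Qed.

Lemma measurable_fun_limn_einf d (T : measurableType d) (f : nat -> T -> \bar R) :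
  (forall n, measurable_fun setT (f n)) ->
  measurable_fun setT (fun x => limn_einf (f ^~ x)).
Proof.
move=> mf.
rewrite (_ : (fun x => _) = fun x => - limn_esup (fun n => - f n x)).
  apply: measurableT_comp => //; apply: (measurable_fun_limn_esup (f := fun n x => - f n x)) => n.
  exact: measurableT_comp.
by [].
Qed.

Lemma measure_liminf_le d (T : measurableType d) (mu : {measure set T -> \bar R})
    (U : (set T)^nat) : (forall k, measurable (U k)) ->
  mu (\bigcup_n \bigcap_(k in [set k | (n <= k)%N]) U k) <= limn_einf (mu \o U).
Proof.
move=> mU; set V := fun n => \bigcap_(k in _) U k.
have mV n : measurable (V n) by exact: bigcap_measurableType.
have V_nd : nondecreasing_seq V.
  move=> n m nm; apply/subsetPset => x Vx k /= mk; apply: Vx => /=.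
  exact: leq_trans nm mk.
have cvgV := nondecreasing_cvg_mu (mu := mu) mV (bigcup_measurable (fun n _ => mV n)) V_nd.
rewrite -(cvg_lim _ cvgV)//; apply: lime_le.
  by apply/cvg_ex; eexists; exact: cvgV.
apply: nearW => n; apply: (le_trans _ (einfs_le_limn_einf _ n)).
apply: le_ereal_inf_tmp => _ [k /= nk <-]; apply: le_measure; rewrite ?inE//.
by move=> x; exact.
Qed.

Section nonmeasurable.
Context d (T : measurableType d) (mu : {measure set T -> \bar R}).

(* The integral of a nonnegative function is a supremum over the simple functions
   below it, so neither side need be measurable. *)
Lemma le_integral_nonneg (f g : T -> \bar R) :
  (forall x, 0 <= f x) -> (forall x, 0 <= g x) -> (forall x, f x <= g x) ->
  \int[mu]_x f x <= \int[mu]_x g x.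
Proof.
move=> f0 g0 fg; rewrite ge0_integralTE// [leRHS]ge0_integralTE//.
apply: ge_ereal_sup => _ [h /= hf <-]; apply: ereal_sup_ubound; exists h => //= x.
exact: le_trans (hf x) (fg x).
Qed.

(** Raising [g] to +oo on the null set keeps its integral and makes the inequality hold everywhere,
    so that [le_integral_nonneg] applies to an [f] that may fail to be measurable. *)
Lemma le_integral_nonmeasurable (f g : T -> \bar R) :
  (forall x, 0 <= f x) -> (forall x, 0 <= g x) -> measurable_fun setT g ->
  {ae mu, forall x, f x <= g x} -> \int[mu]_x f x <= \int[mu]_x g x.
Proof.
move=> f0 g0 mg [N [mN N0 Nfg]].
pose g' x := if x \in N then +oo else g x.
have mg' : measurable_fun setT g'.
  apply: measurable_fun_ifT => //.
  by apply: (measurable_fun_bool true); rewrite setTI (_ : _ @^-1` _ = N)//; apply/seteqP; split=> x /=; [exact: set_mem|exact: mem_set].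
have g'0 x : 0 <= g' x by rewrite /g'; case: ifP.
have -> : \int[mu]_x g x = \int[mu]_x g' x.
  apply: ge0_ae_eq_integral => //; exists N; split=> // x /= h.
  by apply: contrapT => Nx; apply: h => _; rewrite /g' memNset.
apply: le_integral_nonneg => // x; rewrite /g'; case: ifPn => [_|]; first exact: leey.
rewrite notin_setE => Nx; apply: contrapT => fg; exact: Nx (Nfg _ fg).
Qed.
End nonmeasurable.

Lemma product_measure_integral d1 d2 (T1 : measurableType d1) (T2 : measurableType d2)
    (m1 : {sigma_finite_measure set T1 -> \bar R})
    (m2 : {sigma_finite_measure set T2 -> \bar R}) (A : set (T1 * T2)) :
  measurable A -> (m1 \x m2) A = \int[m2]_y m1 (ysection A y).
Proof.
move=> mA; rewrite (product_measure_unique (m' := m1 \x^ m2))// => B C mB mC.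
exact: product_measure2E.
Qed.

End limit_tools.

(** * Necessity *)

(* Feeding the walk with the increments rotated by [L + K] inserts [L] steps before
   time [0] of the process, so that the two-sided windows of [hitting_ineq] fit. *)
Section rotation.
Context {m : nat}.

Definition rot_ord (a : nat) (i : 'I_m) : 'I_m :=
  Ordinal (ltn_pmod (i + a) (leq_ltn_trans (leq0n i) (ltn_ord i))).

Lemma rot_ordK a b : (a + b)%N = m -> cancel (rot_ord a) (rot_ord b).
Proof.
move=> abm i; apply: val_inj; rewrite /= modnDml -addnA abm modnDr modn_small//.
Qed.

End rotation.

Section hitting_set.
Context {R : realType} {dO} {Omega : measurableType dO} (P : probability Omega R).
Context {d n L K : nat} (Y : 'I_n -> R -> Omega -> 'rV[R]_d.+1).
Hypothesis levyY : forall j, levy_process P (Y j).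
Context (del : R) (del0 : 0 <= del) (e : R).
Local Notation rv := (brv R d.+1).
Local Notation m := (L + (L + K))%N.
Local Notation sg := (rot_ord (m := m) (L + K)).

(** The closed [e]-neighbourhood, in the sup norm, of the positions at the grid times 0, ..., M.
    Positions are taken relative to time 0, since [Y j 0] vanishes only almost surely. *)
Definition hit (M : nat) (o : Omega) : set rv :=
  [set x | exists u : {ffun 'I_n -> 'I_M.+1}, forall i,
    `|(x - \sum_j (Y j (del * (u j)%:R) o - Y j 0 o)) ord0 i| <= e].

Lemma measurable_hit M o : measurable (hit M o).
Proof.
pose S (u : {ffun 'I_n -> 'I_M.+1}) := \sum_j (Y j (del * (u j)%:R) o - Y j 0 o).
rewrite (_ : hit M o = \bigcup_(u in [set: {ffun 'I_n -> 'I_M.+1}])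
    box (S u - const_mx e, S u + const_mx e)).
  by apply: fin_bigcup_measurable => // u _; exact: measurable_box.
apply/seteqP; split=> x.
  move=> [u hu]; exists u => // i; have := hu i; rewrite ler_norml !mxE => /andP[h1 h2].
  by apply/andP; split; rewrite /S in h1 h2 *; lra.
move=> [u _ hu]; exists u => i; have := hu i; rewrite ler_norml !mxE => /andP[h1 h2].
by apply/andP; split; rewrite /S in h1 h2 *; lra.
Qed.

Definition pre (o : Omega) : 'rV[R]_d.+1 :=
  \sum_j \sum_(0 <= i < L) inc Y del j ((i + (L + K)) %% m) o.

(** The first L steps use the increments with indices L + K, ..., m - 1 and lead to [pre]. From then
    on the rotated index exceeds the process time by exactly m, so the increments are those of the
    process from time 0 and their sum telescopes. *)
Lemma walk_incs (k : {ffun 'I_n -> 'I_m.+1}) o : allowed (L := L) (K := K) k ->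
  walk k (incs Y del sg o) =
  pre o + \sum_j (Y j (del * (k j - L)%:R) o - Y j 0 o).
Proof.
move=> ak; rewrite /walk /lc -(pair_bigA _ (fun j i => cwalk k (j, i) *: incs Y del sg o (j, i)))/=.
rewrite -big_split/=; apply: eq_bigr => j _.
have /forallP/(_ j)/andP[Lk kM] := ak.
have km : (k j <= m)%N by rewrite -ltnS.
pose f i := inc Y del j ((i + (L + K)) %% m) o.
transitivity (\sum_(0 <= i < k j) f i).
  rewrite (big_nat_widen _ _ _ _ _ km) big_mkord [LHS](bigID (fun i : 'I_m => (i < k j)%N))/=.
  rewrite [X in _ + X]big1 ?addr0.
    by apply: eq_bigr => i ik; rewrite /cwalk /= ik scale1r.
  by move=> i /negbTE ik; rewrite /cwalk/= ik scale0r.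
rewrite (big_cat_nat (n := L))//=; congr (_ + _).
rewrite -{1}[L]add0n big_addn.
transitivity (\sum_(0 <= i < k j - L) (Y j (del * i.+1%:R) o - Y j (del * i%:R) o)).
  apply: eq_big_nat => i /andP[_ ik]; rewrite /f /inc.
  rewrite -addnA modnDr modn_small//; lia.
by rewrite (telescope_sumr (fun i => Y j (del * i%:R) o))// mulr0.
Qed.

(** The allowed times L, ..., L + K of the walk are the times 0, ..., K of the process, and [pre]
    merely translates the picture. *)
Lemma ysection_near_walk o :
  ysection (near_walk (n := n) (m := m) e (allowed (L := L) (K := K))) (incs Y del sg o) =
  [set x | hit K o (x - pre o)].
Proof.
apply/seteqP; split=> x; rewrite /ysection /= ?inE.
  move=> [k ak hk].
  have kL j : (k j - L < K.+1)%N.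
    by have /forallP/(_ j)/andP[Lk kM] := ak; rewrite ltnS leq_subLR.
  exists [ffun j => Ordinal (kL j)] => i; have := hk i; rewrite /= walk_incs//.
  rewrite opprD addrA; under [in X in _ -> X]eq_bigr do rewrite ffunE/=.
  by [].
move=> [u hu].
have uL j : (u j + L < m.+1)%N by have := ltn_ord (u j); rewrite !ltnS addnC => uK; rewrite leq_add2l (leq_trans uK)// leq_addl.
pose k := [ffun j => Ordinal (uL j)] : {ffun 'I_n -> 'I_m.+1}.
have ak : allowed (L := L) (K := K) k.
  by apply/forallP => j; rewrite ffunE/= leq_addl/= [X in (X <= _)%N]addnC leq_add2l -ltnS; exact: ltn_ord.
exists k => // i; rewrite /= walk_incs//; have := hu i.
rewrite opprD addrA; under [in X in _ -> X]eq_bigr do rewrite ffunE/= addnK.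
by [].
Qed.

Lemma nu_hit o : nu d.+1 (hit K o) =
  nu d.+1 (ysection (near_walk (n := n) (m := m) e (allowed (L := L) (K := K))) (incs Y del sg o)).
Proof.
rewrite ysection_near_walk.
have mh := measurable_hit K o.
have mf : measurable_fun setT (fun x : rv => ((\1_(hit K o) x : R))%:E).
  by apply/measurable_EFinP; exact: measurable_indic.
transitivity (\int[nu d.+1]_x (\1_(hit K o) x)%:E)%E.
  by rewrite integral_indic// setIT.
rewrite -(integral_nu_shift (pre o) mf (fun x => _))//.
transitivity (\int[nu d.+1]_x (\1_[set x | hit K o (x - pre o)] x)%:E)%E; last first.
  rewrite integral_indic ?setIT//.
  have := measurable_vecB (@measurable_id _ rv setT) (@measurable_cst _ _ _ rv setT (pre o)).
  by move=> /(_ measurableT _ mh); rewrite setTI.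
by [].
Qed.

Local Notation near := (near_walk (n := n) (m := m) e (allowed (L := L) (K := K))).

Lemma measurable_nu_hit : measurable_fun setT (fun o => nu d.+1 (hit K o)).
Proof.
rewrite (_ : (fun o => _) = (nu d.+1 \o ysection near) \o incs Y del sg).
  apply: measurableT_comp; last exact: measurable_incs.
  by apply: measurable_fun_ysection; exact: measurable_near_walk.
by apply/funext => o; rewrite nu_hit.
Qed.

Lemma integral_nu_hit :
  (nu d.+1 \x inc_law levyY del0 sg)%E near = (\int[P]_o nu d.+1 (hit K o))%E.
Proof.
rewrite product_measure_integral; last exact: measurable_near_walk.
transitivity (\int[P]_o nu d.+1 (ysection near (incs Y del sg o)))%E.
  apply: (ge0_integral_law P (measurable_incs levyY del0 sg) (f := fun v => nu d.+1 (ysection near v))).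
    by apply: measurable_fun_ysection; exact: measurable_near_walk.
  by move=> v; exact: measure_ge0.
by apply: eq_integral => o _; rewrite nu_hit.
Qed.

End hitting_set.

(** * Dyadic approximation of times from the right *)

Section dyadic.
Context {R : realType}.

(** The first grid index strictly after [t]: strictness is what allows the use of a right limit at
    [t]. *)
Definition dyadic (k : nat) (t : R) : nat := (Num.truncn (t * 2 ^+ k)).+1.

Lemma dl_exp k : dl k * 2 ^+ k = 1 :> R.
Proof. by rewrite /dl -exprMn mulVf// expr1n. Qed.

Lemma dyadic_gt k t : t < dl k * (dyadic k t)%:R.
Proof.
have : t * 2 ^+ k < (dyadic k t)%:R by exact: truncnS_gt.
rewrite -(ltr_pM2l (dl_gt0 k)) mulrCA dl_exp mulr1; exact.
Qed.

Lemma dyadic_le k t : 0 <= t -> dl k * (dyadic k t)%:R <= t + dl k.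
Proof.
move=> t0; have : (Num.truncn (t * 2 ^+ k))%:R <= t * 2 ^+ k.
  by rewrite truncn_le mulr_ge0// exprn_ge0.
rewrite -(ler_pM2l (dl_gt0 k)) mulrCA dl_exp mulr1 => h.
by rewrite /dyadic -natr1 mulrDr mulr1 lerD2r.
Qed.

Lemma dyadic_cvg_right (V : topologicalType) (f : R -> V) (t : R) (l : V) : 0 <= t ->
  f s @[s --> t^'+] --> l -> f (dl k * (dyadic k t)%:R) @[k --> \oo] --> l.
Proof.
move=> t0 fl; apply: (cvg_comp _ _ _ fl) => A.
rewrite /at_right /within /= => h.
have [e /= e0 He] : nbhs_ball t [set x | t < x -> A x] by apply/nbhs_ballP.
have /cvgrPdist_lt/(_ _ e0)[N _ NH] := @dl_cvg R.
exists N => // k Nk; apply: He; last exact: dyadic_gt.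
rewrite -ball_normE /=; have := NH k Nk; rewrite sub0r normrN gtr0_norm ?dl_gt0// => dle.
have := dyadic_gt k t; have := dyadic_le k t0; rewrite ltr_norml; lra.
Qed.

End dyadic.

Lemma cvg_sumr (R : realType) I (r : seq I) (f : I -> nat -> R) (l : I -> R) :
  (forall i, f i k @[k --> \oo] --> l i) ->
  \sum_(i <- r) f i k @[k --> \oo] --> \sum_(i <- r) l i.
Proof.
move=> fl; elim: r => [|i r ih].
  by under eq_fun do rewrite big_nil; rewrite big_nil; exact: cvg_cst.
by under eq_fun do rewrite big_cons; rewrite big_cons; exact: cvgD.
Qed.

Section path_hit.
Context {R : realType} {dO} {Omega : measurableType dO} {d n : nat} (Y : 'I_n -> R -> Omega -> 'rV[R]_d.+1).
Context (o : Omega).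
Hypothesis Y0 : forall j, Y j 0 o = 0.
Hypothesis Yr : forall j t, 0 <= t -> Y j s o @[s --> t^'+] --> Y j t o.

Lemma dyadic_sum_cvg (t : 'I_n -> R) : (forall j, 0 <= t j) -> forall i,
  (\sum_j Y j (dl k * (dyadic k (t j))%:R) o) ord0 i @[k --> \oo] -->
  (\sum_j Y j (t j) o) ord0 i.
Proof.
move=> t0 i; rewrite summxE; under eq_fun do rewrite summxE.
apply: cvg_sumr => j.
have := dyadic_cvg_right (t0 j) (@Yr j _ (t0 j)).
move=> h; have hc := @coord_continuous R 1 d.+1 ord0 i (Y j (t j) o).
exact: (cvg_comp _ _ h hc).
Qed.

Lemma path_hit (t : 'I_n -> R) (T : nat) (e : R) : 0 < e ->
  (forall j, 0 <= t j <= T%:R) ->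
  exists k0, forall k, (k0 <= k)%N ->
    hit Y (dl k) e (T * 2 ^ k).+1 o (\sum_j Y j (t j) o).
Proof.
move=> e0 tT; have t0 j : 0 <= t j by have /andP[] := tT j.
have : \forall k \near \oo, forall i, `|(\sum_j Y j (t j) o) ord0 i -
    (\sum_j Y j (dl k * (dyadic k (t j))%:R) o) ord0 i| <= e.
  apply: filter_forall => i; have := @dyadic_sum_cvg t t0 i.
  by move/cvgrPdist_le => /(_ _ e0).
move=> [k0 _ hk]; exists k0 => k kk.
have dT j : (dyadic k (t j) < (T * 2 ^ k).+2)%N.
  rewrite !ltnS truncn_le_nat.
  apply: (@le_lt_trans _ _ (T%:R * 2 ^+ k)); last by rewrite -natrX -natrM ltr_nat.
  by rewrite ler_wpM2r ?exprn_ge0//; have /andP[] := tT j.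
exists [ffun j => Ordinal (dT j)] => i.
rewrite [X in _ - X](eq_bigr (fun j => Y j (dl k * (dyadic k (t j))%:R) o)); last first.
  by move=> j _; rewrite ffunE /= Y0 subr0.
by rewrite !mxE; exact: hk.
Qed.

End path_hit.

Section necessity.
Context {R : realType} {dO} {Omega : measurableType dO} (P : probability Omega R).
Context {d n : nat} (Y : 'I_n -> R -> Omega -> 'rV[R]_d.+1).
Hypothesis levyY : forall j, levy_process P (Y j).
Hypothesis indepY : mutually_independent P (fun j => sigma_process (Y j)).
Context (Psi : 'I_n -> 'rV[R]_d.+1 -> R[i]).
Hypothesis expY : forall j, has_levy_exponent P (Y j) (Psi j).
Local Notation rv := (brv R d.+1).

Let hitT (T k : nat) (e : R) (o : Omega) := nu d.+1 (hit Y (dl k) e (T * 2 ^ k).+1 o).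

(** Constants of [hitting_ineq]: [C1] collects the factors on the right, and [c1 T] bounds 3^-(d+1)
    q^(K n) from below for K = T 2^k + 1, because K steps last at most for time T + 1. *)
Let C1 : R := #|{set 'I_n}|%:R * (4 ^+ n * ((16 * pi) ^+ d.+1 * #|{set 'I_n}|%:R)).
Let c1 (T : nat) : R := 3^-1 ^+ d.+1 * expR (- (T.+1%:R * n%:R)).

Let C1_ge0 : 0 <= C1.
Proof. by rewrite /C1 !mulr_ge0 ?exprn_ge0 ?mulr_ge0 ?pi_ge0. Qed.

Let c1_gt0 T : 0 < c1 T.
Proof. by rewrite mulr_gt0 ?expR_gt0// exprn_gt0// invr_gt0. Qed.

Let qq_lower T k : expR (- (T.+1%:R * n%:R)) <= qq k ^+ ((T * 2 ^ k).+1 * n) :> R.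
Proof.
rewrite /qq -expRM_natr ler_expR mulNr lerN2 natrM mulrA ler_wpM2r//.
rewrite -[in X in _ * X]addn1 natrD natrM natrX mulrDr mulr1 mulrCA dl_exp mulr1.
by rewrite -natr1 lerD2l dl_le1.
Qed.

(** Write I for the limiting integral. For large k the integral on the left of [hitting_ineq]
    exceeds I / 2 and the one on the right is below 2 I, so (c1 I / 2)^2 times the expected volume
    is at most 2 C1 I; solving for the volume gives the constant 8 and the factor 1 / I. *)
Lemma hitT_le (T : nat) (e : R) : 0 < e -> 0 < IQ e (rhos Psi) ->
  exists k0, forall k, (k0 <= k)%N ->
    (\int[P]_o hitT T k e o <= (8 * C1 / c1 T ^+ 2 / IQ e (rhos Psi))%:E)%E.
Proof.
move=> e0; set I := IQ e _ => I0.
have hA := IQ_gA_cvg levyY expY e0.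
have hB := @IQ_gB_cvg _ _ _ _ _ _ _ levyY _ expY e e0 (fun k => LL k + (T * 2 ^ k).+1)%N
  (fun k => leq_addr _ _).
have I2 : I / 2 < 2 ^+ n * I.
  have : 1 <= (2 : R) ^+ n by rewrite exprn_ege1// ler1n.
  nra.
have Ilt : I < 2 * I by lra.
have [kA _ HA] : \forall k \near \oo, I / 2 < IQ e (fun xi => \prod_j (2 * complex.Re
    (gA (dl k) (qq k) (LL k) (ph (Psi j xi) k)))) := cvgr_gt _ hA _ I2.
have [kB _ HB] : \forall k \near \oo, IQ e (fun xi => \prod_j complex.Re
    (gB (dl k) (qq k) (LL k + (T * 2 ^ k).+1)%N (ph (Psi j xi) k))) < 2 * I := cvgr_lt _ hB _ Ilt.
exists (maxn kA kB) => k; rewrite geq_max => /andP[Ak Bk].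
have := HA k Ak; have := HB k Bk; rewrite /=.
set B := IQ e _; set A := IQ e (fun xi => \prod_j (2 * _)) => BI AI.
pose K := (T * 2 ^ k).+1; pose L := LL k.
have sgK := rot_ordK (m := (L + (L + K))%N) (a := (L + K)%N) (b := L) (addnC _ _).
have sgK' := rot_ordK (m := (L + (L + K))%N) (a := L) (b := (L + K)%N) erefl.
have Qprod := inc_law_product levyY indepY (ltW (dl_gt0 k)) sgK sgK'.
have := hitting_ineq Qprod e0 (fun j i xi => inc_char levyY expY (ltW (dl_gt0 k)) _ j i xi)
  (ltW (dl_gt0 k)) (ltW (qq_gt0 k)) (ltW (qq_lt1 k)).
rewrite (integral_nu_hit levyY (ltW (dl_gt0 k)) e) -/A -/B.
set M := (\int[P]_o _)%E; have M0 : (0 <= M)%E by apply: integral_ge0 => o _; exact: measure_ge0.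
have cI0 : 0 < (c1 T * (I / 2)) ^+ 2 by rewrite exprn_gt0// mulr_gt0// divr_gt0.
have le_c : (c1 T * (I / 2)) ^+ 2 <= (3^-1 ^+ d.+1 * (qq k ^+ (K * n) * A)) ^+ 2.
  rewrite lerXn2r ?nnegrE ?mulr_ge0 ?exprn_ge0 ?invr_ge0 ?expR_ge0 ?(ltW I0)//.
  - by rewrite (le_trans _ (ltW AI))// divr_ge0// ltW.
  - rewrite /c1 -mulrA ler_wpM2l ?exprn_ge0 ?invr_ge0//.
    apply: ler_pM; rewrite ?expR_ge0 ?divr_ge0 ?(ltW I0)// ?(ltW AI)//.
move=> hM; have {}hM : (((c1 T * (I / 2)) ^+ 2)%:E * M <= (C1 * (2 * I))%:E)%E.
  apply: le_trans (le_trans hM _); first by rewrite lee_wpmul2r// lee_fin.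
  rewrite lee_fin /C1 -!mulrA; do 3! (apply: ler_wpM2l; first by rewrite ?exprn_ge0 ?mulr_ge0 ?pi_ge0).
  by rewrite ler_wpM2l// ltW.
have -> : 8 * C1 / c1 T ^+ 2 / I = ((c1 T * (I / 2)) ^+ 2)^-1 * (C1 * (2 * I)).
  by field; rewrite !gt_eqF.
by rewrite EFinM lee_pdivlMl.
Qed.

Definition path_sums (o : Omega) : set 'rV[R]_d.+1 :=
  [set \sum_j Y j (t j) o | t in [set t : 'I_n -> R | forall j, 0 <= t j]].

Lemma ae_regular : {ae P, forall o,
  (forall j, Y j 0 o = 0) /\
  (forall j t, 0 <= t -> Y j s o @[s --> t^'+] --> Y j t o)}.
Proof.
have h j : {ae P, forall o, Y j 0 o = 0 /\
    (forall t, 0 <= t -> Y j s o @[s --> t^'+] --> Y j t o)}.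
  have := levy_start0 (levyY j); have := levy_cadlag (levyY j).
  by apply: filterS2 => o [h _] h0.
apply: (filterS _ (filter_forall _ h)) => o ho.
by split=> j; have [] := ho j.
Qed.

(** A measurable upper bound for the volume of the range over [0, T]^n: [einfs] at 0 is the infimum
    over all radii 1 / (r + 1). *)
Let G T (o : Omega) : \bar R :=
  einfs (fun r => limn_einf (fun k => hitT T k r.+1%:R^-1 o)) 0.

Let mhit T r k : measurable_fun setT (hitT T k r.+1%:R^-1).
Proof. exact: (measurable_nu_hit (L := 0) levyY (ltW (dl_gt0 k))). Qed.

Let mG T : measurable_fun setT (G T).
Proof.
apply: (measurable_fun_einfs (f := fun r o => limn_einf (fun k => hitT T k r.+1%:R^-1 o))) => r.
by apply: (measurable_fun_limn_einf (f := fun k => hitT T k r.+1%:R^-1)) => k; exact: mhit.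
Qed.

Let G0 T o : (0 <= G T o)%E.
Proof.
apply: le_ereal_inf_tmp => _ [r _ <-]; apply: limn_einf_ge0 => k; exact: measure_ge0.
Qed.

(** For every radius the range over [0, T]^n lies in the inferior limit of the sets [hit], which is
    Borel; countable subadditivity over T covers the whole orthant. *)
Lemma outer_path_sums_le : {ae P, forall o,
  (lebesgue_outer_rV (path_sums o) <= \sum_(T <oo) G T o)%E}.
Proof.
apply: filterS ae_regular => o [Y0 Yr].
pose S (T : nat) := [set \sum_j Y j (t j) o | t in [set t : 'I_n -> R | forall j, 0 <= t j <= T%:R]].
have sub : path_sums o `<=` \bigcup_T S T.
  move=> _ [t t0 <-].
  exists (\max_j (Num.truncn (t j)).+1) => //; exists t => // j; rewrite t0/=.
  apply: (le_trans (ltW (truncnS_gt (t j)))); rewrite ler_nat.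
  exact: (leq_bigmax (F := fun j => (Num.truncn (t j)).+1)).
apply: (le_trans (le_outer_measure (@lebesgue_outer_rV R d) _ _ sub)).
apply: (le_trans (outer_measure_sigma_subadditive (@lebesgue_outer_rV R d) S)).
apply: lee_nneseries => [T _ _|T _]; first exact: outer_measure_ge0.
apply: le_ereal_inf_tmp => _ [r _ <-].
pose U k : set rv := hit Y (dl k) r.+1%:R^-1 (T * 2 ^ k).+1 o.
have mU k : measurable (U k) by exact: measurable_hit.
apply: (@le_trans _ _ (nu d.+1 (\bigcup_m \bigcap_(k in [set k | (m <= k)%N]) U k))); last first.
  exact: measure_liminf_le.
rewrite -lamE; last first.
  by apply: bigcup_measurable => m _; exact: bigcap_measurableType.
apply: le_outer_measure => _ [t tT <-].
have r0 : 0 < r.+1%:R^-1 :> R by rewrite invr_gt0.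
by have [m hm] := path_hit Y0 Yr r0 tT; exists m => // k mk; exact: hm.
Qed.

(** A positive expected volume forces the integral of some [G T] to be positive. By [hitT_le] that
    integral is at most a constant divided by the smoothed integral of rho, with a constant that
    does not depend on the radius; exchanging the two bounds the latter uniformly. *)
Lemma IQ_rhos_bounded : (0 < \int[P]_o lebesgue_outer_rV (path_sums o))%E ->
  exists C, forall r : nat, IQ r.+1%:R^-1 (rhos Psi) <= C.
Proof.
move=> pos.
have [T GT] : exists T, (0 < \int[P]_o G T o)%E.
  apply: contrapT => /forallNP hG; move: pos; apply/negP; rewrite -leNgt.
  apply: (le_trans (le_integral_nonmeasurable _ _ _ outer_path_sums_le)).
  - by move=> o; exact: outer_measure_ge0.
  - by move=> o; apply: nneseries_ge0 => T _ _; exact: G0.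
  - by apply: ge0_emeasurable_sum => // T o _ _; exact: G0.
  rewrite integral_nneseries//.
  rewrite (_ : (\sum_(T <oo) _)%E = 0%E)//; apply: eseries0 => T _ _.
  by apply/eqP; rewrite eq_le integral_ge0// andbT leNgt; apply/negP; exact: hG.
exists (8 * C1 / c1 T ^+ 2 / fine (\int[P]_o G T o)) => r.
set I := IQ _ _; have r0 : 0 < r.+1%:R^-1 :> R by rewrite invr_gt0.
have D0 : 0 <= 8 * C1 / c1 T ^+ 2.
  by apply: divr_ge0; [exact: mulr_ge0|exact: exprn_ge0 (ltW (c1_gt0 T))].
have [I0|I0] := ltP 0 I; last first.
  by apply: (le_trans I0); rewrite divr_ge0// fine_ge0// ltW.
have GI : (\int[P]_o G T o <= (8 * C1 / c1 T ^+ 2 / I)%:E)%E.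
  apply: (@le_trans _ _ (\int[P]_o limn_einf (fun k => hitT T k r.+1%:R^-1 o))%E).
    apply: ge0_le_integral => //.
    - by apply: measurable_fun_limn_einf => k; exact: mhit.
    - by move=> o _; apply: ereal_inf_lbound; exists r.
  apply: (le_trans (fatou P measurableT _ _)) => //.
  have [k0 hk] := hitT_le T r0 I0.
  exact: limn_einf_le_near hk.
have Gfin : (\int[P]_o G T o)%E \is a fin_num.
  by rewrite ge0_fin_numE ?(le_lt_trans GI) ?ltry// ltW.
rewrite -(fineK Gfin) lee_fin in GI; rewrite -(fineK Gfin) lte_fin in GT.
by rewrite ler_pdivlMr// mulrC -ler_pdivlMr.
Qed.

(** At the scales 1 / (r + 1) the weight [qk] tends to 1, and Fatou's lemma carries the uniform
    bound to the limit. *)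
Lemma integral_rhos_lty : (0 < \int[P]_o lebesgue_outer_rV (path_sums o))%E ->
  (\int[nu d.+1]_xi (rhos Psi xi)%:E < +oo)%E.
Proof.
move=> /IQ_rhos_bounded[C hC].
apply: (@le_lt_trans _ _ C%:E); last exact: ltry.
pose f (r : nat) (xi : rv) : \bar R := (qk r.+1%:R^-1 xi * rhos Psi xi)%:E.
have b := bmf_rhos levyY expY.
have -> : (\int[nu d.+1]_xi (rhos Psi xi)%:E = \int[nu d.+1]_xi limn_einf (f^~ xi))%E.
  apply: eq_integral => xi _.
  have fl : f r xi @[r --> \oo] --> (rhos Psi xi)%:E.
    apply/cvg_EFin; first by apply: nearW.
    rewrite -[X in _ --> X]mul1r; apply: cvgM; last exact: cvg_cst.
    rewrite [X in _ --> X](_ : 1 = \prod_(i < d.+1) (fun=> 1) i); last by rewrite big1.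
    apply: cvg_prodr => i.
    have : expR (- (r.+1%:R^-1 * `|xi ord0 i|)) @[r --> \oo] --> expR (- (0 * `|xi ord0 i|)).
      apply: continuous_cvg; first exact: continuous_expR.
      by apply: cvgN; apply: cvgMr_tmp; exact: cvg_harmonic.
    rewrite mul0r oppr0 expR0; apply: cvg_trans; apply: near_eq_cvg; apply: nearW => r.
    by rewrite /lap mulNr.
  by rewrite is_cvg_limn_einfE; [apply/esym/cvg_lim|apply/cvg_ex; eexists; exact: fl].
apply: (le_trans (fatou (nu d.+1) measurableT _ _)).
- move=> r; apply/measurable_EFinP; apply: measurable_funM; last exact: b.1.
  exact: measurable_qk.
- by move=> r xi _; rewrite lee_fin mulr_ge0 ?qk_ge0//; exact: (rhos_ge0 levyY expY).
apply: (limn_einf_le_near (n0 := 0)) => r _.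
by rewrite -(EFin_IQ _ b) ?lee_fin// invr_gt0.
Qed.

End necessity.

(** * Sufficiency *)

Section enlargement.
Context {R : realType} {d : nat}.
Local Notation V := 'rV[R]_d.+1.

(** A cover by closed boxes leaves no room around the path. Enlarging by eta makes room for the
    discretised path, and by 2 eta also for cubes of radius e <= eta around its points. *)
Definition enlarge (I : V * V) (h : R) : V * V := (I.1 - const_mx h, I.2 + const_mx h).

Lemma enlarge_near (I : V * V) h x y : box (enlarge I h) x ->
  (forall i, `|(y - x) ord0 i| <= h) -> box (enlarge I (2 * h)) y.
Proof.
move=> Ix xy i; have /andP[] := Ix i; have := xy i; rewrite !mxE ler_norml => /andP[h1 h2] h3 h4.
by apply/andP; split; lra.
Qed.

Lemma enlarge_volume_cvg (I : V * V) : box_volume (enlarge I (2 * dl k)) @[k --> \oo] --> box_volume I.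
Proof.
apply: cvg_prodr => i; rewrite /enlarge /=.
set u := I.2 _ _ - _.
have d4 : Num.max 0 u + 4 * dl k @[k --> \oo] --> Num.max 0 u.
  rewrite -[X in _ --> X]addr0 -[X in _ --> _ + X](mulr0 4).
  by apply: cvgD; [exact: cvg_cst|apply: cvgMl_tmp; exact: dl_cvg].
apply: (squeeze_cvgr _ (@cvg_cst _ (Num.max 0 u) _ _ _) d4).
apply: nearW => k; rewrite !mxE; have d0 := @dl_gt0 R k.
rewrite (_ : _ - _ = u + 4 * dl k); last by rewrite /u; lra.
by apply/andP; split; case: (leP 0 u); case: (leP 0 (u + 4 * dl k)); lra.
Qed.

Lemma exists_enlarge (I : V * V) (ep : R) : 0 < ep ->
  exists2 h, 0 < h & box_volume (enlarge I (2 * h)) <= box_volume I + ep.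
Proof.
move=> ep0; have lt : box_volume I < box_volume I + ep by rewrite ltrDl.
have [k _ hk] := cvgr_lt _ (@enlarge_volume_cvg I) _ lt.
by exists (dl k); [exact: dl_gt0|apply: ltW; apply: hk => /=].
Qed.

End enlargement.

(** * Capacity bound and discrete energies *)

Section capacity.
Context {R : realType} {d : nat} (I : finType) (w : I -> R) (X : I -> 'rV[R]_d.+1).
Hypothesis w0 : forall a, 0 <= w a.
Context (e th : R) (e0 : 0 < e) (th0 : 0 < th).
Local Notation rv := (brv R d.+1).
Local Open Scope ereal_scope.

Let Z (x : rv) : R := (\sum_a w a * pk e (x - X a))%R.

Let mpk a : measurable_fun setT (fun x : rv => pk e (x - X a)).
Proof.
apply: (measurableT_comp (measurable_pk e0)).
exact: (measurable_vecB (@measurable_id _ rv setT) (@measurable_cst _ _ _ rv setT (X a))).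
Qed.

Let mZ : measurable_fun setT Z.
Proof. by apply: measurable_sum => a; apply: measurable_funM. Qed.

Let Z0 x : (0 <= Z x)%R.
Proof. by apply: sumr_ge0 => a _; rewrite mulr_ge0 ?pk_ge0. Qed.

(** On the cube of side 2e around [X a] the kernel is at least e^-(d+1), and the cube has volume
    (2e)^(d+1). *)
Lemma integral_pk_near a (W : set rv) : measurable W ->
  (forall x, (forall i, `|(x - X a) ord0 i| <= e)%R -> W x) ->
  (2 ^+ d.+1)%:E <= \int[nu d.+1]_(x in W) (pk e (x - X a))%:E.
Proof.
move=> mW nW; pose B : set rv := box (X a - const_mx e, X a + const_mx e)%R.
have BE x : B x -> forall i, (`|(x - X a) ord0 i| <= e)%R.
  move=> Bx i; have /andP[] := Bx i; rewrite !mxE ler_norml => h1 h2.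
  by apply/andP; split; lra.
have mB : measurable B by exact: measurable_box.
apply: (@le_trans _ _ (\int[nu d.+1]_(x in B) (pk e (x - X a))%:E)); last first.
  apply: ge0_subset_integral => //.
  - by apply/measurable_EFinP; apply: measurable_funTS.
  - by move=> x _; rewrite lee_fin pk_ge0.
  - by move=> x Bx; apply: nW; exact: BE.
apply: (@le_trans _ _ (\int[nu d.+1]_(x in B) (e^-1 ^+ d.+1)%:E)); last first.
  apply: ge0_le_integral => //.
  - by move=> x _; rewrite lee_fin exprn_ge0// invr_ge0 ltW.
  - by apply/measurable_EFinP; apply: measurable_funTS.
  - by move=> x Bx; rewrite lee_fin; apply: pk_ge => //; exact: BE.
rewrite integral_cst//.
have nB : (nu d.+1 B = ((2 * e) ^+ d.+1)%:E)%E.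
  apply: etrans; first exact: nu_box.
  congr EFin; rewrite -[X in (_ ^+ X)%R](card_ord d.+1) -prodr_const; apply: eq_bigr => i _.
  rewrite !mxE (_ : (_ - _)%R = (2 * e)%R); last by lra.
  by rewrite max_r// mulr_ge0// ltW.
apply: (@le_trans _ _ ((e^-1 ^+ d.+1)%:E * ((2 * e) ^+ d.+1)%:E)).
  by rewrite -EFinM -exprMn mulrCA mulVf ?mulr1// gt_eqF.
by apply: lee_wpmul2l; [rewrite lee_fin exprn_ge0// invr_ge0 ltW|rewrite -nB].
Qed.

(** For the smoothed occupation density Z one has Z <= th + Z^2 / th. The integral of Z over [W] is
    at least 2^(d+1) times the mass of the sites whose [e]-cubes lie in [W], and that of Z^2 is at
    most (16 pi)^(d+1) times the energy. Keeping [th] free avoids dividing by the measure of [W]. *)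
Lemma capacity (A : pred I) (W : set rv) : measurable W ->
  (forall a x, A a -> (forall i, `|(x - X a) ord0 i| <= e)%R -> W x) ->
  (2 ^+ d.+1 * \sum_(a | A a) w a)%:E <=
  th%:E * nu d.+1 W +
  (th^-1 * ((16 * pi) ^+ d.+1 * \sum_a \sum_b w a * w b * pk e (X a - X b)))%:E.
Proof.
move=> mW AW; apply: (@le_trans _ _ (\int[nu d.+1]_(x in W) (Z x)%:E)).
  rewrite /Z; under eq_integral do rewrite -sumEFin.
  rewrite ge0_integral_sum//; last 2 first.
  - by move=> a; apply/measurable_EFinP; apply: measurable_funTS; apply: measurable_funM.
  - by move=> a x _; rewrite lee_fin mulr_ge0 ?pk_ge0.
  rewrite mulr_sumr -sumEFin [leRHS](bigID A)/=.
  rewrite -[leLHS]adde0; apply: leeD; last first.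
    by apply: sume_ge0 => a _; apply: integral_ge0 => x _; rewrite lee_fin mulr_ge0 ?pk_ge0.
  apply: lee_sum => a Aa; under eq_integral do rewrite EFinM.
  rewrite ge0_integralZl//; last 3 first.
  - by apply/measurable_EFinP; apply: measurable_funTS.
  - by move=> x _; rewrite lee_fin pk_ge0.
  - by rewrite lee_fin.
  rewrite mulrC EFinM; apply: lee_wpmul2l; first by rewrite lee_fin.
  by apply: integral_pk_near => // x; exact: AW.
apply: (@le_trans _ _ (\int[nu d.+1]_(x in W) (th%:E + (th^-1 * Z x ^+ 2)%:E))).
  apply: ge0_le_integral => //.
  - by move=> x _; rewrite lee_fin.
  - by apply/measurable_EFinP; apply: measurable_funTS.
  - apply: emeasurable_funD => //; apply/measurable_EFinP; apply: measurable_funTS.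
    by apply: measurable_funM => //; exact: measurable_funX.
  - move=> x _; rewrite -EFinD lee_fin -(ler_pM2l th0) mulrDr mulrA divff ?gt_eqF// mul1r.
    have := sqr_ge0 (th - Z x)%R; have := Z0 x; nra.
rewrite ge0_integralD//; last 3 first.
- by move=> x _; rewrite lee_fin ltW.
- by move=> x _; rewrite lee_fin mulr_ge0 ?invr_ge0 ?sqr_ge0// ltW.
- apply/measurable_EFinP; apply: measurable_funTS.
  by apply: measurable_funM => //; exact: measurable_funX.
rewrite integral_cst//; apply: leeD => //.
apply: (@le_trans _ _ (\int[nu d.+1]_x (th^-1 * Z x ^+ 2)%:E)).
  apply: ge0_subset_integral => //.
  - by apply/measurable_EFinP; apply: measurable_funM => //; exact: measurable_funX.
  - by move=> x _; rewrite lee_fin mulr_ge0 ?invr_ge0 ?sqr_ge0// ltW.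
under eq_integral do rewrite EFinM.
rewrite ge0_integralZl//; last 3 first.
- by apply/measurable_EFinP; exact: measurable_funX.
- by move=> x _; rewrite lee_fin sqr_ge0.
- by rewrite lee_fin invr_ge0 ltW.
rewrite EFinM; apply: lee_wpmul2l; first by rewrite lee_fin invr_ge0 ltW.
have ZE x : (Z x ^+ 2)%:E = \sum_a \sum_b (w a * w b)%:E * (pk e (x - X a) * pk e (x - X b))%:E.
  rewrite expr2 /Z big_distrlr/= -sumEFin; apply: eq_bigr => a _.
  by rewrite -sumEFin; apply: eq_bigr => b _; rewrite -EFinM mulrACA.
under eq_integral do rewrite ZE.
have mab a b : measurable_fun setT (fun x : rv => (pk e (x - X a) * pk e (x - X b))%:E).
  by apply/measurable_EFinP; exact: measurable_funM.
have p0 a b x : (0 : \bar R) <= (pk e (x - X a) * pk e (x - X b))%:E.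
  by rewrite lee_fin mulr_ge0 ?pk_ge0.
have ww0 a b : 0 <= (w a * w b)%:E by rewrite lee_fin mulr_ge0.
rewrite ge0_integral_sum//; last 2 first.
- by move=> a; apply: emeasurable_sum => b; exact: emeasurable_funM.
- by move=> a x _; apply: sume_ge0 => b _; exact: mule_ge0.
rewrite mulr_sumr -sumEFin; apply: lee_sum => a _.
rewrite ge0_integral_sum//; last 2 first.
- by move=> b; exact: emeasurable_funM.
- by move=> b x _; exact: mule_ge0.
rewrite mulr_sumr -sumEFin; apply: lee_sum => b _.
rewrite ge0_integralZl//.
rewrite mulrCA [leRHS]EFinM; apply: lee_wpmul2l => //.
exact: integral_pkM_le.
Qed.

End capacity.

Section energy.
Context {R : realType} {dO} {Omega : measurableType dO} (P : probability Omega R).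
Context {d n : nat} (Y : 'I_n -> R -> Omega -> 'rV[R]_d.+1).
Local Notation rv := (brv R d.+1).

Definition wt M k (a : {ffun 'I_n -> 'I_M.+1}) : R := \prod_j (dl k * qq k ^+ a j).

Definition pos M k (a : {ffun 'I_n -> 'I_M.+1}) (o : Omega) : 'rV[R]_d.+1 :=
  \sum_j (Y j (dl k * (a j)%:R) o - Y j 0 o).

Definition energy e M k (o : Omega) : R :=
  \sum_(a : {ffun 'I_n -> 'I_M.+1}) \sum_(b : {ffun 'I_n -> 'I_M.+1})
    wt k a * wt k b * pk e (pos k a o - pos k b o).

Lemma wt_ge0 M k (a : {ffun 'I_n -> 'I_M.+1}) : 0 <= wt k a.
Proof.
by apply: prodr_ge0 => j _; rewrite mulr_ge0 ?exprn_ge0 ?(ltW (dl_gt0 _)) ?(ltW (qq_gt0 _)).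
Qed.

Lemma energy_ge0 e M k o : 0 < e -> 0 <= energy e M k o.
Proof.
move=> e0; apply: sumr_ge0 => a _; apply: sumr_ge0 => b _.
by rewrite !mulr_ge0 ?wt_ge0 ?pk_ge0.
Qed.

Hypothesis levyY : forall j, levy_process P (Y j).
Context (e : R) (e0 : 0 < e).

(** For L = 0 the rotation is the identity and every time is allowed, so the results on [walk]
    apply; the common term [pre] cancels in the difference. *)
Lemma pos_incs M k (a b : {ffun 'I_n -> 'I_M.+1}) o :
  pos k a o - pos k b o =
  walk a (incs Y (dl k) (rot_ord (m := M) M) o) - walk b (incs Y (dl k) (rot_ord (m := M) M) o).
Proof.
have al (c : {ffun 'I_n -> 'I_M.+1}) : allowed (L := 0) (K := M) c.
  by apply/forallP => j; rewrite leq0n /= -ltnS; exact: ltn_ord.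
have h (c : {ffun 'I_n -> 'I_M.+1}) :
    walk c (incs Y (dl k) (rot_ord (m := M) M) o) =
    pre (L := 0) (K := M) Y (dl k) o + pos k c o.
  rewrite (walk_incs Y (ltW (dl_gt0 k)) o (al c)); congr (_ + _).
  by apply: eq_bigr => j _; rewrite subn0.
by rewrite !h opprD addrACA subrr add0r.
Qed.

Lemma bmf_pk_pos M k (a b : {ffun 'I_n -> 'I_M.+1}) :
  bmf (fun o => pk e (pos k a o - pos k b o)).
Proof.
rewrite (_ : (fun o => _) = fun o => (fun v => pk e (walk a v - walk b v))
    (incs Y (dl k) (rot_ord (m := M) M) o)).
  apply: (bmf_comp (f := fun v : fprod rv ('I_n * 'I_M)%type => pk e (walk a v - walk b v))).
    exact: (measurable_incs levyY (ltW (dl_gt0 k))).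
  exact: bmf_gk.
by apply/funext => o; rewrite pos_incs.
Qed.

Lemma bmf_energy M k : bmf (energy e M k).
Proof.
apply: bmf_sum => a _; apply: bmf_sum => b _.
exact: (bmfM (bmf_cst _ _) (bmf_pk_pos k a b)).
Qed.

Hypothesis indepY : mutually_independent P (fun j => sigma_process (Y j)).
Context (Psi : 'I_n -> 'rV[R]_d.+1 -> R[i]).
Hypothesis expY : forall j, has_levy_exponent P (Y j) (Psi j).

(** For L = 0 and [g] empty the window weights [WW] are exactly [wt], so that [sum_WW_gk] computes
    the expectation. *)
Lemma expectation_energy M k : \int[P]_o energy e M k o =
  IQ e (fun xi => \prod_j complex.Re (gB (dl k) (qq k) M (ph (Psi j xi) k))).
Proof.
have d0 := ltW (@dl_gt0 R k).
have sgK := rot_ordK (m := M) (a := M) (b := 0) (addn0 _).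
have sgK' := rot_ordK (m := M) (a := 0) (b := M) erefl.
have Qprod := inc_law_product levyY indepY d0 sgK sgK'.
transitivity (IQ e (fun xi => \prod_j complex.Re (gB (dl k) (qq k) (0 + M) (ph (Psi j xi) k)))).
  2: by [].
rewrite -(sum_WW_gk (L := 0) (K := M) Qprod e0
  (fun j i xi => inc_char levyY expY d0 _ j i xi) _ _ finset.set0)//.
have bt a b := bmfM (bmf_cst Omega (wt k a * wt k b)) (bmf_pk_pos k a b).
have bs (a : {ffun 'I_n -> 'I_M.+1}) : bmf (fun o =>
    \sum_(b : {ffun 'I_n -> 'I_M.+1}) wt k a * wt k b * pk e (pos k a o - pos k b o)).
  by apply: bmf_sum => b _; exact: bt.
rewrite /energy (bmf_Rintegral_sum P _ _ (f := fun a o => \sum_(b : {ffun 'I_n -> 'I_M.+1}) wt k a * wt k b * pk e (pos k a o - pos k b o)))//.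
apply: eq_bigr => a _; rewrite bmf_Rintegral_sum//.
apply: eq_bigr => b _; rewrite bmf_RintegralZl; last exact: bmf_pk_pos.
have WE (c : {ffun 'I_n -> 'I_M.+1}) : WW (L := 0) (K := M) (dl k) (qq k) finset.set0 c = wt k c.
  by apply: eq_bigr => j _; rewrite /win finset.in_set0 leq0n subn0.
rewrite -!WE; congr (_ * _); rewrite /gk Rintegral_law; last exact: bmf_gk.
by apply: eq_Rintegral => o _; rewrite pos_incs.
Qed.

End energy.

Lemma measure_bigsetU_le d (T : measurableType d) (R : realType)
    (mu : {measure set T -> \bar R}) I (r : seq I) (A : pred I) (F : I -> set T) :
  (forall i, measurable (F i)) ->
  (mu (\big[setU/set0]_(i <- r | A i) F i) <= \sum_(i <- r | A i) mu (F i))%E.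
Proof.
move=> mF; elim: r => [|i r ih]; first by rewrite !big_nil measure0.
rewrite !big_cons; case: (A i) => //.
apply: (le_trans (measureU2 _ _ _)) => //; last exact: leeD2l.
by apply: bigsetU_measurable.
Qed.

Lemma box_enlarge_near (R : realType) d (I : 'rV[R]_d.+1 * 'rV[R]_d.+1) h x y : box I x ->
  (forall i, `|(x - y) ord0 i| <= h) -> box (enlarge I h) y.
Proof.
move=> Ix xy i; have /andP[] := Ix i; have := xy i; rewrite !mxE ler_norml => /andP[h1 h2] h3 h4.
by apply/andP; split; lra.
Qed.

Section sufficiency.
Context {R : realType} {dO} {Omega : measurableType dO}.
Context {d N : nat}.
Local Notation n := N.+1.
Context (Y : 'I_n -> R -> Omega -> 'rV[R]_d.+1).
Local Notation rv := (brv R d.+1).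
Local Notation tv := (brv R n).
Local Notation idx M := {ffun 'I_n -> 'I_M.+1}.

(** The cube of times that have dyadic index [a], up to its boundary; cells compare the weights of
    the sites with Lebesgue measure on the parameter space. *)
Definition cell M k (a : idx M) : tv * tv :=
  (\row_j (dl k * ((a j)%:R - 1)), \row_j (dl k * (a j)%:R)).

Lemma cell_volume M k (a : idx M) : box_volume (cell k a) = dl k ^+ n :> R.
Proof.
rewrite -[X in _ ^+ X](card_ord n) -prodr_const; apply: eq_bigr => j _; rewrite !mxE.
rewrite (_ : _ - _ = dl k); first by rewrite max_r// ltW// dl_gt0.
by rewrite mulrBr mulr1 opprB addrC subrK.
Qed.

(** When a j <= 2^k + 1, the time [dl k * a j] is at most 2, so each of the n coordinates loses at
    most a factor e^(-2). *)
Lemma wt_lower M k (a : idx M) : (forall j, a j <= (2 ^ k).+1)%N ->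
  expR (- (2 * n%:R)) * dl k ^+ n <= wt k a :> R.
Proof.
move=> ha; rewrite mulrC -mulNr expRM_natr -exprMn -[X in _ ^+ X](card_ord n) -prodr_const.
have d0 := @dl_gt0 R k.
apply: ler_prod => j _; rewrite mulr_ge0 ?expR_ge0 ?(ltW d0)//=.
rewrite ler_wpM2l ?(ltW d0)// /qq -expRM_natr ler_expR mulNr lerN2.
apply: (@le_trans _ _ (dl k * (2 ^ k).+1%:R)).
  by rewrite ler_wpM2l ?(ltW d0)// ler_nat.
rewrite -natr1 natrX mulrDr mulr1 dl_exp; have := @dl_le1 R k; lra.
Qed.

(* The outcome of [capacity] for the [th] which makes its energy term half of the
   left-hand side. *)
Definition lower_const (G : R) : R :=
  let E := 2 ^+ d.+1 * (expR (- (2 * n%:R)) / 2) in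
  E / 2 / (2 * (16 * pi) ^+ d.+1 * G / E).

Lemma lower_const_gt0 G : 0 < G -> 0 < lower_const G.
Proof.
move=> G0; have p0 : 0 < pi :> R := pi_gt0 R.
by rewrite /lower_const !(divr_gt0, mulr_gt0, exprn_gt0, expR_gt0).
Qed.

Lemma mass_lower M k (A : pred (idx M)) :
  (forall a, A a -> forall j, (a j <= (2 ^ k).+1)%N) ->
  ((2^-1 : R)%:E < nu n (\big[setU/set0]_(a | A a) box (cell k a)))%E ->
  expR (- (2 * n%:R)) / 2 <= \sum_(a | A a) wt k a :> R.
Proof.
move=> hA hm.
have : (2^-1 : R) <= \sum_(a | A a) dl k ^+ n.
  rewrite -lee_fin; apply: (le_trans (ltW hm)).
  apply: (le_trans (measure_bigsetU_le _ _ _ _)); first by move=> a; exact: measurable_box.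
  rewrite -sumEFin; apply: lee_sum => a _; rewrite -(cell_volume k a).
  by rewrite le_eqVlt; apply/orP; left; apply/eqP; exact: nu_box.
rewrite -(ler_pM2l (expR_gt0 (- (2 * n%:R)))) => h; apply: (le_trans h).
by rewrite mulr_sumr; apply: ler_sum => a Aa; apply: wt_lower; exact: hA.
Qed.

Context (o : Omega).
Hypothesis Y0 : forall j, Y j 0 o = 0.
Hypothesis Yr : forall j t, 0 <= t -> Y j s o @[s --> t^'+] --> Y j t o.
Context (kr : nat -> nat) (kr2 : forall r, (r.+2 <= kr r)%N).
Context (G : R) (G0 : 0 < G).
Hypothesis energyG : (limn_einf (fun r =>
  (energy Y r.+1%:R^-1 (LL (kr r)) (kr r) o)%:E) < G%:E)%E.

Section cover.
Context (I : nat -> 'rV[R]_d.+1 * 'rV[R]_d.+1) (eta : nat -> R).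
Hypothesis cov : path_sums Y o `<=` \bigcup_i box (I i).
Hypothesis eta0 : forall i, 0 < eta i.

(** Sites whose cubes of radius 1 / (r + 1) lie in the cover enlarged by twice [eta]. The second
    condition keeps their times bounded, as [mass_lower] requires. *)
Let A r : pred (idx (LL (kr r))) := fun a =>
  `[< (exists i, r.+1%:R^-1 <= eta i /\ box (enlarge (I i) (eta i)) (pos Y (kr r) a o)) /\
      forall j, (a j <= (2 ^ kr r).+1)%N >].

Let B r : set tv := \big[setU/set0]_(a : idx (LL (kr r)) | A a) box (cell (kr r) a).

Let mB r : measurable (B r).
Proof. by apply: bigsetU_measurable => a _; exact: measurable_box. Qed.

(** The point of the path at time t lies in some box [I i]. For large r the site with the dyadic
    index of t is within [eta i] of it, hence is selected, and t lies in its cell. *)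
Lemma unit_box_sub : box (0, const_mx 1) `<=`
  \bigcup_m \bigcap_(r in [set r | (m <= r)%N]) B r.
Proof.
move=> t t01; pose t' (j : 'I_n) := t ord0 j.
have t0 j : 0 <= t' j by have := t01 j; rewrite !mxE => /andP[].
have t1 j : t' j <= 1 by have := t01 j; rewrite !mxE => /andP[].
have [i _ Ii] : (\bigcup_i box (I i)) (\sum_j Y j (t' j) o) by apply: cov; exists t'.
have : \forall k \near \oo, forall l, `|(\sum_j Y j (t' j) o) ord0 l -
    (\sum_j Y j (dl k * (dyadic k (t' j))%:R) o) ord0 l| <= eta i.
  apply: filter_forall => l; have := @dyadic_sum_cvg _ _ _ _ _ _ _ Yr t' t0 l.
  by move/cvgrPdist_le => /(_ _ (eta0 i)).
move=> [k0 _ hk].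
exists (maxn k0 (Num.truncn (eta i)^-1)) => // r /=; rewrite geq_max => /andP[kr0 tr].
set k := kr r; have rk : (r.+2 <= k)%N := kr2 r.
have er : r.+1%:R^-1 <= eta i.
  rewrite -[leRHS]invrK lef_pV2 ?posrE ?invr_gt0//.
  by apply: ltW; apply: (lt_le_trans (truncnS_gt _)); rewrite ler_nat.
have d0 := @dl_gt0 R k.
have dyk j : (dyadic k (t' j) <= (2 ^ k).+1)%N.
  rewrite ltnS truncn_le_nat.
  apply: (@le_lt_trans _ _ (2 ^+ k)); last by rewrite -natrX ltr_nat.
  by rewrite ler_piMl ?exprn_ge0.
(* As k >= 2, one has 2^k + 1 <= k 2^k: the grid reaches past the unit cube. *)
have dyL j : (dyadic k (t' j) < (LL k).+1)%N.
  rewrite ltnS; apply: (leq_trans (dyk j)); rewrite /LL.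
  have : (0 < 2 ^ k)%N by rewrite expn_gt0.
  by move: rk; case: (k) => [|[|k']] // _ h; rewrite mulSn mulSn addnA; lia.
pose a : idx (LL k) := [ffun j => Ordinal (dyL j)].
have posE : pos Y k a o = \sum_j Y j (dl k * (dyadic k (t' j))%:R) o.
  by apply: eq_bigr => j _; rewrite ffunE Y0 subr0.
have Aa : A a.
  apply/asboolP; split; last by move=> j; rewrite ffunE; exact: dyk.
  exists i; split => //; rewrite -/k posE; apply: (box_enlarge_near Ii) => l.
  rewrite !mxE; apply: hk => /=; apply: (leq_trans kr0); lia.
rewrite /B (bigD1 a)//=; left => j; rewrite !mxE ffunE /=.
have := dyadic_gt k (t' j); have := dyadic_le k (t0 j).
by rewrite /t' mulrBr mulr1 => h1 h2; apply/andP; split; lra.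
Qed.

Let W : set rv := \bigcup_i box (enlarge (I i) (2 * eta i)).

(** By [unit_box_sub] the selected cells have measure above 1/2 for all large r, while the energy is
    below [G] for infinitely many r. At a common r, [mass_lower] and [capacity] bound the measure of
    [W] from below independently of the cover. *)
Lemma enlarged_cover_lower : ((lower_const G)%:E <= nu d.+1 W)%E.
Proof.
have mW : measurable W by apply: bigcup_measurable => i _; exact: measurable_box.
have [r [Er Br]] : exists r, energy Y r.+1%:R^-1 (LL (kr r)) (kr r) o < G /\
    ((2^-1 : R)%:E < nu n (B r))%E.
  have : ((2^-1 : R)%:E < limn_einf (nu n \o B))%E.
    apply: (@lt_le_trans _ _ 1%:E); first by rewrite lte_fin invf_lt1// ltr1n.
    apply: (le_trans _ (measure_liminf_le (nu n) mB)).
    apply: (@le_trans _ _ (nu n (box (0, const_mx 1)))).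
      rewrite le_eqVlt; apply/orP; left; apply/eqP/esym.
      apply: etrans; first exact: nu_box.
      by congr EFin; apply: big1 => j _; rewrite !mxE subr0 max_r.
    apply: le_measure; rewrite ?inE.
    - exact: measurable_box.
    - by apply: bigcup_measurable => m _; exact: bigcap_measurableType.
    - exact: unit_box_sub.
  rewrite limn_einfE_sup => /ereal_sup_gt[_ [m _ <-] hm].
  have : exists2 r, (m <= r)%N & energy Y r.+1%:R^-1 (LL (kr r)) (kr r) o < G.
    apply: contrapT => hn; move: energyG; apply/negP; rewrite -leNgt.
    apply: (le_trans _ (einfs_le_limn_einf _ m)).
    apply: le_ereal_inf_tmp => _ [r /= mr <-]; rewrite lee_fin leNgt; apply/negP => h.
    by apply: hn; exists r.
  move=> [r mr Er]; exists r; split=> //; apply: (lt_le_trans hm).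
  by apply: ereal_inf_lbound; exists r.
pose e : R := r.+1%:R^-1; have e0 : 0 < e by rewrite invr_gt0.
have Amass := mass_lower (k := kr r) (A := @A r) (fun a Aa => (asboolW Aa).2) Br.
have p0 : 0 < pi :> R := pi_gt0 R.
set E : R := 2 ^+ d.+1 * (expR (- (2 * n%:R)) / 2).
have E0 : 0 < E by rewrite !(mulr_gt0, exprn_gt0, divr_gt0, expR_gt0).
set D : R := (16 * pi) ^+ d.+1.
have D0 : 0 < D by rewrite exprn_gt0// mulr_gt0.
pose th : R := 2 * D * G / E; have th0 : 0 < th by rewrite divr_gt0 ?mulr_gt0.
have AW a x : @A r a -> (forall l, `|(x - pos Y (kr r) a o) ord0 l| <= e) -> W x.
  move=> /asboolP[[i [ei pi_]] _] xa; exists i => //; apply: (enlarge_near pi_) => l.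
  exact: le_trans (xa l) ei.
have wt0 := wt_ge0 (R := R) (n := n) (kr r) (M := LL (kr r)).
have := capacity wt0 e0 th0 (X := fun a => pos Y (kr r) a o) (A := @A r) mW AW.
have c0 : (0 <= nu d.+1 W)%E by exact: measure_ge0.
have -> : lower_const G = E / 2 / th by [].
case: (nu d.+1 W : \bar R) c0 => [x|_ _|//]; last exact: leey.
rewrite !lee_fin => x0 h.
have h1 : E <= 2 ^+ d.+1 * \sum_(a | @A r a) wt (kr r) a.
  by apply: ler_wpM2l; [exact: exprn_ge0|exact: Amass].
have h2 : th^-1 * (D * energy Y e (LL (kr r)) (kr r) o) <= E / 2.
  apply: (@le_trans _ _ (th^-1 * (D * G))).
    by rewrite ler_wpM2l ?invr_ge0 ?(ltW th0)// ler_wpM2l ?(ltW D0)// ltW.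
  by rewrite (_ : th^-1 * (D * G) = E / 2)// /th; field; rewrite !gt_eqF.
have h3 : E <= th * x + E / 2.
  by apply: (le_trans h1); apply: (le_trans h); apply: lerD; [exact: lexx|exact: h2].
by rewrite ler_pdivrMr//; nra.
Qed.

End cover.
End sufficiency.

Section sufficiency.
Context {R : realType} {dO} {Omega : measurableType dO}.
Context {d N : nat} (Y : 'I_N.+1 -> R -> Omega -> 'rV[R]_d.+1).
Local Notation n := N.+1.
Local Notation rv := (brv R d.+1).

(** The i-th box of a cover is enlarged at a cost of at most ep / 2^(i+1), so the bound for enlarged
    covers passes to the cover itself up to [ep]. *)
Lemma path_sums_lower (o : Omega) (kr : nat -> nat) (G : R) :
  (forall j, Y j 0 o = 0) ->
  (forall j t, 0 <= t -> Y j s o @[s --> t^'+] --> Y j t o) ->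
  (forall r, (r.+2 <= kr r)%N) -> 0 < G ->
  (limn_einf (fun r => (energy Y r.+1%:R^-1 (LL (kr r)) (kr r) o)%:E) < G%:E)%E ->
  ((lower_const (d := d) (N := N) G)%:E <= lebesgue_outer_rV (path_sums Y o))%E.
Proof.
move=> Y0 Yr kr2 G0 EG; apply: le_ereal_inf_tmp => _ [I cov <-].
apply/lee_addgt0Pr => ep ep0.
have p2 i : 0 < ep / (2 ^ i.+1)%:R by rewrite divr_gt0// ltr0n expn_gt0.
have [eta heta] : {eta : nat -> R & forall i, 0 < eta i /\
    box_volume (enlarge (I i) (2 * eta i)) <= box_volume (I i) + ep / (2 ^ i.+1)%:R}.
  apply: (@choice _ _ (fun i h => 0 < h /\ box_volume (enlarge (I i) (2 * h)) <= _)) => i.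
  by have [h h0 hv] := exists_enlarge (I i) (p2 i); exists h.
have eta0 i := (heta i).1.
apply: (le_trans (enlarged_cover_lower Y0 Yr kr2 G0 EG cov eta0)).
pose F i : set rv := box (enlarge (I i) (2 * eta i)).
have mF i : measurable (F i) by exact: measurable_box.
apply: (le_trans (measure_sigma_subadditive (A := \bigcup_i F i) (nu d.+1) mF
  (bigcup_measurable (fun i _ => mF i)) (fun x Fx => Fx))).
apply: (@le_trans _ _ (\sum_(i <oo) ((box_volume (I i))%:E + (ep / (2 ^ i.+1)%:R)%:E)%E)%E); last first.
  by apply: epsilon_trick => [i|]; [rewrite lee_fin box_volume_ge0|exact: ltW].
apply: lee_nneseries => [i _ _|i _]; first exact: measure_ge0.
rewrite -EFinD; apply: (@le_trans _ _ (box_volume (enlarge (I i) (2 * eta i)))%:E).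
  by rewrite le_eqVlt; apply/orP; left; apply/eqP; exact: nu_box.
by rewrite lee_fin; exact: (heta i).2.
Qed.

Context (P : probability Omega R).
Hypothesis levyY : forall j, levy_process P (Y j).
Hypothesis indepY : mutually_independent P (fun j => sigma_process (Y j)).
Context (Psi : 'I_n -> 'rV[R]_d.+1 -> R[i]).
Hypothesis expY : forall j, has_levy_exponent P (Y j) (Psi j).

Lemma IQ_rhos_le (e : R) : 0 < e ->
  ((IQ e (rhos Psi))%:E <= \int[nu d.+1]_xi (rhos Psi xi)%:E)%E.
Proof.
move=> e0; have b := bmf_rhos levyY expY; have r0 := rhos_ge0 levyY expY.
rewrite (EFin_IQ e0 b); apply: ge0_le_integral => //.
- by move=> x _; rewrite lee_fin mulr_ge0 ?qk_ge0 ?r0.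
- apply/measurable_EFinP; apply: measurable_funM; last exact: b.1.
  exact: measurable_qk.
- by apply/measurable_EFinP; exact: b.1.
move=> x _; rewrite lee_fin ler_piMl ?r0//.
rewrite -[leRHS](expr1n _ d.+1) -[X in _ ^+ X](card_ord d.+1) -prodr_const.
apply: ler_prod => i _; rewrite expR_ge0 /= /lap -[leRHS](expR0 R) ler_expR.
by rewrite mulNr oppr_le0 mulr_ge0// ltW.
Qed.

Lemma integral_path_sums_gt0 : (\int[nu d.+1]_xi (rhos Psi xi)%:E < +oo)%E ->
  (0 < \int[P]_o lebesgue_outer_rV (path_sums Y o))%E.
Proof.
move=> fin; have r0 := rhos_ge0 levyY expY.
set kap := (\int[nu d.+1]_xi (rhos Psi xi)%:E)%E in fin.
have kap0 : (0 <= kap)%E by apply: integral_ge0 => x _; rewrite lee_fin r0.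
have kfin : kap \is a fin_num by rewrite ge0_fin_numE.
(* The added 1 puts the limit of the expected energies, which is at most [fine kap], strictly below
   [C], so that a finite k already satisfies the bound. *)
pose C := fine kap + 1; have C0 : 0 < C by rewrite ltr_wpDl// fine_ge0.
have er0 r : 0 < r.+1%:R^-1 :> R by rewrite invr_gt0.
have [kr hkr] : {kr : nat -> nat & forall r, (r.+2 <= kr r)%N /\
    \int[P]_o energy Y r.+1%:R^-1 (LL (kr r)) (kr r) o <= C}.
  apply: (@choice _ _ (fun r k => (r.+2 <= k)%N /\
    \int[P]_o energy Y r.+1%:R^-1 (LL k) k o <= C)) => r.
  have hB := @IQ_gB_cvg _ _ _ _ _ _ _ levyY _ expY _ (er0 r) LL (fun k => leqnn _).
  have lt : IQ r.+1%:R^-1 (rhos Psi) < C.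
    rewrite /C ltr_pwDr// -lee_fin [leRHS]fineK//; exact: (IQ_rhos_le (er0 r)).
  have [k0 _ hk] := cvgr_lt _ hB _ lt.
  exists (maxn r.+2 k0); split; first exact: leq_maxl.
  rewrite (expectation_energy levyY (er0 r) indepY expY).
  by apply: ltW; apply: hk; exact: leq_maxr.
pose E r (o : Omega) : \bar R := (energy Y r.+1%:R^-1 (LL (kr r)) (kr r) o)%:E.
have bE r := bmf_energy levyY (er0 r) (LL (kr r)) (kr r).
have E0 r o : (0 <= E r o)%E by rewrite lee_fin energy_ge0.
have mE r : measurable_fun setT (E r) by apply/measurable_EFinP; exact: (bE r).1.
pose g o := limn_einf (E ^~ o).
have mg : measurable_fun setT g by exact: measurable_fun_limn_einf.
have g0 o : (0 <= g o)%E by exact: limn_einf_ge0.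
have intg : (\int[P]_o g o <= C%:E)%E.
  apply: (le_trans (fatou P measurableT _ _)) => //.
  apply: (limn_einf_le_near (n0 := 0)) => r _.
  by rewrite -(EFin_Rintegral P (bE r)) lee_fin; exact: (hkr r).2.
pose G := 2 * C; have G0 : 0 < G by rewrite mulr_gt0.
pose A := [set o | (g o < G%:E)%E].
have mA : measurable A.
  rewrite (_ : A = setT `&` g @^-1` [set x | (x < G%:E)%E]); last by rewrite setTI.
  apply: mg => //; rewrite (_ : mkset _ = `]-oo, G%:E[%classic); first exact: emeasurable_itv.
  by apply/seteqP; split=> x /=; rewrite in_itv.
(* Otherwise g >= 2 C almost surely, against its integral being at most C. *)
have PA : (0 < P A)%E.
  rewrite lt0e measure_ge0 andbT; apply/eqP => PA0.
  have : (G%:E <= \int[P]_o g o)%E.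
    rewrite -[leLHS]mule1 -(@probability_setT _ _ _ P) -integral_cst//.
    apply: le_integral_nonmeasurable => //; first by move=> o; rewrite lee_fin ltW.
    exists A; split=> // o /= h; rewrite /A /= ltNge; apply/negP => h'; exact: h.
  apply/negP; rewrite -ltNge; apply: (le_lt_trans intg).
  by rewrite lte_fin /G; lra.
have [Nn [mN N0 Nreg]] := ae_regular levyY.
have c0 := lower_const_gt0 (d := d) (N := N) G0.
set c := lower_const G in c0.
(* The volume of the range need not be a measurable function of the path, so its integral is bounded
   below by that of a simple function under it: the constant [c] on the good paths outside the
   exceptional null set. *)
apply: (@lt_le_trans _ _ (\int[P]_o (c * \1_(A `\` Nn) o)%:E)%E).
  under eq_integral do rewrite EFinM.
  rewrite ge0_integralZl//; last 2 first.
  - by apply/measurable_EFinP; apply: measurable_indic; exact: measurableD.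
  - by rewrite lee_fin ltW.
  rewrite integral_indic ?setIT//; last exact: measurableD.
  rewrite mule_gt0 ?lte_fin//.
  rewrite lt0e measure_ge0 andbT; apply/eqP => AN0.
  move: PA; rewrite lt_neqAle measure_ge0 andbT => /eqP; apply; apply/esym/eqP.
  rewrite eq_le measure_ge0 andbT; apply: (@le_trans _ _ (P ((A `\` Nn) `|` Nn))).
    apply: le_measure; rewrite ?inE//; first by apply: measurableU => //; exact: measurableD.
    by move=> x Ax; have [Nx|Nx] := pselect (Nn x); [right|left].
  apply: (le_trans (measureU2 _ _ _)) => //; first exact: measurableD.
  rewrite -[leRHS]adde0; apply: leeD; rewrite le_eqVlt; apply/orP; left; apply/eqP; [exact: AN0|exact: N0].
apply: le_integral_nonneg => //.
- by move=> o; rewrite lee_fin mulr_ge0// ltW.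
- by move=> o; exact: outer_measure_ge0.
move=> o; rewrite indicE; case: (boolP (o \in _)) => [/set_mem[Ao No]|_]; last first.
  by rewrite mulr0; exact: outer_measure_ge0.
rewrite mulr1.
have [Y0 Yr] : (forall j, Y j 0 o = 0) /\
    (forall j t, 0 <= t -> Y j s o @[s --> t^'+] --> Y j t o).
  by apply: contrapT => h; exact: No (Nreg _ h).
by apply: (path_sums_lower Y0 Yr (fun r => (hkr r).1)).
Qed.

End sufficiency.

Theorem theorem1p1 (R : realType) (dO : measure_display)
    (Omega : measurableType dO) (P : probability Omega R) (N d : nat)
    (X : 'rV[R]_N.+1 -> Omega -> 'rV[R]_d.+1)
    (Psi : 'I_N.+1 -> 'rV[R]_d.+1 -> R[i]) :
  additive_levy_process P X Psi ->
  (0 < \int[P]_w lebesgue_measure_rV R d (path_range X w))%E <->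
  (\int[lebesgue_measure_rV R d]_xi
     (\prod_j complex.Re (1 / (1 + Psi j xi)))%:E < +oo)%E.
Proof.
move=> [Y [levyY expY indepY XE]].
have rangeE w : path_range X w = path_sums Y w.
  apply/seteqP; split=> x.
    by move=> [t t0 <-]; exists (t ord0) => //; rewrite XE.
  move=> [t t0 <-]; exists (\row_j t j); first by move=> j; rewrite mxE.
  by rewrite XE; [apply: eq_bigr => j _; rewrite mxE|move=> j; rewrite mxE].
rewrite (_ : (\int[P]_w _)%E = (\int[P]_w lebesgue_outer_rV (path_sums Y w))%E); last first.
  by apply: eq_integral => w _; rewrite rangeE.
have b := bmf_rhos levyY expY; have r0 := rhos_ge0 levyY expY.
rewrite (_ : (\int[lebesgue_measure_rV R d]_xi _)%E = (\int[nu d.+1]_xi (rhos Psi xi)%:E)%E).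
  by split; [exact: integral_rhos_lty|exact: integral_path_sums_gt0].
apply: (integral_lebesgue_rV (f := fun xi => (rhos Psi xi)%:E)).
  by apply/measurable_EFinP; exact: b.1.
by move=> xi; rewrite lee_fin r0.
Qed.
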